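(* $\textsc{BNSL}^{+}_{\leq}$ is W[1]-hard when parameterized by the treewidth of the superstructure graph.
   Context: Let $V$ be a finite set and $\mathcal{F}=\{f_v:2^{V\setminus\{v\}}\to\mathbb{N}_0 : v\in V\}$. For a digraph $D=(V,A)$ let $P_D(v)=\{u:uv\in A\}$ and $\texttt{score}(D)=\sum_v f_v(P_D(v))$. In the additive representation, $f_v(Q)=\sum_{x\in Q}f_v(\{x\})$ for all $v$ and $Q\subseteq V\setminus\{v\}$, and $\mathcal{F}$ is given by the values $f_v(\{x\})$. $\textsc{BNSL}^{+}_{\leq}$: given $V$, $\mathcal{F}$ in the additive representation and integers $\ell,q$, decide whether there is an acyclic digraph $D$ on $V$ with all in-degrees at most $q$ and $\texttt{score}(D)\geq\ell$ ($q$ is part of the input, not part of the parameter). The superstructure graph $G=(V,E)$ has $ab\in E$ iff $f_b(\{a\})\neq0$ or $f_a(\{b\})\neq0$. *)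

(* Defs.v *)
From mathcomp Require Import all_boot all_order all_algebra.
From mathcomp Require Import boolp.

Set Implicit Arguments.
Unset Strict Implicit.
Unset Printing Implicit Defensive.

(** * Machine model

  A random access machine in structured form: a program uses finitely many
  registers, addressed directly, and a heap, addressed indirectly.  Registers
  and heap cells hold natural numbers; arithmetic is addition, truncated
  subtraction and halving at unit cost.  There is no unit-cost multiplication, so the bit length of every stored number grows by
  at most a program-dependent constant per step and the model is polynomially
  equivalent to Turing machines. *)

Inductive expr : Type :=
| Const of nat
| Reg of nat
| Mem of expr
| Add of expr & expr
| Sub of expr & expr
| Half of expr.

Inductive cmd : Type :=
| Skip
| SetReg of nat & expr
| SetMem of expr & expr
| Seq of cmd & cmd
| If of expr & cmd & cmd
| While of expr & cmd.

Record state : Type := State { regs : nat -> nat; heap : nat -> nat }.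

Definition update (m : nat -> nat) (a b : nat) : nat -> nat :=
  fun i => if i == a then b else m i.

Fixpoint eval (s : state) (e : expr) : nat :=
  match e with
  | Const n => n
  | Reg r => regs s r
  | Mem e1 => heap s (eval s e1)
  | Add e1 e2 => eval s e1 + eval s e2
  | Sub e1 e2 => eval s e1 - eval s e2
  | Half e1 => (eval s e1)./2
  end.

(* [exec c s t s']: started in [s], the program [c] halts in [s'] after exactly
   [t] steps, a step being an assignment, a skip or a test.  An expression has
   a size fixed by the program, so it is charged one step. *)
Inductive exec : cmd -> state -> nat -> state -> Prop :=
| ExecSkip s : exec Skip s 1 s
| ExecSetReg s r e :
    exec (SetReg r e) s 1 (State (update (regs s) r (eval s e)) (heap s))
| ExecSetMem s e1 e2 :
    exec (SetMem e1 e2) s 1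
      (State (regs s) (update (heap s) (eval s e1) (eval s e2)))
| ExecSeq c1 c2 s1 s2 s3 t1 t2 :
    exec c1 s1 t1 s2 -> exec c2 s2 t2 s3 ->
    exec (Seq c1 c2) s1 (t1 + t2) s3
| ExecIfTrue e c1 c2 s s' t :
    eval s e != 0 -> exec c1 s t s' -> exec (If e c1 c2) s t.+1 s'
| ExecIfFalse e c1 c2 s s' t :
    eval s e = 0 -> exec c2 s t s' -> exec (If e c1 c2) s t.+1 s'
| ExecWhileFalse e c s :
    eval s e = 0 -> exec (While e c) s 1 s
| ExecWhileTrue e c s1 s2 s3 t1 t2 :
    eval s1 e != 0 -> exec c s1 t1 s2 -> exec (While e c) s2 t2 s3 ->
    exec (While e c) s1 (t1 + t2).+1 s3.

(* A word is a finite sequence of naturals; it is stored in the heap cells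
   0, 1, ..., with its length in register 0. *)
Definition word : Type := seq nat.

Definition load (x : word) : state :=
  State (fun r => if r == 0 then size x else 0) (fun i => nth 0 x i).

Definition output (s : state) : word := mkseq (heap s) (regs s 0).

(* Emitting a letter of the output costs one step: register 0 could otherwise
   declare an output exponentially longer than the running time. *)
Definition computes_in (c : cmd) (x y : word) (t : nat) : Prop :=
  exists (t' : nat) (s : state),
    [/\ exec c (load x) t' s, output s = y & t' + size y <= t].

Definition computable (f : nat -> nat) : Prop :=
  exists c : cmd, forall n : nat, exists t : nat,
    computes_in c [:: n] [:: f n] t.

(* Total length of the binary representations of the letters. *)
Definition bitsize (x : word) : nat := \sum_(a <- x) (trunc_log 2 a).+1.

(** * Parameterized problems, fpt-reductions and W[1] *)

(* The parameterization is not required to be computable in polynomial time: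
   computing the treewidth is NP-hard. *)
Record pproblem : Type := PProblem {
  lang : word -> Prop;
  param : word -> nat
}.

Definition fpt_reducible (A B : pproblem) : Prop :=
  exists (c : cmd) (R : word -> word) (f g : nat -> nat) (e : nat),
    [/\ computable f,
        computable g,
        forall x, computes_in c x (R x) (f (param A x) * (bitsize x).+1 ^ e),
        forall x, lang A x <-> lang B (R x)
      & forall x, param B (R x) <= g (param A x)].

(* Boolean circuits, with the gates listed in a topological order and referred
   to by position; the output gate is the last one.  Gates of in-degree 0 are
   inputs, those of in-degree 1 are negations, those of in-degree at least 2
   are conjunctions or disjunctions. *)
Inductive gate : Type :=
| Input
| Neg of nat
| And of seq nat
| Or of seq nat.

Definition circuit : Type := seq gate.

Definition preds (g : gate) : seq nat :=
  match g with
  | Input => [::]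
  | Neg i => [:: i]
  | And s | Or s => s
  end.

Definition is_input (g : gate) : bool := if g is Input then true else false.

Definition wf_gate (g : gate) : bool :=
  match g with
  | And s | Or s => (1 < size s) && uniq s
  | _ => true
  end.

Definition wf_circuit (C : circuit) : bool :=
  [&& 0 < size C, all wf_gate C
    & all (fun i => all (fun j => j < i) (preds (nth Input C i)))
          (iota 0 (size C))].

(* The values at all gates, [F vs g] computing the value at the gate [g] from
   the list [vs] of the values at the preceding gates. *)
Definition gate_values (T : Type) (F : seq T -> gate -> T) (C : circuit) :
    seq T :=
  foldl (fun vs g => rcons vs (F vs g)) [::] C.

(* [a i] is the value of the input gate at position [i]. *)
Definition circuit_eval (a : nat -> bool) (C : circuit) : bool :=
  last false (gate_values (fun vs g =>
    match g with
    | Input => a (size vs)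
    | Neg i => ~~ nth false vs i
    | And s => all (nth false vs) s
    | Or s => has (nth false vs) s
    end) C).

Definition circuit_depth (C : circuit) : nat :=
  last 0 (gate_values (fun vs g =>
    if is_input g then 0 else (\max_(i <- preds g) nth 0 vs i).+1) C).

(* Largest number of gates of in-degree greater than 2 on a path from an input
   to the output. *)
Definition circuit_weft (C : circuit) : nat :=
  last 0 (gate_values (fun vs g =>
    (2 < size (preds g)) + \max_(i <- preds g) nth 0 vs i) C).

Definition weight (a : nat -> bool) (C : circuit) : nat :=
  count (fun i => is_input (nth Input C i) && a i) (iota 0 (size C)).

Definition encode_gate (g : gate) : word :=
  match g with
  | Input => [:: 0]
  | Neg i => [:: 1; i]
  | And s => [:: 2, size s & s]
  | Or s => [:: 3, size s & s]
  end.

Definition encode_circuit (C : circuit) : word :=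
  size C :: flatten (map encode_gate C).

(* Weighted satisfiability of circuits of weft at most [t] and depth at most
   [d], parameterized by the weight [k]. *)
Definition weighted_circuit_sat (t d : nat) : pproblem := {|
  lang := fun x => exists (k : nat) (C : circuit),
    [/\ x = k :: encode_circuit C,
        wf_circuit C,
        circuit_weft C <= t,
        circuit_depth C <= d
      & exists a : nat -> bool, weight a C = k /\ circuit_eval a C];
  param := fun x => head 0 x
|}.

Definition in_W (t : nat) (A : pproblem) : Prop :=
  exists d : nat, fpt_reducible A (weighted_circuit_sat t d).

Definition W_hard (t : nat) (B : pproblem) : Prop :=
  forall A : pproblem, in_W t A -> fpt_reducible A B.

(** * Treewidth *)

Definition is_tree (T : finType) (e : rel T) : Prop :=
  [/\ 0 < #|T|,
      symmetric e /\ irreflexive e,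
      forall x y : T, connect e x y
    & forall c : seq T, 2 < size c -> ~~ ucycleb e c].

Definition is_tree_decomposition (V : finType) (G : rel V)
    (T : finType) (e : rel T) (B : T -> {set V}) : Prop :=
  [/\ is_tree e,
      forall v : V, exists x : T, v \in B x,
      forall u v : V, G u v -> exists x : T, (u \in B x) && (v \in B x)
    & forall (v : V) (x y : T), v \in B x -> v \in B y ->
        connect [rel a b | [&& e a b, v \in B a & v \in B b]] x y].

Definition treewidth_at_most (V : finType) (G : rel V) (k : nat) : Prop :=
  exists (T : finType) (e : rel T) (B : T -> {set V}),
    is_tree_decomposition G e B /\ forall x : T, #|B x| <= k.+1.

Lemma treewidth_subproof (V : finType) (G : rel V) :
  exists k : nat, `[< treewidth_at_most G k >].
Proof.
exists #|V|; apply/asboolP.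
exists unit, (fun _ _ => false), (fun _ => setT); split; last first.
  by move=> x; rewrite cardsT.
split.
- split=> //; first by rewrite card_unit.
  + by case=> -[].
  + by case=> [|x [|y c]] //= _; rewrite /ucycleb.
- by move=> v; exists tt; rewrite inE.
- by move=> u v _; exists tt; rewrite !inE.
- by move=> v [] [] _ _.
Qed.

(* For the graph without vertices this is 0, not -1. *)
Definition treewidth (V : finType) (G : rel V) : nat :=
  ex_minn (treewidth_subproof G).

(** * Bayesian network structure learning *)

Section ScoreFunctions.
Variable V : finType.

(* Only the values [f v Q] with [v \notin Q] are meaningful. *)
Implicit Types (f : V -> {set V} -> nat) (D : rel V).

Definition parents D (v : V) : {set V} := [set u | D u v].

Definition score f D : nat := \sum_(v : V) f v (parents D v).

Definition acyclic D : Prop :=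
  forall c : seq V, c != [::] -> ~~ cycle D c.

Definition additive_scores f : Prop :=
  forall (v : V) (Q : {set V}),
    v \notin Q -> f v Q = \sum_(x in Q) f v [set x].

Definition superstructure f : rel V :=
  fun a b => (a != b) && ((f b [set a] != 0) || (f a [set b] != 0)).

End ScoreFunctions.

Record bnsl_instance : Type := BnslInstance {
  bn_size : nat;
  bn_f : 'I_bn_size -> {set 'I_bn_size} -> nat;
  bn_additive : additive_scores bn_f;
  bn_ell : int;
  bn_q : int
}.

Definition bnsl_yes (I : bnsl_instance) : Prop :=
  exists D : rel 'I_(bn_size I),
    [/\ acyclic D,
        forall v, (#|parents D v|%:Z <= bn_q I)%R
      & (bn_ell I <= (score (@bn_f I) D)%:Z)%R].

(* [w] lists the values f_v({u}), u != v, row by row. *)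
Definition table_scores (n : nat) (w : seq nat) (v : 'I_n) (Q : {set 'I_n}) :
    nat :=
  \sum_(u in Q) nth 0 w (v * n.-1 + unbump v u).

Lemma table_scores_additive (n : nat) (w : seq nat) :
  additive_scores (@table_scores n w).
Proof. by move=> v Q _; apply: eq_bigr => u _; rewrite /table_scores big_set1. Qed.

Definition decode_int (s a : nat) : int :=
  (if s == 0%N then a%:Z else - a%:Z)%R.

Definition decode_bnsl (x : word) : option bnsl_instance :=
  if x is [:: n, sl, l, sq, q & w] then
    if size w == n * n.-1 then
      Some (BnslInstance (@table_scores_additive n w)
              (decode_int sl l) (decode_int sq q))
    else None
  else None.

Definition bnsl_treewidth : pproblem := {|
  lang := fun x => if decode_bnsl x is Some i then bnsl_yes i else False;
  param := fun x =>
    if decode_bnsl x is Some i then treewidth (superstructure (@bn_f i)) else 0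
|}.

(* Main.v *)
(**
  A circuit of weft 1 is evaluated as a game: the prover picks a true child of
  every disjunction and a false child of every refuted conjunction, so that the
  circuit is true under an assignment of weight [k] iff there are boundedly many
  choices, together with the sorted list of the [k] true inputs, such that none of
  the claims reached in the game, which goes down to the children of the large
  universal gates, is refuted.  Each such claim depends on boundedly many inputs,
  and whether an input is true can be read off the two list elements around it;
  hence a claim is refuted by a bounded number of the list elements.  This is a constraint satisfaction problem with
  [O(k)] variables of domain size [O(n)] and constraints of bounded arity.

  The latter is expressed by choosing one item in each of boundedly many classes
  subject to boundedly many unary capacity constraints, equality of two chosen
  values [u] and [z] being [u + (q - z) <= q] and [(q - u) + z <= q].  In the BNSL
  instance the capacity constraints are the bounds on the in-degrees, and the
  vertices carrying them are, with one selector per class, contained in all bags of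
  a tree decomposition.  The other vertices form a forest.
*)
From mathcomp Require Import all_boot all_order all_algebra.
From mathcomp Require Import boolp zify.
Require Import Defs.

Set Implicit Arguments.
Unset Strict Implicit.
Unset Printing Implicit Defensive.

(** * Evaluating functions on a random access machine *)

(** Two restrictions shape the construction. The depth is a constant of the problem whereas the
    number of gates is not, so all [s]-tuples of variables may be enumerated ([K ^ s] of them, a
    function of the parameter), but nothing of the size of the circuit may enter the bags. It enters
    as amounts instead, that is, as numbers of leaves; writing them in unary is affordable because
    values are at most [G + 1]. Moreover one degree bound [q] serves all vertices: every counter has
    the same capacity, amounts are complemented with respect to it, and selectors are padded with
    fillers until a single place is left for a hub. That the reduction is a program is shown in a
    small calculus of polynomial-time functions ([ev], [pb]) closed under bounded iteration.
    Recursion occurs only to constant depth and turns into nested loops. *)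

Lemma poly_add m a b : 1 < m -> m ^ a + m ^ b <= m ^ (a + b).+1.
Proof.
move=> m1; have m0 : 0 < m by lia.
have := leq_pexp2l m0 (leq_addr b a); have := leq_pexp2l m0 (leq_addl a b).
by rewrite expnS; nia.
Qed.

Lemma poly_const m c : 1 < m -> c <= m ^ c.
Proof. by move=> m1; apply: ltnW; apply: ltn_expl. Qed.

Definition agree (k : nat) (s s' : state) : Prop :=
  (forall r, r < k -> regs s' r = regs s r) /\
  (forall i, i < regs s 0 -> heap s' i = heap s i).

(* [rep e s]: the state [s] holds the environment [e] in the registers below
   [lvl], the input word being stored in the heap and its length in register 0.
   Running times are measured against powers of [msr e]. *)
Record ctx : Type := Ctx {
  env : Type;
  inp : env -> word;
  msr : env -> nat;
  lvl : nat;
  rep : env -> state -> Prop;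
  msr_gt1 : forall e, 1 < msr e;
  size_msr : forall e, size (inp e) <= msr e;
  lvl_gt0 : 0 < lvl;
  rep_inp : forall e s, rep e s -> regs s 0 = size (inp e) /\
    forall i, i < size (inp e) -> heap s i = nth 0 (inp e) i;
  rep_ext : forall e s s', agree lvl s s' -> rep e s -> rep e s'
}.

Definition runs (c : cmd) (s : state) (T k v : nat) : Prop :=
  exists t s', [/\ exec c s t s', t <= T, regs s' k = v,
    forall r, r < k -> regs s' r = regs s r & heap s' = heap s].

(* [F] is computed in time polynomial in [msr] by a program that writes its
   result in a register [k] of choice and preserves the registers below [k] and
   the heap. *)
Definition ev (C : ctx) (F : env C -> nat) : Prop :=
  forall k, lvl C <= k -> exists c d, forall e s, rep e s ->
    runs c s (msr e ^ d) k (F e).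

(** Only environments held by some state count, so that a loop index gets its bound from the
    invariant of its context. *)
Definition pb (C : ctx) (F : env C -> nat) : Prop :=
  exists d, forall e s, rep e s -> F e <= msr e ^ d.

(** Words are never computed: the input is the only word that can be read. *)
Definition evw (C : ctx) (X : env C -> word) : Prop := forall e, X e = inp e.

(** Weakening along [pr], stated as closure of the three judgements so that it composes when loops
    are nested. *)
Definition extends (C C' : ctx) (pr : env C' -> env C) : Prop :=
  [/\ forall F, ev F -> ev (fun e => F (pr e)),
      forall F, pb F -> pb (fun e => F (pr e))
    & forall X, evw X -> evw (fun e => X (pr e))].

Section Ext.
Variables (C : ctx) (k : nat) (P : env C -> nat -> Prop) (hk : lvl C <= k).

Definition ext_rep (p : env C * nat) (s : state) : Prop :=
  [/\ rep p.1 s, regs s k = p.2 & P p.1 p.2].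

Lemma ext_rep_inp p s : ext_rep p s -> regs s 0 = size (inp p.1) /\
  forall i, i < size (inp p.1) -> heap s i = nth 0 (inp p.1) i.
Proof. by case=> /rep_inp. Qed.

Lemma ext_rep_ext p s s' : agree k.+1 s s' -> ext_rep p s -> ext_rep p s'.
Proof.
case=> hr hh [r1 r2 r3]; split=> //; last by rewrite hr.
by apply: rep_ext r1; split=> // r lt; apply: hr; lia.
Qed.

Definition ext : ctx :=
  @Ctx (env C * nat) (fun p => inp p.1) (fun p => msr p.1) k.+1 ext_rep
    (fun p => msr_gt1 p.1) (fun p => size_msr p.1) (ltn0Sn k) ext_rep_inp ext_rep_ext.

Lemma ext_extends : @extends C ext fst.
Proof.
split.
- move=> F hF k' hk'; have [|c [d hc]] := hF k'; first by move: hk' => /=; lia.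
  by exists c, d => e s [re _ _]; apply: hc.
- by move=> F [d hd]; exists d => e s [re _ _]; apply: (hd _ s).
- by move=> X hX e; apply: hX.
Qed.

Lemma ev_ext_var : @ev ext snd.
Proof.
move=> k' hk'; exists (SetReg k' (Reg k)), 0 => e s [_ h _].
exists 1, (State (update (regs s) k' (regs s k)) (heap s)).
split=> //=; first exact: ExecSetReg.
  by rewrite /update eqxx.
by move=> r lt; rewrite /update; case: eqP => // ?; lia.
Qed.

End Ext.

Section Rules.
Variable C : ctx.
Implicit Types F : env C -> nat.

Lemma ev_eq F F' : F =1 F' -> ev F -> ev F'.
Proof.
move=> h hF k hk; have [c [d hc]] := hF k hk; exists c, d => e s re.
by rewrite -h; apply: hc.
Qed.

Lemma rep_agree (e : env C) s s' : rep e s -> heap s' = heap s ->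
  (forall r, r < lvl C -> regs s' r = regs s r) -> rep e s'.
Proof. by move=> re hh hr; apply: rep_ext re; split=> // i _; rewrite hh. Qed.

Lemma ev_op0 (F : env C -> nat) (x : nat -> expr) :
  (forall k (e : env C) s, rep e s -> eval s (x k) = F e) -> ev F.
Proof.
move=> hx k hk; exists (SetReg k (x k)), 0 => e s re.
exists 1, (State (update (regs s) k (eval s (x k))) (heap s)).
split=> //=; first exact: ExecSetReg.
  by rewrite /update eqxx; apply: hx.
by move=> r lt; rewrite /update; case: eqP => // ?; lia.
Qed.

Lemma ev_op2 (op : nat -> nat -> nat) (x : nat -> expr) F1 F2 :
  (forall k s, eval s (x k) = op (regs s k) (regs s k.+1)) ->
  ev F1 -> ev F2 -> ev (fun e => op (F1 e) (F2 e)).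
Proof.
move=> hx h1 h2 k hk.
have [c1 [d1 hc1]] := h1 k hk; have [c2 [d2 hc2]] := h2 k.+1 (leqW hk).
(* The second operand is computed in register [k.+1], which leaves the first one in [k] intact. The
   exponent adds both costs and the final assignment, of cost [msr e ^ 0]. *)
exists (Seq c1 (Seq c2 (SetReg k (x k)))), ((d1 + d2).+1 + 0).+1 => e s re.
have [t1 [s1 [x1 lt1 v1 r1 m1]]] := hc1 _ _ re.
have re1 : rep e s1 by apply: rep_agree re _ _ => // r lt; apply: r1; lia.
have [t2 [s2 [x2 lt2 v2 r2 m2]]] := hc2 _ _ re1.
exists (t1 + (t2 + 1)), (State (update (regs s2) k (eval s2 (x k))) (heap s2)).
split=> //=.
- by apply: ExecSeq x1 (ExecSeq x2 _); apply: ExecSetReg.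
- have m := msr_gt1 e; apply: leq_trans (poly_add _ _ m).
  by have := poly_add d1 d2 m; rewrite expn0; lia.
- by rewrite /update eqxx hx v2 r2 // v1.
- move=> r lt; rewrite /update; case: eqP => [?|_]; first by lia.
  by rewrite r2 ?r1 //; lia.
- by rewrite m2.
Qed.

Lemma ev_op1 (op : nat -> nat) (x : nat -> expr) F1 :
  (forall k s, eval s (x k) = op (regs s k)) ->
  ev F1 -> ev (fun e => op (F1 e)).
Proof. by move=> hx h; apply: (@ev_op2 (fun a _ => op a) x _ _ _ h h). Qed.

Lemma ev_const n : ev (fun _ : env C => n).
Proof. exact: (@ev_op0 _ (fun _ => Const n)). Qed.

Lemma ev_size X : @evw C X -> ev (fun e => size (X e)).
Proof.
move=> hX; apply: (@ev_op0 _ (fun _ => Reg 0)) => k e s /rep_inp [h _] /=.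
by rewrite h hX.
Qed.

Lemma ev_add F1 F2 : ev F1 -> ev F2 -> ev (fun e => F1 e + F2 e).
Proof. exact: (@ev_op2 addn (fun k => Add (Reg k) (Reg k.+1))). Qed.

Lemma ev_succ F : ev F -> ev (fun e => (F e).+1).
Proof.
by apply: (@ev_op1 succn (fun k => Add (Reg k) (Const 1))) => k s /=; rewrite addn1.
Qed.

Lemma ev_sub F1 F2 : ev F1 -> ev F2 -> ev (fun e => F1 e - F2 e).
Proof. exact: (@ev_op2 subn (fun k => Sub (Reg k) (Reg k.+1))). Qed.

Lemma ev_pred F : ev F -> ev (fun e => (F e).-1).
Proof.
by apply: (@ev_op1 predn (fun k => Sub (Reg k) (Const 1))) => k s /=; rewrite subn1.
Qed.

Lemma ev_leq F1 F2 : ev F1 -> ev F2 -> ev (fun e => (F1 e <= F2 e : nat)).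
Proof.
apply: (@ev_op2 (fun a b => a <= b)
  (fun k => Sub (Const 1) (Sub (Reg k) (Reg k.+1)))) => k s /=; lia.
Qed.

Lemma ev_eqn F1 F2 : ev F1 -> ev F2 -> ev (fun e => (F1 e == F2 e : nat)).
Proof.
apply: (@ev_op2 (fun a b => a == b)
  (fun k => Sub (Const 1) (Add (Sub (Reg k) (Reg k.+1)) (Sub (Reg k.+1) (Reg k)))))
  => k s /=; lia.
Qed.

Lemma ev_not (b : env C -> bool) :
  ev (fun e => (b e : nat)) -> ev (fun e => (~~ b e : nat)).
Proof.
move=> h; apply: (@ev_eq (fun e => 1 - b e)); first by move=> e; case: (b e).
by apply: ev_sub h; apply: ev_const.
Qed.

Lemma ev_and (b1 b2 : env C -> bool) :
  ev (fun e => (b1 e : nat)) -> ev (fun e => (b2 e : nat)) ->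
  ev (fun e => (b1 e && b2 e : nat)).
Proof.
move=> h1 h2; apply: (@ev_eq (fun e => b1 e + b2 e - 1)).
  by move=> e; case: (b1 e); case: (b2 e).
by apply: ev_sub; [apply: ev_add|apply: ev_const].
Qed.

Lemma ev_or (b1 b2 : env C -> bool) :
  ev (fun e => (b1 e : nat)) -> ev (fun e => (b2 e : nat)) ->
  ev (fun e => (b1 e || b2 e : nat)).
Proof.
move=> h1 h2; apply: (@ev_eq (fun e => (0 < b1 e + b2 e : nat))).
  by move=> e; case: (b1 e); case: (b2 e).
by apply: ev_leq; [apply: ev_const|apply: ev_add].
Qed.

Lemma ev_if (b : env C -> bool) F1 F2 :
  ev (fun e => (b e : nat)) -> ev F1 -> ev F2 ->
  ev (fun e => if b e then F1 e else F2 e).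
Proof.
move=> h0 h1 h2 k hk.
have [c0 [d0 hc0]] := h0 k hk.
have [c1 [d1 hc1]] := h1 k hk; have [c2 [d2 hc2]] := h2 k hk.
exists (Seq c0 (If (Reg k) c1 c2)), ((d0 + 0).+1 + (d1 + d2).+1).+1 => e s re.
have [t0 [s0 [x0 lt0 v0 r0 m0]]] := hc0 _ _ re.
have re0 : rep e s0 by apply: rep_agree re _ _ => // r lt; apply: r0; lia.
have [t1 [s1 [x1 lt1 v1 r1 m1]]] := hc1 _ _ re0.
have [t2 [s2 [x2 lt2 v2 r2 m2]]] := hc2 _ _ re0.
have m := msr_gt1 e.
have H := poly_add (d0 + 0).+1 (d1 + d2).+1 m.
have H1 := poly_add d1 d2 m; have H0 := poly_add d0 0 m; rewrite expn0 in H0.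
case: (boolP (b e)) => be; rewrite ?be ?(negbTE be) in v0.
- exists (t0 + t1.+1), s1; split=> //.
  + by apply: (ExecSeq x0); apply: ExecIfTrue x1; rewrite /= v0.
  + by lia.
  + by move=> r lt; rewrite r1 ?r0.
  + by rewrite m1.
- exists (t0 + t2.+1), s2; split=> //.
  + by apply: (ExecSeq x0); apply: ExecIfFalse x2; rewrite /= v0.
  + by lia.
  + by move=> r lt; rewrite r2 ?r0.
  + by rewrite m2.
Qed.

(** Cells behind the input may hold anything, so the program compares the index with register 0 and
    supplies the default 0 itself. *)
Lemma ev_nth X F : @evw C X -> ev F -> ev (fun e => nth 0 (X e) (F e)).
Proof.
move=> hX h k hk; have [c [d hc]] := h k hk.
exists (Seq c (If (Sub (Reg 0) (Reg k)) (SetReg k (Mem (Reg k))) (SetReg k (Const 0)))),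
  ((d + 0).+1 + 0).+1 => e s re.
have [t [s1 [x1 lt v1 r1 m1]]] := hc _ _ re.
have [r0 hh] := rep_inp re.
have k0 : 0 < k by have := lvl_gt0 C; lia.
have m := msr_gt1 e.
have H := poly_add (d + 0).+1 0 m; have H0 := poly_add d 0 m.
rewrite expn0 in H H0.
have up v r : r < k -> update (regs s1) k v r = regs s r.
  by move=> ltr; rewrite /update; case: eqP => [?|_]; [lia|apply: r1].
case: (ltnP (F e) (size (X e))) => hlt.
- exists (t + 2), (State (update (regs s1) k (heap s1 (regs s1 k))) (heap s1)).
  split=> //=.
  + apply: (ExecSeq x1 (t2 := 2)); apply: ExecIfTrue; last exact: ExecSetReg.
    by rewrite /= v1 r1 // r0 -hX; lia.
  + by lia.
  + by rewrite /update eqxx v1 m1 hh -?hX.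
  + exact: up.
- exists (t + 2), (State (update (regs s1) k 0) (heap s1)).
  split=> //=.
  + apply: (ExecSeq x1 (t2 := 2)); apply: ExecIfFalse; last exact: ExecSetReg.
    by rewrite /= v1 r1 // r0 -hX; lia.
  + by lia.
  + by rewrite /update eqxx nth_default.
  + exact: up.
Qed.

(** Registers [k] to [k.+3] hold the bound, the index, the accumulator and the result of one step.
    Only the number of rounds has to be polynomial; the accumulator may be large, since the cost
    counts steps and not digits. *)
Lemma ev_iter Fb F0 (step : env C -> nat -> nat -> nat) :
  ev Fb -> pb Fb -> ev F0 ->
  (forall C' (pr : env C' -> env C) (vi va : env C' -> nat),
     extends pr -> ev vi -> pb vi -> ev va ->
     ev (fun e => step (pr e) (vi e) (va e))) ->
  ev (fun e => iteri (Fb e) (step e) (F0 e)).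
Proof.
move=> hb [db hdb] h0 hstep k hk.
have hk1 : lvl C <= k.+1 by lia.
have [cb [d1 hcb]] := hb k hk.
have [c0 [d2 hc0]] := h0 k.+2 (leqW hk1).
pose C1 := @ext C k.+1 (fun e i => i < Fb e) hk1.
pose C2 := @ext C1 k.+2 (fun _ _ => True) (leqnn _).
have hs : @ev C2 (fun p => step p.1.1 p.1.2 p.2).
  have [a1 a2 a3] := ext_extends (fun e i => i < Fb e) hk1.
  have [b1 b2 b3] := @ext_extends C1 k.+2 (fun _ _ => True) (leqnn _).
  apply: (hstep C2 (fun p => p.1.1) (fun p => p.1.2) snd).
  - by split=> F hF; [exact: b1 (a1 _ hF)|exact: b2 (a2 _ hF)|exact: b3 (a3 _ hF)].
  - by apply: (b1 snd); apply: ev_ext_var.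
  - exists db => -[[e i] a] s [[/= r1 _ hi] _ _].
    by apply: leq_trans (hdb _ _ r1); apply: ltnW.
  - exact: ev_ext_var.
have [c3 [d3 hc3]] := hs k.+3 (leqnn _).
pose body := Seq c3 (Seq (SetReg k.+2 (Reg k.+3)) (SetReg k.+1 (Add (Reg k.+1) (Const 1)))).
pose loop := While (Sub (Reg k) (Reg k.+1)) body.
exists (Seq cb (Seq c0 (Seq (SetReg k.+1 (Const 0)) (Seq loop (SetReg k (Reg k.+2)))))),
  ((((d1 + d2).+1) + (db + (d3 + 3).+1)).+1 + 3).+1 => e s re.
have [t1 [s1 [x1 lt1 v1 r1 m1]]] := hcb _ _ re.
have re1 : rep e s1 by apply: rep_agree re _ _ => // r lt; apply: r1; lia.
have [t2 [s2 [x2 lt2 v2 r2 m2]]] := hc0 _ _ re1.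
pose s3 := State (update (regs s2) k.+1 0) (heap s2).
have x3 : exec (SetReg k.+1 (Const 0)) s2 1 s3 by apply: ExecSetReg.
have loopP n : forall s i, i + n = Fb e -> rep e s -> regs s k = Fb e ->
    regs s k.+1 = i -> regs s k.+2 = iteri i (step e) (F0 e) ->
    exists t s', [/\ exec loop s t s', t <= n * (msr e ^ d3 + 3) + 1,
      regs s' k.+2 = iteri (Fb e) (step e) (F0 e),
      forall r, r < k -> regs s' r = regs s r & heap s' = heap s].
  elim: n => [|n IH] sa i hin rea vk vi va.
    exists 1, sa; split=> //; last by rewrite va; congr iteri; lia.
    by apply: ExecWhileFalse; rewrite /= vk vi; lia.
  have [|t [sb [xb ltb vb rb mb]]] := hc3 ((e, i), iteri i (step e) (F0 e)) sa.
    by split=> //=; split=> //=; lia.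
  pose sc := State (update (update (regs sb) k.+2 (regs sb k.+3)) k.+1 i.+1) (heap sb).
  have xc : exec body sa (t + (1 + 1)) sc.
    apply: ExecSeq xb _; apply: ExecSeq; first exact: ExecSetReg.
    suff -> : sc = State (update (update (regs sb) k.+2 (regs sb k.+3)) k.+1
       (eval (State (update (regs sb) k.+2 (regs sb k.+3)) (heap sb))
         (Add (Reg k.+1) (Const 1)))) (heap sb) by apply: ExecSetReg.
    congr State; congr update; rewrite /= /update ifF; last by lia.
    by rewrite rb ?vi; lia.
  have rc r : r < k.+1 -> regs sc r = regs sa r.
    move=> lt; rewrite /= /update; case: eqP => [?|_]; first lia.
    by case: eqP => [?|_]; [lia|rewrite rb //; lia].
  have [|||||t' [s' [x' lt' v' r' m']]] := IH sc i.+1.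
  - by lia.
  - by apply: rep_agree rea _ _ => [|r lt]; [|apply: rc; lia].
  - by rewrite rc.
  - by rewrite /= /update eqxx.
  - by rewrite /= /update ifF ?eqxx ?vb //; lia.
  exists (t + (1 + 1) + t').+1, s'; split=> //.
  - by apply: ExecWhileTrue xc x'; rewrite /= vk vi; lia.
  - by move: ltb lt' => /=; rewrite mulSn; lia.
  - by move=> r lt; rewrite r' // rc //; lia.
  - by rewrite m' /= mb.
have u3 r : r <= k -> regs s3 r = regs s1 r.
  move=> lt; rewrite /= /update; case: eqP => [?|_]; first by lia.
  by apply: r2; lia.
have [|||||t4 [s4 [x4 lt4 v4 r4 m4]]] := loopP (Fb e) s3 0.
- by [].
- by apply: rep_agree re1 _ _ => [|r lt]; [|apply: u3; lia].
- by rewrite u3.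
- by rewrite /= /update eqxx.
- by rewrite /= /update ifF ?v2 //; lia.
exists (t1 + (t2 + (1 + (t4 + 1)))), (State (update (regs s4) k (regs s4 k.+2)) (heap s4)).
split=> //=.
- by apply: ExecSeq x1 (ExecSeq x2 (ExecSeq x3 (ExecSeq x4 _))); apply: ExecSetReg.
- have m := msr_gt1 e; have hb' := hdb _ _ re.
  have H3 := poly_add d3 3 m; have P3 := poly_const 3 m.
  have H12 := poly_add d1 d2 m.
  have HH := poly_add (d1 + d2).+1 (db + (d3 + 3).+1) m.
  have HHH := poly_add ((d1 + d2).+1 + (db + (d3 + 3).+1)).+1 3 m.
  have Q : Fb e * (msr e ^ d3 + 3) <= msr e ^ (db + (d3 + 3).+1).
    by rewrite expnD; apply: leq_mul => //; lia.
  lia.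
- by rewrite /update eqxx v4.
- move=> r lt; rewrite /update; case: eqP => [?|_]; first by lia.
  by rewrite r4 // u3 ?r1 //; lia.
- by rewrite m4 /= m2.
Qed.

End Rules.

Section PolyBounds.
Variable C : ctx.
Implicit Types F : env C -> nat.

Lemma pb_le F F' : (forall e, F' e <= F e) -> pb F -> pb F'.
Proof. by move=> h [d hd]; exists d => e s /hd; apply: leq_trans. Qed.

Lemma pb_const n : pb (fun _ : env C => n).
Proof. by exists n => e s _; apply: poly_const; apply: msr_gt1. Qed.

Lemma pb_size X : @evw C X -> pb (fun e => size (X e)).
Proof. by move=> hX; exists 1 => e s _; rewrite hX expn1; apply: size_msr. Qed.

Lemma pb_add F1 F2 : pb F1 -> pb F2 -> pb (fun e => F1 e + F2 e).
Proof.
move=> [a ha] [b hb]; exists (a + b).+1 => e s r.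
by apply: leq_trans (poly_add a b (msr_gt1 e)); rewrite leq_add ?(ha _ s) ?(hb _ s).
Qed.

Lemma pb_mul F1 F2 : pb F1 -> pb F2 -> pb (fun e => F1 e * F2 e).
Proof.
move=> [a ha] [b hb]; exists (a + b) => e s r.
by rewrite expnD leq_mul ?(ha _ s) ?(hb _ s).
Qed.

Lemma pb_exp F n : pb F -> pb (fun e => F e ^ n).
Proof.
move=> h; elim: n => [|n IH]; first exact: pb_const.
by apply: pb_le (pb_mul h IH) => e; rewrite expnS.
Qed.

End PolyBounds.

(** * Arithmetic and bounded quantifiers as loops *)

Ltac weaken W1 W2 W3 :=
  repeat match goal with
  | H : @ev _ _ |- _ => apply W1 in H
  | H : @pb _ _ |- _ => apply W2 in H
  | H : @evw _ _ |- _ => apply W3 in H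
  end.

(** Enters the body of a loop: the hypotheses are transported to the extended context, then the
    index and, if present, the accumulator are introduced. *)
Ltac ev_bind :=
  let C' := fresh "C" in let pr := fresh "pr" in
  let vi := fresh "vi" in let va := fresh "va" in
  let W1 := fresh "W" in let W2 := fresh "W" in let W3 := fresh "W" in
  let h1 := fresh "hv" in let h2 := fresh "hv" in let h3 := fresh "hv" in
  lazymatch goal with
  | |- forall (C' : ctx) (pr : _) (vi va : _), @extends _ _ _ -> _ =>
    intros C' pr vi va [W1 W2 W3]; weaken W1 W2 W3; clear W1 W2 W3; intros h1 h2 h3
  | |- forall (C' : ctx) (pr : _) (vi : _), @extends _ _ _ -> _ =>
    intros C' pr vi [W1 W2 W3]; weaken W1 W2 W3; clear W1 W2 W3; intros h1 h2
  end; cbv beta.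

(** By repeated addition; this is why the first factor must be polynomially bounded. *)
Lemma ev_mul C (F1 F2 : env C -> nat) : ev F1 -> pb F1 -> ev F2 -> ev (fun e => F1 e * F2 e).
Proof.
move=> h1 p1 h2.
apply: (@ev_eq _ (fun e => iteri (F1 e) (fun _ a => a + F2 e) 0)).
  by move=> e; elim: (F1 e) => //= n ->; rewrite mulSn addnC.
apply: (ev_iter (step := fun e _ a => a + F2 e)) => //; first exact: ev_const.
by ev_bind; apply: ev_add.
Qed.

Lemma ev_sum C (Fb : env C -> nat) (f : env C -> nat -> nat) : ev Fb -> pb Fb ->
  (forall C' (pr : env C' -> env C) (vi : env C' -> nat),
     extends pr -> ev vi -> pb vi -> ev (fun e => f (pr e) (vi e))) ->
  ev (fun e => \sum_(i < Fb e) f e i).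
Proof.
move=> hb pb hf.
apply: (@ev_eq _ (fun e => iteri (Fb e) (fun i a => a + f e i) 0)).
  by move=> e; elim: (Fb e) => [|n IH]; rewrite ?big_ord0 // big_ord_recr /= IH.
apply: (ev_iter (step := fun e i a => a + f e i)) => //; first exact: ev_const.
by move=> C' pr vi va W hi pi ha; apply: ev_add => //; apply: hf.
Qed.

Lemma ev_all C (Fb : env C -> nat) (f : env C -> nat -> bool) : ev Fb -> pb Fb ->
  (forall C' (pr : env C' -> env C) (vi : env C' -> nat),
     extends pr -> ev vi -> pb vi -> ev (fun e => (f (pr e) (vi e) : nat))) ->
  ev (fun e => (all (f e) (iota 0 (Fb e)) : nat)).
Proof.
move=> hb pb hf.
apply: (@ev_eq _ (fun e => (iteri (Fb e) (fun i a => a + ~~ f e i) 0 == 0 : nat))).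
  move=> e; congr nat_of_bool; elim: (Fb e) => [|n IH] //.
  by rewrite -addn1 iotaD all_cat -IH /= addn1 /= andbT addn_eq0 add0n; case: (f e n).
apply: ev_eqn; last exact: ev_const.
apply: (ev_iter (step := fun e i a => a + ~~ f e i)) => //; first exact: ev_const.
move=> C' pr vi va W hi pi ha; apply: ev_add => //.
by apply: (ev_not (b := fun e => f (pr e) (vi e))); apply: hf.
Qed.

Lemma ev_has C (Fb : env C -> nat) (f : env C -> nat -> bool) : ev Fb -> pb Fb ->
  (forall C' (pr : env C' -> env C) (vi : env C' -> nat),
     extends pr -> ev vi -> pb vi -> ev (fun e => (f (pr e) (vi e) : nat))) ->
  ev (fun e => (has (f e) (iota 0 (Fb e)) : nat)).
Proof.
move=> hb pb hf.
apply: (@ev_eq _ (fun e => (~~ all (fun i => ~~ f e i) (iota 0 (Fb e)) : nat))).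
  by move=> e; rewrite (all_predC (f e)) negbK.
apply: (ev_not (b := fun e => all (fun i => ~~ f e i) (iota 0 (Fb e)))).
apply: (ev_all (f := fun e i => ~~ f e i)) => // C' pr vi W hi pi.
by apply: (ev_not (b := fun e => f (pr e) (vi e))); apply: hf.
Qed.

Lemma ev_exp C (F : env C -> nat) n : ev F -> pb F -> ev (fun e => F e ^ n).
Proof.
move=> h p; elim: n => [|n IH]; first exact: ev_const.
by apply: (@ev_eq _ (fun e => F e * F e ^ n)); [move=> e; rewrite expnS|apply: ev_mul].
Qed.

Lemma ev_pow C (F1 F2 : env C -> nat) : ev F1 -> pb F1 -> ev F2 -> pb F2 -> ev (fun e => F1 e ^ F2 e).
Proof.
move=> h1 p1 h2 p2.
apply: (@ev_eq _ (fun e => iteri (F2 e) (fun _ a => F1 e * a) 1)).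
  by move=> e; elim: (F2 e) => //= n ->; rewrite expnS.
apply: (ev_iter (step := fun e _ a => F1 e * a)) => //; first exact: ev_const.
by ev_bind; apply: ev_mul.
Qed.

(** Division becomes a count of multiples, a sum that a loop can evaluate. *)
Lemma divn_count a b : a %/ b = \sum_(i < a) ((0 < b) && (i.+1 * b <= a)).
Proof.
case: (posnP b) => [->|b0]; first by rewrite divn0 big1.
transitivity (\sum_(i < a | i < a %/ b) 1).
  by rewrite -(big_ord_widen a (fun _ => 1)) ?leq_div // sum1_card card_ord.
rewrite big_mkcond; apply: eq_bigr => i _ /=.
by rewrite leq_divRL //; case: leqP.
Qed.

Lemma ev_div C (F1 F2 : env C -> nat) : ev F1 -> pb F1 -> ev F2 -> ev (fun e => F1 e %/ F2 e).
Proof.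
move=> h1 p1 h2.
apply: (@ev_eq _ (fun e => \sum_(i < F1 e) ((0 < F2 e) && (i.+1 * F2 e <= F1 e)))).
  by move=> e; rewrite -divn_count.
apply: (ev_sum (f := fun e i => ((0 < F2 e) && (i.+1 * F2 e <= F1 e)))) => //.
move=> C' pr vi [W1 W2 W3] hi pi; weaken W1 W2 W3.
apply: (ev_and (b1 := fun e => 0 < F2 (pr e)) (b2 := fun e => (vi e).+1 * F2 (pr e) <= F1 (pr e))).
  by apply: ev_leq => //; apply: ev_const.
apply: ev_leq => //; apply: ev_mul => //; first exact: ev_succ.
by apply: pb_le (pb_add (pb_const _ 1) pi).
Qed.

Lemma pb_div C (F1 F2 : env C -> nat) : pb F1 -> pb (fun e => F1 e %/ F2 e).
Proof. by apply: pb_le => e; apply: leq_div. Qed.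

Lemma pb_mod C (F1 F2 : env C -> nat) : pb F1 -> pb (fun e => F1 e %% F2 e).
Proof. by apply: pb_le => e; apply: leq_mod. Qed.

Lemma ev_mod C (F1 F2 : env C -> nat) : ev F1 -> pb F1 -> ev F2 -> ev (fun e => F1 e %% F2 e).
Proof.
move=> h1 p1 h2; apply: (@ev_eq _ (fun e => F1 e - F1 e %/ F2 e * F2 e)).
  by move=> e; rewrite {1}(divn_eq (F1 e) (F2 e)) addKn.
by apply: ev_sub => //; apply: ev_mul => //; [apply: ev_div|apply: pb_div].
Qed.

Lemma ev_min C (F1 F2 : env C -> nat) : ev F1 -> ev F2 -> ev (fun e => minn (F1 e) (F2 e)).
Proof.
move=> h1 h2; apply: (@ev_eq _ (fun e => F1 e - (F1 e - F2 e))); first by move=> e; lia.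
by do 2!apply: ev_sub => //.
Qed.

(** * Programs from words to words *)

Section Top.
Variable m : word -> nat.
Hypotheses (m1 : forall x, 1 < m x) (msz : forall x, size x <= m x).

Definition holds (x : word) (s : state) : Prop :=
  regs s 0 = size x /\ forall i, i < size x -> heap s i = nth 0 x i.

Lemma holds_ext x s s' : agree 1 s s' -> holds x s -> holds x s'.
Proof.
case=> hr hh [h0 h1]; split=> [|i lt]; first by rewrite hr.
by rewrite hh ?h0 // h1.
Qed.

Definition top : ctx :=
  @Ctx word id m 1 holds m1 msz isT (fun _ _ => id) holds_ext.

(* The output is first written behind the input, which must stay readable, and
   then moved down to cell 0.  Nothing is assumed about the rest of the heap and
   the other registers, so that the program can run after any other one. *)
Lemma ev_program (len : word -> nat) (out : word -> nat -> nat) :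
  @ev top len -> @pb top len ->
  (forall C (pr : env C -> env top) (vi : env C -> nat),
     extends pr -> ev vi -> pb vi -> ev (fun e => out (pr e) (vi e))) ->
  exists c d, forall x s, holds x s -> exists t s',
    [/\ exec c s t s', t <= m x ^ d & output s' = mkseq (out x) (len x)].
Proof.
move=> hlen [dl hdl] hout.
have [c1 [d1 hc1]] := hlen 1 (leqnn _).
pose C1 := @ext top 2 (fun x i => i < len x) isT.
have hs : @ev C1 (fun p => out p.1 p.2).
  apply: (hout C1 fst snd); [exact: ext_extends|exact: ev_ext_var|].
  by exists dl => -[x i] s [/= r _ lt]; apply: leq_trans (hdl _ _ r); apply: ltnW.
have [c3 [d3 hc3]] := hs 3 (leqnn _).
pose incr := SetReg 2 (Add (Reg 2) (Const 1)).
pose test := Sub (Reg 1) (Reg 2).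
pose loop1 := While test (Seq c3 (Seq (SetMem (Add (Reg 0) (Reg 2)) (Reg 3)) incr)).
pose loop2 := While test (Seq (SetMem (Reg 2) (Mem (Add (Reg 0) (Reg 2)))) incr).
exists (Seq c1 (Seq (SetReg 2 (Const 0)) (Seq loop1 (Seq (SetReg 2 (Const 0))
  (Seq loop2 (SetReg 0 (Reg 1))))))), (d1 + (dl + (d3 + 11).+1)).+1 => x s hx.
have [t1 [s1 [x1 lt1 v1 r1 mm1]]] := hc1 _ _ hx.
have hx1 : holds x s1.
  by apply: holds_ext hx; split=> [r|i]; [apply: r1|rewrite mm1].
have incrP sa i : regs sa 2 = i ->
    exec incr sa 1 (State (update (regs sa) 2 i.+1) (heap sa)).
  by move=> <-; rewrite -(addn1 (regs sa 2)); apply: ExecSetReg.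
have loop1P n : forall sa i, i + n = len x -> holds x sa -> regs sa 1 = len x ->
    regs sa 2 = i -> (forall j, j < i -> heap sa (size x + j) = out x j) ->
    exists t sb, [/\ exec loop1 sa t sb, t <= n * (m x ^ d3 + 3) + 1, holds x sb,
      regs sb 1 = len x & forall j, j < len x -> heap sb (size x + j) = out x j].
  elim: n => [|n IH] sa i hin hxa va vi hj.
    exists 1, sa; split=> //; first by apply: ExecWhileFalse; rewrite /= va vi; lia.
    by move=> j lt; apply: hj; lia.
  have [|t [sb [xb ltb vb rb mb]]] := hc3 (x, i) sa.
    by split=> //=; lia.
  pose hp := update (heap sb) (size x + i) (out x i).
  pose sc := State (update (regs sb) 2 i.+1) hp.
  have xc : exec (Seq c3 (Seq (SetMem (Add (Reg 0) (Reg 2)) (Reg 3)) incr)) sa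
      (t + (1 + 1)) sc.
    apply: ExecSeq xb _; apply: ExecSeq; first exact: ExecSetMem.
    rewrite /= vb /= !rb // (hxa.1) vi.
    by apply: (incrP (State (regs sb) hp)) => /=; rewrite rb.
  have [|||||t' [s' [x' lt' h1' h2' h3']]] := IH sc i.+1.
  - by lia.
  - split=> [|j lt]; first by rewrite /= /update /= rb // hxa.1.
    rewrite /= /hp /update ifF ?mb ?hxa.2 //; lia.
  - by rewrite /= /update /= rb.
  - by rewrite /= /update eqxx.
  - move=> j lt; rewrite /= /hp /update eqn_add2l; case: eqP => [->//|ne].
    by rewrite mb hj //; lia.
  exists (t + (1 + 1) + t').+1, s'; split=> //.
  - by apply: ExecWhileTrue xc x'; rewrite /= va vi; lia.
  - by move: ltb lt' => /=; rewrite mulSn; lia.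
have loop2P n : forall sa i, i + n = len x -> regs sa 0 = size x ->
    regs sa 1 = len x -> regs sa 2 = i ->
    (forall j, j < len x -> i <= j -> heap sa (size x + j) = out x j) ->
    (forall j, j < i -> heap sa j = out x j) ->
    exists t sb, [/\ exec loop2 sa t sb, t <= n * 3 + 1, regs sb 1 = len x
      & forall j, j < len x -> heap sb j = out x j].
  elim: n => [|n IH] sa i hin v0 va vi hj hd.
    exists 1, sa; split=> //; first by apply: ExecWhileFalse; rewrite /= va vi; lia.
    by move=> j lt; apply: hd; lia.
  pose hp := update (heap sa) i (out x i).
  pose sc := State (update (regs sa) 2 i.+1) hp.
  have xc : exec (Seq (SetMem (Reg 2) (Mem (Add (Reg 0) (Reg 2)))) incr) sa (1 + 1) sc.
    apply: ExecSeq; first exact: ExecSetMem.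
    rewrite /= v0 vi hj; try lia.
    exact: (incrP (State (regs sa) hp)).
  have [||||||t' [s' [x' lt' h1' h2']]] := IH sc i.+1.
  - by lia.
  - by [].
  - by [].
  - by rewrite /= /update eqxx.
  - move=> j lt le; rewrite /= /hp /update ifF ?hj //; lia.
  - move=> j lt; rewrite /= /hp /update; case: eqP => [->//|ne].
    by rewrite hd //; lia.
  exists ((1 + 1) + t').+1, s'; split=> //.
  - by apply: ExecWhileTrue xc x'; rewrite /= va vi; lia.
pose s2 := State (update (regs s1) 2 0) (heap s1).
have [|||||t3 [s3 [x3 lt3 hx3 v3 hs3]]] := loop1P (len x) s2 0; rewrite ?add0n //.
pose s4 := State (update (regs s3) 2 0) (heap s3).
have [||||||t5 [s5 [x5 lt5 v5 hs5]]] := loop2P (len x) s4 0; rewrite ?add0n //.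
- exact: hx3.1.
- by move=> j lt _; apply: hs3.
exists (t1 + (1 + (t3 + (1 + (t5 + 1))))), (State (update (regs s5) 0 (regs s5 1)) (heap s5)).
split.
- apply: ExecSeq x1 (ExecSeq (_ : exec _ _ 1 s2) (ExecSeq x3
    (ExecSeq (_ : exec _ _ 1 s4) (ExecSeq x5 _)))); exact: ExecSetReg.
- have mx := m1 x.
  have H3 := poly_add d3 11 mx; have P3 := poly_const 11 mx.
  have H1 := poly_add d1 (dl + (d3 + 11).+1) mx.
  (* Per letter the loops add 3 steps each to the cost of the letter; 5 steps are spent once. The
     constant 11 is 6 + 5. *)
  have Q : len x * (m x ^ d3 + 6) + 5 <= m x ^ (dl + (d3 + 11).+1).
    rewrite expnD; apply: (@leq_trans (m x ^ dl * (m x ^ d3 + 11))).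
      have p0 : 0 < m x ^ dl by rewrite expn_gt0; lia.
      have hl : len x <= m x ^ dl by apply: (hdl _ s).
      by nia.
    by rewrite leq_mul2l; apply/orP; right; lia.
  by move: lt1 lt3 lt5 => /=; nia.
- rewrite /output /= /update /= v5; apply/eq_in_map => i.
  by rewrite mem_iota => /andP[_ lt]; apply: hs5.
Qed.

End Top.

(** * Packing and acyclic orientations *)

Section RootedTree.
Variables (T : finType) (par : T -> T) (root : T) (rk : T -> nat).
Hypothesis par_root : par root = root.
Hypothesis par_lt : forall x, x != root -> rk (par x) < rk x.

Definition tree_rel : rel T :=
  fun x y => (x != y) && ((par x == y) || (par y == x)).

Lemma tree_rel_sym : symmetric tree_rel.
Proof. by move=> x y; rewrite /tree_rel eq_sym orbC. Qed.

Lemma tree_rel_par x : x != root -> tree_rel x (par x).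
Proof.
move=> xr; rewrite /tree_rel eqxx andbT; apply/eqP => e.
by have := par_lt xr; rewrite -e ltnn.
Qed.

Lemma tree_rel_connect_root x : connect tree_rel x root.
Proof.
have [n] := ubnP (rk x); elim: n x => // n IH x lt.
case: (eqVneq x root) => [->|xr]; first exact: connect0.
apply: connect_trans (connect1 (tree_rel_par xr)) (IH _ _).
by have := par_lt xr; lia.
Qed.

(** In a cycle, take a vertex of largest rank. Neither of its two neighbours there can be a child,
    so both are its parent, which contradicts that they are distinct. *)
Lemma tree_rel_is_tree : is_tree tree_rel.
Proof.
split.
- by apply/card_gt0P; exists root.
- by split; [exact: tree_rel_sym|move=> x; rewrite /tree_rel eqxx].
- move=> x y; apply: connect_trans (tree_rel_connect_root x) _.
  by rewrite (sym_connect_sym tree_rel_sym) tree_rel_connect_root.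
move=> c c2; apply/negP => /andP[cyc un].
have [x0 x0c] : exists x0, x0 \in c by case: c c2 {cyc un} => // x c _; exists x; rewrite inE eqxx.
have [x xc xmax] := @arg_maxnP T x0 (mem c) rk x0c.
have [i p def] := rot_to xc.
move: cyc un; rewrite -(rot_cycle i) -(rot_uniq i) def.
have szp : 1 < size p by have := size_rot i c; rewrite def /=; lia.
have pc y : y \in p -> rk y <= rk x.
  by move=> yp; apply: xmax; rewrite /= -(mem_rot i) def inE yp orbT.
have nb y : rk y <= rk x -> tree_rel x y -> y = par x.
  move=> le /andP[ne /orP[/eqP //|/eqP e]].
  have yr : y != root by apply/eqP => er; move: ne; rewrite -e er par_root eqxx.
  by have := par_lt yr; rewrite e; lia.
case: p def szp pc => // y p; case/lastP: p => // p z def _ pc /=.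
case/andP=> exy; rewrite rcons_path => /andP[_ ezx] /and3P[_ yn _].
rewrite last_rcons tree_rel_sym in ezx.
have ey := nb _ (pc y (mem_head _ _)) exy.
have ez : z = par x by apply: nb ezx; apply: pc; rewrite inE mem_rcons mem_head orbT.
by move: yn; rewrite mem_rcons inE ey ez eqxx.
Qed.

End RootedTree.

Lemma rank_acyclic (V : finType) (D : rel V) (rk : V -> nat) :
  (forall u v, D u v -> rk u < rk v) -> acyclic D.
Proof.
move=> h [|x p] // _; apply/negP => /= cyc.
have /order_path_min : path (relpre rk ltn) x (rcons p x) by apply: sub_path cyc.
move=> /(_ (fun a b c => @ltn_trans _ _ _)) /allP /(_ x).
by rewrite mem_rcons mem_head /= ltnn => /(_ isT).
Qed.

Lemma acyclic_connect (V : finType) (D : rel V) a b :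
  acyclic D -> connect D a b -> ~~ D b a.
Proof.
move=> ac /connectP[p pth ->]; apply/negP => Dba.
by have /negP := ac (a :: p) isT; apply; rewrite /= rcons_path pth.
Qed.

(** Turns the bound on the total score into an equality at every single vertex. *)
Lemma leq_sum_eq (I : finType) (F G : I -> nat) :
  (forall i, F i <= G i) -> \sum_i G i <= \sum_i F i -> forall i, F i = G i.
Proof.
move=> le ge i; apply/eqP; rewrite eqn_leq le /=; move: ge.
rewrite (bigD1 i) //= [X in _ <= X](bigD1 i) //=.
have : \sum_(j | j != i) F j <= \sum_(j | j != i) G j by apply: leq_sum.
lia.
Qed.

Lemma sum_indic (V : finType) (f : V -> nat) (b : bool) (w : V) :
  \sum_v f v * (b && (w == v)) = b * f w.
Proof.
rewrite (bigD1 w) //= eqxx andbT big1 => [|v ne]; first by lia.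
by rewrite eq_sym (negbTE ne) andbF muln0.
Qed.

Lemma sum_pairs (V : finType) (P : V -> V -> bool) :
  \sum_v \sum_u (P u v : nat) = #|[set p : V * V | P p.2 p.1]|.
Proof.
rewrite pair_bigA /= -sum1_card [RHS]big_mkcond /=.
by apply: eq_bigr => p _; rewrite inE; case: (P _ _).
Qed.

Lemma sum_bool_card (V : finType) (P : pred V) :
  \sum_v (P v : nat) = #|[set v | P v]|.
Proof.
by rewrite -sum1_card [RHS]big_mkcond; apply: eq_bigr => v _; rewrite inE; case: (P v).
Qed.

Section Gadget.
(* Kinds of vertices: 0 counter, 1 selector, 2 hub, 3 leaf, 4 filler; a vertex of
   any other kind is isolated.  A selector chooses one of its hubs; the leaves of
   a hub form chains leading to it.  If [h] is chosen, the arc [h -> selof h]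
   closes a cycle with any arc [selof h -> p] to a leaf [p] of [h], so [p] has to
   use one unit of the in-degree of its counter instead. *)
Variables (V : finType) (kind : V -> nat).
Variables (selof hubof ctrof next : V -> V) (pos : V -> nat) (q : nat).

Definition isC v := kind v == 0.
Definition isS v := kind v == 1.
Definition isH v := kind v == 2.
Definition isL v := kind v == 3.
Definition isF v := kind v == 4.

Hypothesis leaf_ctr : forall p, isL p -> isC (ctrof p).
Hypothesis leaf_hub : forall p, isL p -> isH (hubof p).
Hypothesis hub_sel : forall h, isH h -> isS (selof h).
Hypothesis sel_hub : forall p, isL p -> selof (hubof p) = selof p.
Hypothesis leaf_next : forall p, isL p -> next p != hubof p ->
  [/\ isL (next p), hubof (next p) = hubof p & pos (next p) < pos p].
(** Arcs along [next] leave one place free for an arc from the selector; counters and fillers leave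
    a selector exactly one place for a hub. *)
Hypothesis next_card : forall v, #|[set p | isL p && (next p == v)]| < q.
Hypothesis sel_card : forall s, isS s ->
  #|[set u | isC u || isF u && (selof u == s)]|.+1 = q.

(* At most [4 * #|V|] arcs have weight 1, so that no arc of weight [W] can be
   given up. *)
Let W := 4 * #|V| + 1.

Definition big_arc (u v : V) : bool :=
  isS v && (isC u || isF u && (selof u == v)).

Definition gadget_wt (u v : V) : nat :=
  W * big_arc u v + (isL u && (next u == v)) + (isL u && (ctrof u == v))
  + (isL v && (selof v == u)) + (isH u && (selof u == v)).

(** A selector should receive all its [q.-1] big arcs and one arc from a hub. A leaf should
    contribute two of its three unit arcs: the one to [next], and either the one to its counter or
    the one from its selector. *)
Definition gadget_goal : nat := \sum_v (isS v * (W * q.-1 + 1) + isL v * 2).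

Definition gadget_score (D : rel V) : nat :=
  \sum_v \sum_(u | D u v) gadget_wt u v.

Lemma gadget_scoreE D : gadget_score D =
  W * (\sum_v \sum_u (D u v && big_arc u v : nat))
  + \sum_p isL p * (D p (next p) + D p (ctrof p) + D (selof p) p)
  + \sum_h isH h * D h (selof h).
Proof.
transitivity (\sum_v \sum_u (W * (D u v && big_arc u v) +
   D u v * (isL u && (next u == v)) + D u v * (isL u && (ctrof u == v)) +
   D u v * (isL v && (selof v == u)) + D u v * (isH u && (selof u == v)))).
  apply: eq_bigr => v _; rewrite big_mkcond; apply: eq_bigr => u _.
  by rewrite /gadget_wt; case: (D u v); rewrite /= ?mul1n // muln0.
do 4!(under eq_bigr do rewrite big_split); rewrite !big_split /=.
have E b w : (\sum_v \sum_u D u v * (b u && (w u == v))) = \sum_u b u * D u (w u).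
  by rewrite exchange_big; apply: eq_bigr => u _; apply: (sum_indic (D u)).
rewrite !E; congr (_ + _); rewrite -!addnA; congr (_ + _).
  rewrite big_distrr; apply: eq_bigr => v _.
  by rewrite big_distrr.
rewrite -!big_split /=; apply: eq_bigr => p _.
by rewrite (sum_indic (D^~ p)); lia.
Qed.

Lemma big_arc_sum : \sum_v \sum_u (big_arc u v : nat) = \sum_v isS v * q.-1.
Proof.
apply: eq_bigr => v _; rewrite /big_arc; case: (boolP (isS v)) => sv /=; last first.
  by rewrite big1.
by rewrite mul1n -(sel_card sv) sum_bool_card.
Qed.

Lemma gadget_goalE : gadget_goal =
  W * (\sum_v \sum_u (big_arc u v : nat)) + \sum_v (isL v * 2 + isS v).
Proof.
rewrite big_arc_sum big_distrr -big_split /=; apply: eq_bigr => v _; lia.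
Qed.

Section Sound.
Variable D : rel V.
Hypothesis acD : acyclic D.
Hypothesis degD : forall v, #|parents D v| <= q.
Hypothesis scD : gadget_goal <= gadget_score D.

Lemma big_arcs_in u v : big_arc u v -> D u v.
Proof.
move=> buv; apply: contraT => nD.
have lt : \sum_v \sum_u (D u v && big_arc u v : nat) < \sum_v \sum_u (big_arc u v : nat).
  rewrite !(sum_pairs (fun u v => D u v && big_arc u v)) !(sum_pairs (fun u v => big_arc u v)).
  apply: proper_card; apply/properP; split.
    by apply/subsetP => p; rewrite !inE => /andP[].
  by exists (v, u); rewrite !inE //= (negbTE nD).
have l1 : \sum_p isL p * (D p (next p) + D p (ctrof p) + D (selof p) p) <= 3 * #|V|.
  rewrite mulnC -sum_nat_const; apply: leq_sum => p _.
  by case: (isL p); case: (D _ _); case: (D _ _); case: (D _ _).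
have l2 : \sum_h isH h * D h (selof h) <= #|V|.
  rewrite -[leqRHS]muln1 -sum_nat_const; apply: leq_sum => p _.
  by case: (isH p); case: (D _ _).
have key n a b x y z : (4 * n + 1) * b + z <= (4 * n + 1) * a + x + y ->
    a < b -> x <= 3 * n -> y <= n -> false by nia.
by move: scD; rewrite gadget_scoreE gadget_goalE => /key; apply.
Qed.

Let hubs s := [set h | [&& isH h, selof h == s & D h s]].

(** The [q.-1] big arcs are all present, so the degree bound admits one further parent. *)
Lemma hubs_le1 s : isS s -> #|hubs s| <= 1.
Proof.
move=> ss.
have dis : [disjoint [set u | isC u || isF u && (selof u == s)] & hubs s].
  rewrite -setI_eq0; apply/eqP/setP => u; rewrite !inE /isC /isF /isH.
  by apply/negP; case/andP=> h1 /and3P[/eqP h2 _ _]; move: h1; rewrite h2.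
have sub : [set u | isC u || isF u && (selof u == s)] :|: hubs s \subset parents D s.
  apply/subsetP => u; rewrite !inE => /orP[h|/and3P[] //].
  by apply: big_arcs_in; rewrite /big_arc ss.
have := leq_trans (subset_leq_card sub) (degD s).
rewrite cardsU disjoint_setI0 // cards0 subn0 -(sel_card ss); lia.
Qed.

(** The counter sends a big arc to every selector, so both arcs together would close a triangle. *)
Lemma sel_leaf_cycle p : isL p -> D p (ctrof p) -> ~~ D (selof p) p.
Proof.
move=> lp d1.
have ss : isS (selof p) by rewrite -sel_hub //; apply/hub_sel/leaf_hub.
apply: (acyclic_connect acD); apply: connect_trans (connect1 d1) (connect1 _).
by apply: big_arcs_in; rewrite /big_arc ss leaf_ctr.
Qed.

(** The left side never exceeds the right one: of the three leaf arcs, those at the counter and at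
    the selector exclude each other, and a selector has at most one hub. The score requires the
    opposite inequality for the sums. *)
Lemma gadget_tight v :
  isL v * (D v (next v) + D v (ctrof v) + D (selof v) v) + isS v * #|hubs v| =
  isL v * 2 + isS v.
Proof.
move: v; apply: leq_sum_eq => [v|].
  apply: leq_add.
    case: (boolP (isL v)) => lv //=; rewrite !mul1n.
    have := sel_leaf_cycle lv; case: (D v (ctrof v)) => [/(_ isT)/negbTE ->|_].
      by case: (D _ _).
    by case: (D _ _); case: (D _ _).
  by case: (boolP (isS v)) => // sv; rewrite mul1n hubs_le1.
have all_big : \sum_v \sum_u (D u v && big_arc u v : nat) = \sum_v \sum_u (big_arc u v : nat).
  apply: eq_bigr => v _; apply: eq_bigr => u _; congr nat_of_bool.
  by case: (boolP (big_arc u v)) => [/big_arcs_in ->|]; rewrite ?andbF.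
have hubsE : \sum_h isH h * D h (selof h) = \sum_s isS s * #|hubs s|.
  transitivity (\sum_s \sum_h (D h s && isS s) * (isH h && (selof h == s))).
    rewrite exchange_big; apply: eq_bigr => h _.
    rewrite (sum_indic (fun s => D h s && isS s : nat)).
    by case: (boolP (isH h)) => // /hub_sel ->; rewrite andbT.
  apply: eq_bigr => s _; rewrite -sum_bool_card big_distrr.
  by apply: eq_bigr => h _; rewrite mulnb; case: (D h s); case: (isS s); case: (isH h);
    case: (selof h == s).
move: scD; rewrite gadget_scoreE gadget_goalE all_big hubsE -addnA leq_add2l.
by rewrite -big_split.
Qed.

Lemma leaf_next_arc p : isL p -> D p (next p).
Proof.
move=> lp; have := gadget_tight p; rewrite lp.
have -> : isS p = false by move/eqP: lp; rewrite /isS => ->.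
have := sel_leaf_cycle lp; case: (D p (ctrof p)) => [/(_ isT)/negbTE ->|_];
by case: (D _ _); case: (D _ _).
Qed.

Lemma leaf_connect_hub p : isL p -> connect D p (hubof p).
Proof.
have [n] := ubnP (pos p); elim: n p => // n IH p lt lp.
have d := leaf_next_arc lp.
case: (eqVneq (next p) (hubof p)) => [e|ne]; first by rewrite -e connect1.
have [ln en ltn] := leaf_next lp ne.
by apply: connect_trans (connect1 d) _; rewrite -en; apply: IH => //; lia.
Qed.

Lemma gadget_sound : exists chi : V -> V,
  (forall s, isS s -> isH (chi s) /\ selof (chi s) = s) /\
  (forall c, isC c ->
    #|[set p | [&& isL p, ctrof p == c & chi (selof p) == hubof p]]| <= q).
Proof.
(* The default is never taken at a selector: tightness provides a hub. *)
pose chi s := odflt s [pick h in hubs s].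
have chiP s : isS s -> chi s \in hubs s.
  move=> ss; rewrite /chi; case: pickP => //= no.
  have := gadget_tight s; rewrite ss mul1n (eq_card0 no).
  by have -> : isL s = false by move/eqP: ss; rewrite /isL => ->.
exists chi; split=> [s /chiP|c cc]; first by rewrite inE => /and3P[? /eqP].
apply: leq_trans (degD c); apply: subset_leq_card; apply/subsetP => p.
rewrite !inE => /and3P[lp /eqP <- /eqP e].
have ss : isS (selof p) by rewrite -sel_hub //; apply/hub_sel/leaf_hub.
have := chiP _ ss; rewrite e inE => /and3P[_ _ dh].
have nd : ~~ D (selof p) p.
  by apply: (acyclic_connect acD); apply: connect_trans (leaf_connect_hub lp) (connect1 dh).
have := gadget_tight p; rewrite lp (negbTE nd) leaf_next_arc //.
have -> : isS p = false by move/eqP: lp; rewrite /isS => ->.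
by case: (D _ _).
Qed.

End Sound.

Section Complete.
Variable chi : V -> V.
Hypothesis chiP : forall s, isS s -> isH (chi s) /\ selof (chi s) = s.
Hypothesis capP : forall c, isC c ->
  #|[set p | [&& isL p, ctrof p == c & chi (selof p) == hubof p]]| <= q.

Let on p := chi (selof p) == hubof p.

Definition gadget_dag : rel V := fun u v =>
  [|| big_arc u v, isL u && (next u == v), [&& isL u, on u & ctrof u == v],
      [&& isL v, ~~ on v & selof v == u]
    | [&& isH u, chi (selof u) == u & selof u == v]].

Let P := \max_v pos v.

(** A topological order: leaves of chosen hubs (up to [P]), counters and chosen hubs ([P.+1]),
    selectors ([P.+2]), leaves of the other hubs ([P + 3] to [2 * P + 3]), and finally those hubs.
    Fillers are sources. *)
Let rk v : nat :=
  match kind v with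
  | 0 => P.+1
  | 1 => P.+2
  | 2 => if chi (selof v) == v then P.+1 else 2 * P + 4
  | 3 => if on v then P - pos v else P + 3 + (P - pos v)
  | _ => 0
  end.

Lemma leaf_sel_isS p : isL p -> isS (selof p).
Proof. by move=> lp; rewrite -sel_hub //; apply/hub_sel/leaf_hub. Qed.

Lemma gadget_dag_acyclic : acyclic gadget_dag.
Proof.
have leP v : pos v <= P by apply: leq_bigmax.
apply: (@rank_acyclic _ _ rk) => u v /or4P[|||/orP[]].
- case/andP=> /eqP kv /orP[/eqP ku|/andP[/eqP ku _]]; by rewrite /rk kv ku.
- case/andP=> lu /eqP <-.
  case: (eqVneq (next u) (hubof u)) => [->|ne].
    rewrite /rk (eqP lu) (eqP (leaf_hub lu)) sel_hub // /on.
    by have := leP u; case: eqP => _; lia.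
  have [ln en lt] := leaf_next lu ne.
  have onE : on (next u) = on u by rewrite /on -sel_hub // en sel_hub.
  rewrite /rk (eqP lu) (eqP ln) onE.
  by have := leP u; case: ifP => _; lia.
- case/and3P=> lu ou /eqP <-; rewrite /rk (eqP lu) (eqP (leaf_ctr lu)) ou; lia.
- case/and3P=> lv ov /eqP <-.
  by rewrite /rk (eqP lv) (eqP (leaf_sel_isS lv)) (negbTE ov); lia.
- by case/and3P=> hu cu /eqP <-; rewrite /rk (eqP hu) (eqP (hub_sel hu)) cu.
Qed.

Lemma gadget_dag_deg v : #|parents gadget_dag v| <= q.
Proof.
have big0 u : ~~ isS v -> big_arc u v = false by rewrite /big_arc => /negbTE ->.
have sel0 u : ~~ isS v -> isH u -> selof u == v = false.
  by move=> sv hu; apply/eqP => e; move: sv; rewrite -e hub_sel.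
have ctr0 u : ~~ isC v -> isL u -> ctrof u == v = false.
  by move=> sv hu; apply/eqP => e; move: sv; rewrite -e leaf_ctr.
have nxt0 u : isL u -> next u == v -> isL v || isH v.
  move=> lu /eqP <-; case: (eqVneq (next u) (hubof u)) => [->|ne].
    by rewrite leaf_hub ?orbT.
  by have [-> _ _] := leaf_next lu ne.
case: (boolP (isS v)) => sv.
  rewrite -(sel_card sv).
  apply: leq_trans (_ : #|chi v |: [set u | isC u || isF u && (selof u == v)]| <= _); last first.
    by rewrite cardsU1; lia.
  apply: subset_leq_card; apply/subsetP => u; rewrite !inE.
  have nL : isL v = false by rewrite /isL (eqP sv).
  have nH : isH v = false by rewrite /isH (eqP sv).
  have nC : ~~ isC v by rewrite /isC (eqP sv).
  case/or4P=> [/andP[_ ->]|/andP[lu /(nxt0 _ lu)]|/and3P[lu _]|/orP[]].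
  - by rewrite orbT.
  - by rewrite nL nH.
  - by rewrite ctr0.
  - by rewrite nL.
  - by case/and3P=> _ /eqP cu /eqP su; rewrite -su cu eqxx.
case: (boolP (isC v)) => cv.
  apply: leq_trans (capP cv); apply: subset_leq_card; apply/subsetP => u; rewrite !inE.
  have nL : isL v = false by rewrite /isL (eqP cv).
  have nH : isH v = false by rewrite /isH (eqP cv).
  case/or4P=> [|/andP[lu /(nxt0 _ lu)]|/and3P[lu ou ->]|/orP[]].
  - by rewrite big0.
  - by rewrite nL nH.
  - by rewrite lu.
  - by rewrite nL.
  - by case/and3P=> hu _; rewrite sel0.
(* Any other vertex has as parents at most its predecessors along [next] and its selector. *)
apply: leq_trans (next_card v).
apply: leq_trans (_ : #|selof v |: [set p | isL p && (next p == v)]| <= _); last first.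
  by rewrite cardsU1; case: (_ \notin _); rewrite ?add1n ?add0n.
apply: subset_leq_card; apply/subsetP => u; rewrite !inE.
case/or4P=> [|->|/and3P[lu ou]|/orP[]].
- by rewrite big0.
- by rewrite orbT.
- by rewrite ctr0.
- by case/and3P=> _ _ /eqP ->; rewrite eqxx.
- by case/and3P=> hu _; rewrite sel0.
Qed.

Lemma gadget_dag_score : gadget_goal <= gadget_score gadget_dag.
Proof.
rewrite gadget_goalE gadget_scoreE -addnA; apply: leq_add.
  rewrite leq_mul2l; apply/orP; right; apply: leq_sum => v _; apply: leq_sum => u _.
  by rewrite /gadget_dag; case: (big_arc u v).
rewrite big_split /=; apply: leq_add.
  apply: leq_sum => p _; case: (boolP (isL p)) => // lp; rewrite !mul1n.
  rewrite /gadget_dag lp !eqxx !andbT /= orbT add1n.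
  by case: (on p); rewrite /= ?orbT //= ?orbT; case: (_ || _).
have -> : \sum_s (isS s : nat) = \sum_(s | isS s) 1.
  by rewrite [RHS]big_mkcond; apply: eq_bigr => s _; case: (isS s).
apply: (@leq_trans (\sum_(s | isS s) isH (chi s) * gadget_dag (chi s) (selof (chi s)))).
  apply: leq_sum => s ss; have [hc sc] := chiP ss.
  by rewrite hc /gadget_dag hc sc !eqxx !orbT.
(* The hub determines its selector, so [chi] is injective on selectors and the sum is a part of the
   sum over all hubs. *)
rewrite -(big_imset (h := chi) (fun h => isH h * gadget_dag h (selof h))) /=; last first.
  by move=> s t /chiP[_ e1] /chiP[_ e2] e; rewrite -e1 -e2 e.
by rewrite [leqRHS](bigID (mem [set chi x | x in isS])) /= leq_addr.
Qed.

End Complete.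

Lemma gadget_correct :
  (exists D : rel V, [/\ acyclic D, forall v, #|parents D v| <= q &
     gadget_goal <= gadget_score D]) <->
  (exists chi : V -> V,
    (forall s, isS s -> isH (chi s) /\ selof (chi s) = s) /\
    (forall c, isC c ->
      #|[set p | [&& isL p, ctrof p == c & chi (selof p) == hubof p]]| <= q)).
Proof.
split=> [[D [h1 h2 h3]]|[chi [h1 h2]]]; first exact: (gadget_sound h1 h2 h3).
exists (gadget_dag chi); split; [exact: gadget_dag_acyclic|exact: gadget_dag_deg|].
exact: gadget_dag_score.
Qed.

Let par (x : option V) : option V :=
  if x is Some v then (if isL v then Some (next v) else None) else None.

(* The counters and the selectors are in every bag; what remains is a forest. *)
Let bag (x : option V) : {set V} :=
  [set v | isC v || isS v] :|:
  (if x is Some v then v |: (if isL v then [set next v] else set0) else set0).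

(** A bag adds to the core only [v] and, for a leaf, [next v], hence the width exceeds the size of
    the core by one. A vertex [v] outside the core occurs in its own bag and in those of the leaves
    [w] with [next w = v], which are adjacent to it in the tree. *)
Lemma gadget_treewidth (G : rel V) :
  (forall a b, G a b -> (gadget_wt a b != 0) || (gadget_wt b a != 0)) ->
  treewidth_at_most G (#|[set v | isC v || isS v]|.+1).
Proof.
move=> hG; exists (option V), (tree_rel par), bag.
have tree : is_tree (tree_rel par).
  pose rk (x : option V) := if x is Some v then (if isL v then (pos v).+2 else 1) else 0.
  apply: (@tree_rel_is_tree _ par None rk) => // -[v|] //= _.
  case: (boolP (isL v)) => lv //=.
  case: (eqVneq (next v) (hubof v)) => [->|ne]; last first.
    by have [-> _ lt] := leaf_next lv ne.
  by have := leaf_hub lv; rewrite /isL /isH => /eqP ->.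
have core v x : isC v || isS v -> v \in bag x by rewrite !inE => ->.
have self v : v \in bag (Some v) by rewrite !inE eqxx orbT.
split; last first.
  move=> x; apply: leq_trans (leq_card_setU _ _) _; rewrite -addn2 leq_add2l.
  case: x => [v|]; last by rewrite cards0.
  by rewrite cardsU1; case: (_ \notin _); case: (isL v); rewrite ?cards1 ?cards0.
split=> //.
- by move=> v; exists (Some v).
- suff H a b : gadget_wt a b != 0 -> exists x, (a \in bag x) && (b \in bag x).
    by move=> a b /hG /orP[/H //|/H [x]]; rewrite andbC; exists x.
  rewrite /gadget_wt !addn_eq0 !negb_and -!orbA => /or4P[||| /orP[]].
  + rewrite muln_eq0 negb_or eqb0 negbK => /andP[_ /andP[sb _]].
    by exists (Some a); rewrite self core // sb orbT.
  + rewrite eqb0 negbK => /andP[la /eqP <-]; exists (Some a).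
    by rewrite self /= !inE la inE eqxx !orbT.
  + rewrite eqb0 negbK => /andP[la /eqP <-]; exists (Some a).
    by rewrite self core // leaf_ctr.
  + rewrite eqb0 negbK => /andP[lb /eqP <-]; exists (Some b).
    by rewrite self core // leaf_sel_isS ?orbT.
  + rewrite eqb0 negbK => /andP[ha /eqP <-]; exists (Some a).
    by rewrite self core // hub_sel ?orbT.
- move=> v x y vx vy; set R := [rel a b | _].
  have symR : symmetric R.
    by move=> a b; rewrite /= tree_rel_sym; congr (_ && _); apply: andbC.
  case: (boolP (isC v || isS v)) => cv.
    have [_ _ con _] := tree; rewrite (eq_connect (e' := tree_rel par)) //.
    by move=> a b; rewrite /= !core // !andbT.
  suff H z : v \in bag z -> connect R z (Some v).
    by apply: connect_trans (H _ vx) _; rewrite (sym_connect_sym symR) H.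
  case: z => [w|]; rewrite !inE (negbTE cv) //=.
  case: (eqVneq v w) => [-> _|ne /=]; first exact: connect0.
  case: (boolP (isL w)) => lw; rewrite inE // => /eqP e.
  apply: connect1; rewrite /= self e /tree_rel /= lw eqxx /= !inE lw inE eqxx !orbT !andbT.
  by rewrite -e; apply/eqP => -[] /eqP; rewrite eq_sym (negbTE ne).
Qed.

End Gadget.

(** * Digits in base [b], used to code vertices and tuples by numbers *)

Definition dg (b c l : nat) : nat := c %/ b ^ l %% b.

Definition hcode (b : nat) (s : seq nat) : nat := foldr (fun a r => a + b * r) 0 s.

Lemma dgS b c l : dg b c l.+1 = dg b (c %/ b) l.
Proof. by rewrite /dg expnS divnMA. Qed.

Lemma dg0 b c : dg b c 0 = c %% b.
Proof. by rewrite /dg expn0 divn1. Qed.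

Lemma dg_lt b c l : 0 < b -> dg b c l < b.
Proof. exact: ltn_pmod. Qed.

Lemma hcode_lt b s : all (gtn b) s -> hcode b s < b ^ size s.
Proof.
elim: s => //= a s IH /andP[ab /IH lt]; rewrite expnS.
by have : b * (hcode b s).+1 <= b * b ^ size s; [rewrite leq_mul2l lt orbT|lia].
Qed.

Lemma dg_hcode b s i : all (gtn b) s -> dg b (hcode b s) i = nth 0 s i.
Proof.
elim: s i => [|a s IH] i /=; first by rewrite /dg div0n mod0n nth_nil.
case/andP=> ab /IH {}IH; have b0 : 0 < b by lia.
case: i => [|i]; first by rewrite dg0 addnC mulnC modnMDl modn_small.
by rewrite dgS addnC mulnC divnMDl // divn_small // addn0 IH.
Qed.

Lemma dg_inj b n c c' : c < b ^ n -> c' < b ^ n ->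
  (forall i, i < n -> dg b c i = dg b c' i) -> c = c'.
Proof.
elim: n c c' => [|n IH] c c'; first by rewrite expn0; case: c c' => [|c] [|c'].
rewrite expnS => l1 l2 h; have b0 : 0 < b by case: b l1 {h l2 IH}.
rewrite (divn_eq c b) (divn_eq c' b); congr (_ * _ + _); last first.
  by have := h 0 isT; rewrite !dg0.
apply: IH => [||i lt]; rewrite ?ltn_divLR // 1?mulnC //.
by rewrite -!dgS h.
Qed.

Lemma dg_exists b n (f : nat -> nat) : (forall i, i < n -> f i < b) ->
  exists2 c, c < b ^ n & forall i, i < n -> dg b c i = f i.
Proof.
move=> h; have al : all (gtn b) (mkseq f n).
  by apply/allP => x /mapP[i]; rewrite mem_iota => /andP[_ lt] ->; apply: h.
exists (hcode b (mkseq f n)); first by have := hcode_lt al; rewrite size_mkseq.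
by move=> i lt; rewrite dg_hcode // nth_mkseq.
Qed.

(** * The gadget of a packing problem, on numbers as vertices *)

Section PackingGadget.
Variables (nCl nIt nC q M : nat) (ok : nat -> nat -> bool) (amt : nat -> nat -> nat -> nat).

(** The digits are kind, class, item, counter and unit; a field that a kind does not use is 0. *)
Definition vcode a b c d e := hcode M [:: a; b; c; d; e].
Definition vsize := M ^ 5.

(** Every number below [vsize] is a vertex. Codes that are out of range or have a nonzero idle field
    get kind 5 and stay isolated, so each object has exactly one code. The number of fillers
    completes the [nC] counters to [q.-1]. *)
Definition vkind (v : nat) : nat :=
  let a := dg M v 0 in let cl := dg M v 1 in let it := dg M v 2 in
  let ct := dg M v 3 in let u := dg M v 4 in
  if a == 0 then (if [&& cl == 0, it == 0, ct < nC & u == 0] then 0 else 5)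
  else if a == 1 then (if [&& cl < nCl, it == 0, ct == 0 & u == 0] then 1 else 5)
  else if a == 2 then
    (if [&& cl < nCl, it < nIt, ok cl it, ct == 0 & u == 0] then 2 else 5)
  else if a == 3 then
    (if [&& cl < nCl, it < nIt, ok cl it, ct < nC & u < amt cl it ct] then 3 else 5)
  else if a == 4 then
    (if [&& cl < nCl, it == 0, ct == 0 & u < q - nC.+1] then 4 else 5)
  else 5.

Definition vsel v := vcode 1 (dg M v 1) 0 0 0.
Definition vhub v := vcode 2 (dg M v 1) (dg M v 2) 0 0.
Definition vctr v := vcode 0 0 0 (dg M v 3) 0.
(** For each class, item and counter, the [amt] leaves form one chain that counts the unit digit
    down and ends in the hub. *)
Definition vnext v := if dg M v 4 == 0 then vhub v
  else vcode 3 (dg M v 1) (dg M v 2) (dg M v 3) (dg M v 4).-1.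

(** The weights of the gadget rewritten on plain numbers, as the program has to compute them. *)
Definition vwt (u v : nat) : nat :=
  (4 * vsize + 1) *
    ((vkind v == 1) && ((vkind u == 0) || (vkind u == 4) && (vsel u == v)))
  + ((vkind u == 3) && (vnext u == v)) + ((vkind u == 3) && (vctr u == v))
  + ((vkind v == 3) && (vsel v == u)) + ((vkind u == 2) && (vsel u == v)).

Definition vgoal : nat :=
  \sum_(v < vsize) ((vkind v == 1) * ((4 * vsize + 1) * q.-1 + 1) + (vkind v == 3) * 2).

Definition packing : Prop :=
  exists chi : nat -> nat,
    (forall cl, cl < nCl -> chi cl < nIt /\ ok cl (chi cl)) /\
    (forall ct, ct < nC -> \sum_(cl < nCl) amt cl (chi cl) ct <= q).

Hypotheses (M5 : 5 <= M) (clM : nCl <= M) (itM : nIt <= M) (cM : nC <= M) (qM : q <= M).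
Hypothesis cq : nC < q.
Hypothesis amt_le : forall cl it ct, amt cl it ct <= q.

Let V := 'I_vsize.

Lemma vsize_gt0 : 0 < vsize. Proof. by rewrite expn_gt0; lia. Qed.

Let v0 : V := Ordinal vsize_gt0.
Let vtx a b c d e : V := insubd v0 (vcode a b c d e).
Let D (v : V) i := dg M v i.

Lemma dgM v i : dg M v i < M. Proof. by apply: dg_lt; lia. Qed.

Lemma vcode_lt a b c d e : [&& a < M, b < M, c < M, d < M & e < M] ->
  vcode a b c d e < vsize.
Proof. by move=> h; apply: hcode_lt; rewrite /= andbT. Qed.

Lemma val_vtx a b c d e : [&& a < M, b < M, c < M, d < M & e < M] ->
  vtx a b c d e = vcode a b c d e :> nat.
Proof. by move=> h; rewrite val_insubd vcode_lt. Qed.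

Lemma D_vtx a b c d e i : [&& a < M, b < M, c < M, d < M & e < M] ->
  D (vtx a b c d e) i = nth 0 [:: a; b; c; d; e] i.
Proof. by move=> h; rewrite /D val_vtx // dg_hcode //= andbT. Qed.

Lemma vtx_eq (v w : V) : D v 0 = D w 0 -> D v 1 = D w 1 -> D v 2 = D w 2 ->
  D v 3 = D w 3 -> D v 4 = D w 4 -> v = w.
Proof.
move=> h0 h1 h2 h3 h4; apply: val_inj; apply: (@dg_inj M 5) => //; try exact: ltn_ord.
by case=> [|[|[|[|[|i]]]]].
Qed.

Let kind (v : V) := vkind v.
Let selof (v : V) := vtx 1 (D v 1) 0 0 0.
Let hubof (v : V) := vtx 2 (D v 1) (D v 2) 0 0.
Let ctrof (v : V) := vtx 0 0 0 (D v 3) 0.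
Let next (v : V) := if D v 4 == 0 then hubof v
  else vtx 3 (D v 1) (D v 2) (D v 3) (D v 4).-1.
Let pos (v : V) := D v 4.

Lemma kindC v : isC kind v = [&& D v 0 == 0, D v 1 == 0, D v 2 == 0, D v 3 < nC & D v 4 == 0].
Proof.
rewrite /isC /kind /vkind /D; case: (dg M v 0) => [|[|[|[|[|a]]]]] //=; by case: ifP.
Qed.
Lemma kindS v : isS kind v = [&& D v 0 == 1, D v 1 < nCl, D v 2 == 0, D v 3 == 0 & D v 4 == 0].
Proof.
rewrite /isS /kind /vkind /D; case: (dg M v 0) => [|[|[|[|[|a]]]]] //=; by case: ifP.
Qed.
Lemma kindH v : isH kind v = [&& D v 0 == 2, D v 1 < nCl, D v 2 < nIt, ok (D v 1) (D v 2),
  D v 3 == 0 & D v 4 == 0].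
Proof.
rewrite /isH /kind /vkind /D; case: (dg M v 0) => [|[|[|[|[|a]]]]] //=; by case: ifP.
Qed.
Lemma kindL v : isL kind v = [&& D v 0 == 3, D v 1 < nCl, D v 2 < nIt, ok (D v 1) (D v 2),
  D v 3 < nC & D v 4 < amt (D v 1) (D v 2) (D v 3)].
Proof.
rewrite /isL /kind /vkind /D; case: (dg M v 0) => [|[|[|[|[|a]]]]] //=; by case: ifP.
Qed.
Lemma kindF v : isF kind v = [&& D v 0 == 4, D v 1 < nCl, D v 2 == 0, D v 3 == 0
  & D v 4 < q - nC.+1].
Proof.
rewrite /isF /kind /vkind /D; case: (dg M v 0) => [|[|[|[|[|a]]]]] //=; by case: ifP.
Qed.

Lemma DM v i : D v i < M. Proof. exact: dgM. Qed.

Let M0 : 0 < M. Proof. by lia. Qed.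
Let M1 : 1 < M. Proof. by lia. Qed.
Let M2 : 2 < M. Proof. by lia. Qed.
Let M3 : 3 < M. Proof. by lia. Qed.
Let M4 : 4 < M. Proof. by lia. Qed.

Lemma predM v i : (D v i).-1 < M. Proof. by have := DM v i; lia. Qed.

Let ltM := (M0, M1, M2, M3, M4, DM, predM).

Lemma D_sel v i : D (selof v) i = nth 0 [:: 1; D v 1; 0; 0; 0] i.
Proof. by apply: D_vtx; rewrite !ltM. Qed.
Lemma D_hub v i : D (hubof v) i = nth 0 [:: 2; D v 1; D v 2; 0; 0] i.
Proof. by apply: D_vtx; rewrite !ltM. Qed.
Lemma D_ctr v i : D (ctrof v) i = nth 0 [:: 0; 0; 0; D v 3; 0] i.
Proof. by apply: D_vtx; rewrite !ltM. Qed.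
Lemma D_next v i : D (next v) i = if D v 4 == 0 then D (hubof v) i
  else nth 0 [:: 3; D v 1; D v 2; D v 3; (D v 4).-1] i.
Proof. by rewrite /next; case: ifP => // _; apply: D_vtx; rewrite !ltM. Qed.

Lemma leaf_ctr p : isL kind p -> isC kind (ctrof p).
Proof. by rewrite kindL kindC !D_ctr /= => /and5P[_ _ _ _ /andP[-> _]]. Qed.

Lemma leaf_hub p : isL kind p -> isH kind (hubof p).
Proof. by rewrite kindL kindH !D_hub /= => /and5P[_ -> -> -> _]. Qed.

Lemma hub_sel h : isH kind h -> isS kind (selof h).
Proof. by rewrite kindH kindS !D_sel /= => /and3P[_ -> _]. Qed.

Lemma sel_hub p : selof (hubof p) = selof p.
Proof. by rewrite /selof D_hub. Qed.

Lemma leaf_next p : isL kind p -> next p != hubof p ->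
  [/\ isL kind (next p), hubof (next p) = hubof p & pos (next p) < pos p].
Proof.
case: (posnP (D p 4)) => [e|u0 lp _]; first by rewrite /next e !eqxx.
have nz : D p 4 == 0 = false by lia.
split.
- move: lp; rewrite !kindL !D_next nz /= => /and5P[_ -> -> -> /andP[-> h]] /=; lia.
- by rewrite /hubof !D_next nz.
- by rewrite /pos D_next nz /=; lia.
Qed.

(** A predecessor of [v] is determined by its counter: class and item are those of [v], and the unit
    is one more than that of a leaf [v], or 0 if [v] is a hub. So there are at most [nC] of them. *)
Lemma next_card v : #|[set p | isL kind p && (next p == v)]| < q.
Proof.
pose g (i : 'I_nC) := vtx 3 (D v 1) (D v 2) i (if isL kind v then (D v 4).+1 else 0).
apply: leq_ltn_trans cq; rewrite -[X in _ <= X]card_ord.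
apply: leq_trans (leq_imset_card g 'I_nC); apply: subset_leq_card.
apply/subsetP => p; rewrite inE => /andP[lp /eqP e].
have := lp; rewrite kindL => /and5P[/eqP p0 p1 p2 pok /andP[p3 p4]].
apply/imsetP; exists (Ordinal p3) => //; rewrite /g /=.
have E i : D v i = if D p 4 == 0 then D (hubof p) i
    else nth 0 [:: 3; D p 1; D p 2; D p 3; (D p 4).-1] i by rewrite -e D_next.
have e1 : D v 1 = D p 1 by rewrite E D_hub; case: ifP.
have e2 : D v 2 = D p 2 by rewrite E D_hub; case: ifP.
have e4 : (if isL kind v then (D v 4).+1 else 0) = D p 4.
  case: (posnP (D p 4)) => [z|u0].
    by rewrite kindL E D_hub z.
  have nz : D p 4 == 0 = false by lia.
  rewrite kindL !E nz /= p1 p2 pok p3 /= ifT; lia.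
rewrite e1 e2 e4; apply: vtx_eq; rewrite D_vtx // !ltM //.
Qed.

Lemma card_vtx_imset m (f : 'I_m -> V) i : (forall j, D (f j) i = j) ->
  #|[set f j | j : 'I_m]| = m.
Proof.
move=> h; rewrite card_imset ?card_ord // => a b e.
by apply: val_inj; rewrite /= -!h e.
Qed.

Lemma setC_card : #|[set v | isC kind v]| = nC.
Proof.
pose f (j : 'I_nC) := vtx 0 0 0 j 0.
have Df j i : D (f j) i = nth 0 [:: 0; 0; 0; val j; 0] i.
  by apply: D_vtx; rewrite !ltM (leq_trans (ltn_ord j)).
rewrite -[RHS](@card_vtx_imset _ f 3) => [|j]; last by rewrite Df.
congr #|pred_of_set _|; apply/setP => v; rewrite inE kindC; apply/idP/imsetP => [|[j _ ->]].
  case/and5P=> /eqP h0 /eqP h1 /eqP h2 h3 /eqP h4; exists (Ordinal h3) => //.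
  by apply: vtx_eq; rewrite Df.
by rewrite !Df /= ltn_ord.
Qed.

Lemma sel_card s : isS kind s ->
  #|[set u | isC kind u || isF kind u && (selof u == s)]|.+1 = q.
Proof.
rewrite kindS => /and5P[/eqP s0 s1 /eqP s2 /eqP s3 /eqP s4].
pose f (j : 'I_(q - nC.+1)) := vtx 4 (D s 1) 0 0 j.
have Df j i : D (f j) i = nth 0 [:: 4; D s 1; 0; 0; val j] i.
  by apply: D_vtx; rewrite !ltM /=; have := ltn_ord j; lia.
have -> : [set u | isC kind u || isF kind u && (selof u == s)] =
    [set u | isC kind u] :|: [set f j | j : 'I_(q - nC.+1)].
  apply/setP => u; rewrite !inE; congr (_ || _); apply/idP/imsetP => [|[j _ ->]].
    rewrite kindF => /andP[/and5P[/eqP u0 u1 /eqP u2 /eqP u3 u4] /eqP e].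
    by exists (Ordinal u4) => //; apply: vtx_eq; rewrite Df //= -e D_sel.
  rewrite kindF !Df /= s1 ltn_ord /=; apply/eqP.
  by apply: vtx_eq; rewrite D_sel //= Df.
rewrite cardsU disjoint_setI0 ?cards0 ?subn0.
  rewrite setC_card (@card_vtx_imset _ f 4) => [|j]; last by rewrite Df.
  by lia.
rewrite -setI_eq0; apply/eqP/setP => u; rewrite !inE kindC.
apply/negP => /andP[/andP[/eqP h _] /imsetP[j _ e]].
by move: h; rewrite e Df.
Qed.

Lemma core_card : #|[set v | isC kind v || isS kind v]| <= nC + nCl.
Proof.
apply: leq_trans (_ : #|[set v | isC kind v] :|: [set v | isS kind v]| <= _).
  by apply: subset_leq_card; apply/subsetP => v; rewrite !inE.
apply: leq_trans (leq_card_setU _ _) _; rewrite setC_card leq_add2l.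
rewrite -[X in _ <= X]card_ord; pose g (i : 'I_nCl) := vtx 1 i 0 0 0.
apply: leq_trans (leq_imset_card g 'I_nCl); apply: subset_leq_card.
apply/subsetP => s; rewrite inE kindS => /and5P[/eqP s0 s1 /eqP s2 /eqP s3 /eqP s4].
apply/imsetP; exists (Ordinal s1) => //.
by apply: vtx_eq; rewrite D_vtx // !ltM.
Qed.

(** Sort the leaves by class; within a class the leaves of the chosen item at [ct] are numbered by
    the units below the amount. *)
Lemma leaves_card (chi : nat -> nat) ct : ct < nC ->
  (forall cl, cl < nCl -> chi cl < nIt /\ ok cl (chi cl)) ->
  #|[set p | [&& isL kind p, D p 3 == ct & chi (D p 1) == D p 2]]| =
  \sum_(cl < nCl) amt cl (chi cl) ct.
Proof.
move=> ltc hchi; rewrite -sum_bool_card.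
transitivity (\sum_(p : V) \sum_(cl < nCl)
    ([&& isL kind p, D p 3 == ct, chi (D p 1) == D p 2 & D p 1 == cl] : nat)).
  apply: eq_bigr => p _; case: (boolP (isL kind p)) => lp /=; last by rewrite big1.
  have p1 : D p 1 < nCl by move: lp; rewrite kindL => /and3P[].
  rewrite (bigD1 (Ordinal p1)) //= eqxx andbT big1 ?addn0 // => cl ne.
  by rewrite [D p 1 == cl]eq_sym; move: ne; rewrite -val_eqE /= => /negbTE ->; rewrite !andbF.
rewrite exchange_big; apply: eq_bigr => cl _; rewrite sum_bool_card.
have [c1 c2] := hchi cl (ltn_ord cl).
pose f (j : 'I_(amt cl (chi cl) ct)) := vtx 3 cl (chi cl) ct j.
have Df j i : D (f j) i = nth 0 [:: 3; val cl; chi cl; ct; val j] i.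
  apply: D_vtx; rewrite !ltM /=; have := ltn_ord j; have := amt_le cl (chi cl) ct.
  by have := ltn_ord cl; lia.
rewrite -[RHS](@card_vtx_imset _ f 4) => [|j]; last by rewrite Df.
congr #|pred_of_set _|; apply/setP => p; rewrite inE; apply/idP/imsetP => [|[j _ ->]].
  case/and4P=> lp /eqP p3 /eqP hp /eqP p1.
  move: lp; rewrite kindL p3 p1 -hp p1 => /and5P[/eqP p0 _ _ _ /andP[_ p4]].
  by exists (Ordinal p4) => //; apply: vtx_eq; rewrite Df //= -hp p1.
by rewrite kindL !Df /= c1 c2 ltc !ltn_ord !eqxx.
Qed.

Lemma wtE (u v : V) : gadget_wt kind selof ctrof next u v = vwt u v.
Proof.
rewrite /gadget_wt /vwt /big_arc card_ord /isS /isC /isF /isL /isH /kind.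
have e1 (a b : V) : (selof a == b) = (vsel a == b :> nat).
  by rewrite -val_eqE /= val_vtx // !ltM.
have e2 (a b : V) : (ctrof a == b) = (vctr a == b :> nat).
  by rewrite -val_eqE /= val_vtx // !ltM.
have e3 (a b : V) : (next a == b) = (vnext a == b :> nat).
  rewrite -val_eqE /next /vnext /D; case: ifP => _ /=; rewrite val_vtx //.
    by rewrite !ltM.
  by have := predM a 4; rewrite /D => ->; rewrite !ltM.
by rewrite !e1 e2 e3.
Qed.

Theorem packing_bnsl :
  (exists D : rel 'I_vsize, [/\ acyclic D, forall v, #|parents D v| <= q &
     vgoal <= \sum_v \sum_(u | D u v) vwt u v]) <-> packing.
Proof.
have E (A : rel V) : gadget_score kind selof ctrof next A = \sum_v \sum_(u | A u v) vwt u v.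
  by apply: eq_bigr => v _; apply: eq_bigr => u _; apply: wtE.
have G : gadget_goal kind q = vgoal.
  by rewrite /gadget_goal /vgoal card_ord.
have key := gadget_correct leaf_ctr leaf_hub hub_sel (fun p _ => sel_hub p) leaf_next
  next_card sel_card.
have S cl : cl < nCl -> isS kind (vtx 1 cl 0 0 0).
  by move=> lt; rewrite kindS !D_vtx /= ?lt // !ltM; lia.
have Dsel cl i : cl < nCl -> D (vtx 1 cl 0 0 0) i = nth 0 [:: 1; cl; 0; 0; 0] i.
  by move=> lt; rewrite D_vtx // !ltM /=; lia.
have Dctr ct i : ct < nC -> D (vtx 0 0 0 ct 0) i = nth 0 [:: 0; 0; 0; ct; 0] i.
  by move=> lt; rewrite D_vtx // !ltM /=; lia.
have L1 p : isL kind p -> D p 1 < nCl by rewrite kindL => /and3P[].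
have ctrE p ct : ct < nC -> (ctrof p == vtx 0 0 0 ct 0) = (D p 3 == ct).
  move=> lt; apply/eqP/eqP => [e|<- //].
  by have := D_ctr p 3; rewrite e Dctr.
split.
- move=> [A [h1 h2 h3]].
  have [|chi [hc1 hc2]] := key.1; first by exists A; split=> //; rewrite E G.
  pose chi' cl := D (chi (vtx 1 cl 0 0 0)) 2.
  have hchi cl : cl < nCl -> chi (vtx 1 cl 0 0 0) = vtx 2 cl (chi' cl) 0 0 /\
      (chi' cl < nIt /\ ok cl (chi' cl)).
    move=> lt; have [hh hs] := hc1 _ (S _ lt).
    move: hh; rewrite kindH => /and5P[/eqP a0 a1 a2 a3 /andP[/eqP a4 /eqP a5]].
    have a6 : D (chi (vtx 1 cl 0 0 0)) 1 = cl.
      by have := D_sel (chi (vtx 1 cl 0 0 0)) 1; rewrite hs Dsel.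
    rewrite a6 in a3; split=> //.
    apply: vtx_eq; rewrite D_vtx // /chi' !ltM /=; lia.
  exists chi'; split=> [cl /hchi[] //|ct lt].
  rewrite -(leaves_card lt); last by move=> cl /hchi[].
  have cc : isC kind (vtx 0 0 0 ct 0) by rewrite kindC !Dctr /= ?lt.
  apply: leq_trans (hc2 _ cc); apply: subset_leq_card; apply/subsetP => p.
  rewrite !inE ctrE // => /and3P[lp -> /eqP hp]; rewrite lp /=.
  by rewrite (hchi _ (L1 _ lp)).1 hp eqxx.
- move=> [chi [hc1 hc2]].
  have [|A [h1 h2 h3]] := key.2; last by exists A; split=> //; rewrite -E -G.
  exists (fun s => vtx 2 (D s 1) (chi (D s 1)) 0 0); split.
    move=> s; rewrite kindS => /and5P[/eqP s0 s1 /eqP s2 /eqP s3 /eqP s4].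
    have [c1 c2] := hc1 _ s1.
    have Dh i : D (vtx 2 (D s 1) (chi (D s 1)) 0 0) i = nth 0 [:: 2; D s 1; chi (D s 1); 0; 0] i.
      by apply: D_vtx; rewrite !ltM /=; lia.
    split; first by rewrite kindH !Dh /= s1 c1 c2.
    by apply: vtx_eq; rewrite D_sel /= ?Dh.
  move=> c; rewrite kindC => /and5P[/eqP c0 /eqP c1 /eqP c2 c3 /eqP c4].
  have -> : c = vtx 0 0 0 (D c 3) 0 by apply: vtx_eq; rewrite Dctr.
  apply: leq_trans (hc2 _ c3); rewrite -(leaves_card c3) //.
  apply: subset_leq_card; apply/subsetP => p.
  rewrite !inE ctrE // => /and3P[lp -> /eqP hp]; rewrite lp /=.
  have := congr1 (D^~ 2) hp; rewrite D_hub D_sel /= D_vtx /= => [->//|].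
  by have := hc1 _ (L1 _ lp); rewrite !ltM /=; lia.
Qed.

Theorem packing_treewidth (G : rel 'I_vsize) :
  (forall a b, G a b -> (vwt a b != 0) || (vwt b a != 0)) ->
  treewidth_at_most G (nC + nCl).+1.
Proof.
move=> hG.
have [|T [e [B [h1 h2]]]] := @gadget_treewidth V kind selof hubof ctrof next pos leaf_ctr
  leaf_hub hub_sel (fun p _ => sel_hub p) leaf_next G.
  by move=> a b /hG; rewrite !wtE.
exists T, e, B; split=> // x; apply: leq_trans (h2 x) _.
by rewrite !ltnS; apply: core_card.
Qed.

End PackingGadget.

(** * From local constraints to packing *)

Section LocalConstraints.
Variables (K N s : nat) (A : nat -> nat -> bool).

(* [K] variables with values below [N]; the relation [A] must hold for every
   [s]-tuple of variables, given with its tuple of values by the digits of [J]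
   and [U]. *)
Definition local_csp : Prop :=
  exists z : nat -> nat, (forall i, i < K -> z i < N) /\
    forall J, J < K ^ s -> exists2 U, U < N ^ s &
      (forall l, l < s -> dg N U l = z (dg K J l)) /\ A J U.

Definition csp_counters : nat := 2 * (s * K ^ s).
(** Larger than the number of counters, as the gadget requires of the degree bound, and larger than
    every value, so that complements do not truncate. *)
Definition csp_cap : nat := csp_counters + 1 + N.

Definition csp_item_ok (cl it : nat) : bool := if cl < K then it < N else A (cl - K) it.

(* The classes below [K] choose the values of the variables, the class [K + J]
   chooses the values seen by the tuple [J].  The counters [(J, l, 0)] and
   [(J, l, 1)] force the two choices for the [l]-th variable of [J] to agree:
   the amounts [u + (q - z)] and [(q - u) + z] are both at most [q] only if
   [u = z]. *)
Definition csp_amount (cl it ct : nat) : nat :=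
  let l := ct %/ 2 %% s in let J := ct %/ 2 %/ s in
  if cl < K then
    (if cl == dg K J l then (if ct %% 2 == 0 then csp_cap - it else minn it csp_cap) else 0)
  else
    (if cl - K == J then (if ct %% 2 == 0 then dg N it l else csp_cap - dg N it l) else 0).

Hypothesis N0 : 0 < N.

(** The bound covers inadmissible items as well, thanks to the clipping of [it] in [csp_amount]. *)
Lemma csp_amount_le cl it ct : csp_amount cl it ct <= csp_cap.
Proof.
rewrite /csp_amount; case: ifP => _; case: ifP => _ //; case: ifP => _; try lia.
by have := dg_lt it (ct %/ 2 %% s) N0; rewrite /csp_cap; lia.
Qed.

Hypotheses (K0 : 0 < K) (s0 : 0 < s).

(** Only two classes load a given counter: the variable that it concerns and the tuple that reads
    this variable. *)
Lemma csp_amount_sum (chi : nat -> nat) ct : ct < csp_counters ->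
  let l := ct %/ 2 %% s in let J := ct %/ 2 %/ s in
  \sum_(cl < K + K ^ s) csp_amount cl (chi cl) ct =
  csp_amount (dg K J l) (chi (dg K J l)) ct + csp_amount (K + J) (chi (K + J)) ct.
Proof.
move=> lt l J.
have i0 : dg K J l < K by apply: dg_lt.
have i1 : dg K J l < K + K ^ s by lia.
have JK : J < K ^ s.
  rewrite /J ltn_divLR // ltn_divLR //; move: lt; rewrite /csp_counters; lia.
have j1 : K + J < K + K ^ s by lia.
rewrite (bigD1 (Ordinal i1)) //= (bigD1 (Ordinal j1)) /=; last first.
  by rewrite -val_eqE /=; lia.
rewrite big1 ?addn0 // => cl /andP[]; rewrite -!val_eqE /= => n1 n2.
rewrite /csp_amount -/l -/J (negbTE n1); case: ifP => // h.
by case: eqP => // e; lia.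
Qed.

Theorem local_csp_packing :
  packing (K + K ^ s) (N ^ s) csp_counters csp_cap csp_item_ok csp_amount <-> local_csp.
Proof.
(* All classes draw from the same [N ^ s] item numbers, so values have to be among them. *)
have NNs : N <= N ^ s by case: s s0 => // n _; rewrite expnS leq_pmulr // expn_gt0 N0.
split=> [[chi [h1 h2]]|[z [h1 h2]]].
- have chiK i : i < K -> chi i < N.
    by move=> lt; have [|_] := h1 i; [lia|rewrite /csp_item_ok lt].
  exists chi; split=> // J JK.
  have [|hU hA] := h1 (K + J); first by lia.
  exists (chi (K + J)) => //; split; last first.
    by move: hA; rewrite /csp_item_ok ifF ?addKn //; lia.
  (* The number of the counter [(J, l, b)]. *)
  move=> l ls; pose ct b := b + 2 * (l + s * J).
  have ctb b : b < 2 -> [/\ ct b < csp_counters, ct b %% 2 = b, ct b %/ 2 %% s = l & ct b %/ 2 %/ s = J].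
    move=> b2; have e2 : ct b %/ 2 = l + s * J.
      by rewrite /ct addnC mulnC divnMDl // divn_small // addn0.
    split; rewrite ?e2.
    - rewrite /ct /csp_counters; have : s * J.+1 <= s * K ^ s by rewrite leq_mul2l JK orbT.
      by rewrite mulnS; lia.
    - by rewrite /ct addnC mulnC modnMDl modn_small.
    - by rewrite addnC mulnC modnMDl modn_small.
    - by rewrite addnC mulnC divnMDl // divn_small // addn0.
  have i0 : dg K J l < K by apply: dg_lt.
  have kJ : K + J < K = false by lia.
  have dN := dg_lt (chi (K + J)) l N0; have cN := chiK _ i0.
  have [c1 c2 c3 c4] := ctb 0 isT; have [d1 d2 d3 d4] := ctb 1 isT.
  have := h2 _ c1; have := h2 _ d1; rewrite !csp_amount_sum // c3 c4 d3 d4.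
  rewrite /csp_amount c2 c3 c4 d2 d3 d4 i0 kJ eqxx addKn eqxx /= /csp_cap.
  lia.
- have ex J : exists U, J < K ^ s -> [/\ U < N ^ s,
      forall l, l < s -> dg N U l = z (dg K J l) & A J U].
    by case: (ltnP J (K ^ s)) => [/h2 [U ? []]|_]; [exists U|exists 0].
  have [U hU] := choice ex.
  pose chi cl := if cl < K then z cl else U (cl - K).
  exists chi; split.
    move=> cl lt; rewrite /chi /csp_item_ok; case: (ltnP cl K) => le.
      by have := h1 _ le; split=> //; lia.
    by have [|? ? ?] := hU (cl - K); first lia.
  move=> ct lt; rewrite csp_amount_sum //=.
  set l := _ %% s; set J := _ %/ s.
  have i0 : dg K J l < K by apply: dg_lt.
  have kJ : K + J < K = false by lia.
  have JK : J < K ^ s.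
    rewrite /J ltn_divLR // ltn_divLR //; move: lt; rewrite /csp_counters; lia.
  have ls : l < s by rewrite ltn_pmod.
  have [_ hd _] := hU J JK.
  rewrite /csp_amount -/l -/J /chi i0 kJ eqxx addKn eqxx hd //.
  by have := h1 _ i0; rewrite /csp_cap; case: ifP => _; lia.
Qed.

End LocalConstraints.

(** * From circuits to local constraints *)

Section Checks.
Variables (tag ar : nat -> nat) (pr : nat -> nat -> nat).

(** These checks recurse on a depth [j] fixed in advance rather than on the circuit; for constant
    [j] they are nested loops. Running out of depth fails only in [deep], which thereby makes the
    other two conclusive. *)
Fixpoint deep (j g : nat) : bool :=
  if j is j'.+1 then all (fun l => deep j' (pr g l)) (iota 0 (ar g)) else false.

Fixpoint small (j g : nat) : bool :=
  if j is j'.+1 then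
    (ar g <= 2) && all (fun l => small j' (pr g l)) (iota 0 (ar g))
  else true.

Fixpoint weft1 (j g : nat) : bool :=
  if j is j'.+1 then
    (ar g <= 2) && all (fun l => weft1 j' (pr g l)) (iota 0 (ar g))
    || (2 < ar g) && all (fun l => small j' (pr g l)) (iota 0 (ar g))
  else true.

(* The variables [0 .. k+1] hold [0], the successors of the [k] true inputs in
   increasing order, and [G + 1]; the variable [k + 2 + o] holds the child chosen
   at position [o] of the evaluation game.  A view gives the values [U l] of the
   variables [J l], [l < s].  Two consecutive variables with values [u < w] show
   that the inputs strictly between them are false. *)
Section View.
Variables (G k s : nat) (J U : nat -> nat).

Definition known_true (g : nat) : bool :=
  has (fun l => [&& 0 < J l, J l <= k & U l == g.+1]) (iota 0 s).

Definition known_false (g : nat) : bool :=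
  has (fun l => has (fun l' =>
    [&& J l' == (J l).+1, J l' <= k.+1, U l < g.+1 & g.+1 < U l']) (iota 0 s)) (iota 0 s).

Definition input_poss (g : nat) (v : bool) : bool :=
  v && ~~ known_false g || ~~ v && ~~ known_true g.

(* Whether the view leaves it possible that the gate [g] has the value [v]. *)
Fixpoint poss (j g : nat) (v : bool) : bool :=
  if j is j'.+1 then
    [|| (tag g == 0) && input_poss g v,
        (tag g == 1) && poss j' (pr g 0) (~~ v),
        [&& 1 < tag g, (tag g == 3) == v
          & has (fun l => poss j' (pr g l) v) (iota 0 (ar g))]
      | [&& 1 < tag g, (tag g == 3) != v
          & all (fun l => poss j' (pr g l) v) (iota 0 (ar g))]]
  else true.

(* The claim that [g] has the value [v], with the choices of the prover made
   explicit above the first large universal gate.  The game below the position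
   [o] uses the [2 ^ j - 1] positions from [o] on. *)
Fixpoint chk (j g : nat) (v : bool) (o : nat) : bool :=
  if j is j'.+1 then
    [|| (tag g == 0) && input_poss g v,
        (tag g == 1) && chk j' (pr g 0) (~~ v) o.+1,
        [&& 1 < tag g, (tag g == 3) == v
          & all (fun l => (J l != k.+2 + o)
              || (U l < ar g) && chk j' (pr g (U l)) v o.+1) (iota 0 s)],
        [&& 1 < tag g, (tag g == 3) != v, ar g <= 2,
            chk j' (pr g 0) v o.+1 & chk j' (pr g 1) v (o + 2 ^ j')]
      | [&& 1 < tag g, (tag g == 3) != v, 2 < ar g
          & all (fun l => poss j' (pr g l) v) (iota 0 (ar g))]]
  else true.

Definition slot_ok (l : nat) : bool :=
  [&& (J l != 0) || (U l == 0), (J l != k.+1) || (U l == G.+1)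
    & [|| J l == 0, k < J l | [&& 0 < U l, U l <= G & tag (U l).-1 == 0]]].

Definition order_ok (l l' : nat) : bool :=
  [|| J l' != (J l).+1, k.+1 < J l' | U l < U l'].

Definition view_ok (D : nat) : bool :=
  [&& all slot_ok (iota 0 s), all (fun l => all (order_ok l) (iota 0 s)) (iota 0 s)
    & chk D G.-1 true 0].

End View.

Lemma all_iotaP (P : pred nat) n : reflect (forall l, l < n -> P l) (all P (iota 0 n)).
Proof.
by apply: (iffP allP) => h l; [move=> lt; apply: h; rewrite mem_iota|rewrite mem_iota; apply: h].
Qed.

Lemma has_iotaP (P : pred nat) n : reflect (exists2 l, l < n & P l) (has P (iota 0 n)).
Proof.
by apply: (iffP hasP) => -[l]; [rewrite mem_iota; exists l|exists l; rewrite ?mem_iota].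
Qed.


(** * What a view says about the values of the gates *)

Section Semantics.
Variables (G : nat).

(** A gate takes the value [b] iff some child does, with [b] true for disjunctions and false for
    conjunctions. This treats both at once: the claim that the value is [b] is existential, the
    opposite claim universal. The bound [ar g <= G] makes the index of a chosen child a legal value
    of a variable. *)
Variant gate_spec (a val : nat -> bool) (g : nat) : Prop :=
| SpecInput of tag g = 0 & ar g = 0 & val g = a g
| SpecNeg of tag g = 1 & ar g = 1 & pr g 0 < g & val g = ~~ val (pr g 0)
| SpecGate (b : bool) of tag g = 2 + b & 1 < ar g & ar g <= G
    & (forall l, l < ar g -> pr g l < g)
    & (val g == b) = has (fun l => val (pr g l) == b) (iota 0 (ar g)).

Section Fixed.
Variables (a val : nat -> bool) (k s : nat).
Hypothesis spec : forall g, g < G -> gate_spec a val g.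

Definition truthful (J U : nat -> nat) : Prop := forall g, g < G -> tag g = 0 ->
  (known_true k s J U g -> a g) /\ (known_false k s J U g -> ~~ a g).

Lemma truthful_input J U g : truthful J U -> g < G -> tag g = 0 ->
  input_poss k s J U g (a g).
Proof.
move=> tv gG tg; have [t1 t2] := tv g gG tg; rewrite /input_poss.
case ag: (a g) => /=; rewrite ?orbF.
  by apply/negP => /t2; rewrite ag.
by apply/negP => /t1; rewrite ag.
Qed.

Lemma spec_eq g (b v : bool) : (val g == b) = has (fun l => val (pr g l) == b) (iota 0 (ar g)) ->
  val g = v ->
  if v == b then has (fun l => val (pr g l) == v) (iota 0 (ar g))
  else all (fun l => val (pr g l) == v) (iota 0 (ar g)).
Proof.
move=> e vg; case: (eqVneq v b) => [eb|ne]; first by rewrite eb -e vg eb.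
have /negP nh : ~~ has (fun l => val (pr g l) == b) (iota 0 (ar g)) by rewrite -e vg.
apply/allP => l lm; apply: contraT => h; case: nh; apply/hasP; exists l => //.
by move: h ne; case: (val _) v {vg} => [] []; case: b {e}.
Qed.

Lemma poss_truthful J U : truthful J U -> forall j g, g < G -> poss k s J U j g (val g).
Proof.
move=> tv; elim=> //= j IH g gG.
case: (spec gG) => [tg _ vg|tg _ lt vg|b tg a1 aG lt vg].
- by rewrite tg vg truthful_input.
- by rewrite tg vg negbK /= IH ?orbT //; apply: ltn_trans gG.
- have nx l : l < ar g -> poss k s J U j (pr g l) (val (pr g l)).
    by move=> la; apply: IH; apply: ltn_trans gG; apply: lt.
  have tb : (tag g == 3) = b by rewrite tg; case: b {tg vg}.
  have := spec_eq vg erefl; rewrite tb eq_sym tg /=.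
  case: ifP => /= _; rewrite ?orbF ?orbT.
    by move=> /has_iotaP[l la /eqP e]; apply/has_iotaP; exists l => //; rewrite -e nx.
  by move=> /all_iotaP h; apply/all_iotaP => l la; rewrite -(eqP (h l la)) nx.
Qed.

(** The strategy [y] of the prover is fixed before the view. It names a child with the claimed value
    at each existential gate; at a small universal gate the strategies for the two children use
    disjoint intervals of positions, split at [o + 2 ^ j]. *)
Lemma chk_complete j : forall g o, g < G ->
  exists y : nat -> nat, (forall i, y i <= G) /\
    forall J U, truthful J U ->
      (forall l i, l < s -> o <= i -> i.+1 < o + 2 ^ j -> J l = k.+2 + i -> U l = y i) ->
      chk k s J U j g (val g) o.
Proof.
elim: j => [|j IH] g o gG; first by exists (fun=> 0).
have e2 : 0 < 2 ^ j by rewrite expn_gt0.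
have e2S : 2 ^ j.+1 = 2 ^ j + 2 ^ j by rewrite expnS; lia.
case: (spec gG) => [tg _ vg|tg _ lt vg|b tg a1 aG lt vg].
- by exists (fun=> 0); split=> // J U tv _ /=; rewrite tg vg truthful_input.
- have [|y [y1 y2]] := IH (pr g 0) o.+1; first by apply: ltn_trans gG.
  exists y; split=> // J U tv hy /=; rewrite tg vg negbK /= y2 ?orbT // => l i ls oi io.
  by apply: hy => //; lia.
have tb : (tag g == 3) = b by rewrite tg; case: b {tg vg}.
have ltG l : l < ar g -> pr g l < G by move=> la; apply: ltn_trans gG; apply: lt.
have := spec_eq vg erefl; case: ifP => vb.
  move=> /has_iotaP[c ca /eqP vc].
  have [|y [y1 y2]] := IH (pr g c) o.+1; first exact: ltG.
  exists (fun i => if i == o then c else y i); split=> [i|J U tv hy].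
    by case: eqP => // _; apply: leq_trans aG; apply: ltnW.
  rewrite /= tb [b == _]eq_sym vb tg /= ?orbF; apply/all_iotaP => l ls.
  case: eqP => //= e; rewrite (hy l o) ?eqxx //; last by lia.
  rewrite ca -vc y2 // => l' i ls' oi io e'; rewrite (hy l' i) ?ifF //; lia.
move=> /all_iotaP al; case: (leqP (ar g) 2) => a2; last first.
  exists (fun=> 0); split=> // J U tv _.
  rewrite /= tb [b == _]eq_sym vb tg /= leqNgt a2 /=; apply/all_iotaP => l la.
  by rewrite -(eqP (al l la)); apply: poss_truthful => //; apply: ltG.
have [|yl [yl1 yl2]] := IH (pr g 0) o.+1; first by apply: ltG; lia.
have [|yr [yr1 yr2]] := IH (pr g 1) (o + 2 ^ j); first by apply: ltG; lia.
exists (fun i => if i < o + 2 ^ j then yl i else yr i); split=> [i|J U tv hy].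
  by case: ifP.
rewrite /= tb [b == _]eq_sym vb tg /= a2 /=; apply/orP; left; apply/andP; split.
  rewrite -(eqP (al 0 _)); last by lia.
  by apply: yl2 => // l i ls oi io e; rewrite (hy l i) ?ifT //; lia.
rewrite -(eqP (al 1 _)); last by lia.
by apply: yr2 => // l i ls oi io e; rewrite (hy l i) ?ifF //; lia.
Qed.

Fixpoint inputs_below (j g : nat) : seq nat :=
  if j is j'.+1 then
    if tag g == 0 then [:: g]
    else flatten [seq inputs_below j' (pr g l) | l <- iota 0 (ar g)]
  else [::].

Lemma inputs_below_size j g : small j g -> size (inputs_below j g) <= 2 ^ j.
Proof.
elim: j g => //= j IH g /andP[a2 /all_iotaP h]; case: eqP => _ //=; first by rewrite expn_gt0.
have h' l : l < ar g -> size (inputs_below j (pr g l)) <= 2 ^ j by move/h/IH.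
rewrite expnS; case: (ar g) a2 h' => [|[|[|]]] //= _ h'; rewrite ?cats0 ?size_cat.
- by have := h' 0 isT; lia.
- by have := h' 0 isT; have := h' 1 isT; lia.
Qed.

Lemma inputs_below_input j g i : g < G -> i \in inputs_below j g -> i < G /\ tag i = 0.
Proof.
elim: j g => //= j IH g gG; case: eqP => [tg|_]; first by rewrite inE => /eqP ->.
case/flattenP=> t /mapP[l]; rewrite mem_iota => /andP[_ la] -> ; apply: IH.
case: (spec gG) => [_ a0 _|_ a1 lt _|b _ _ _ lt _].
- by move: la; rewrite a0.
- by move: la; rewrite a1; case: l => // _; apply: ltn_trans gG.
- by apply: ltn_trans gG; apply: lt.
Qed.

Definition located (J U : nat -> nat) (i : nat) : Prop :=
  if a i then known_true k s J U i else known_false k s J U i.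

(** At a located input only the true value remains possible, and this propagates upwards through all
    gates. *)
Lemma poss_sound J U j : forall g v, g < G -> deep j g ->
  (forall i, i \in inputs_below j g -> located J U i) ->
  poss k s J U j g v -> val g = v.
Proof.
elim: j => //= j IH g v gG /all_iotaP dg loc.
case: (spec gG) => [tg _ vg|tg ag lt vg|b tg a1 aG lt vg].
- rewrite tg /= ?orbF vg; move: (loc g); rewrite tg eqxx inE eqxx => /(_ isT).
  rewrite /located /input_poss; case: (a g) => ->; case: v; rewrite //= orbF.
- have pG : pr g 0 < G by apply: ltn_trans gG.
  rewrite tg /= ?orbF vg => h; rewrite (IH (pr g 0) (~~ v)) ?negbK //.
    by apply: dg; rewrite ag.
  by move=> i hi; apply: loc; rewrite tg /= ag /= cats0.
have tb : (tag g == 3) = b by rewrite tg; case: b {tg vg}.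
have step l w : l < ar g -> poss k s J U j (pr g l) w -> val (pr g l) = w.
  move=> la; apply: IH; first by apply: ltn_trans gG; apply: lt.
    exact: dg.
  move=> i hi; apply: loc; rewrite tg /=; apply/flattenP.
  exists (inputs_below j (pr g l)) => //; apply/mapP; exists l => //.
  by rewrite mem_iota.
rewrite tb tg /=; case: (eqVneq b v) => [e|ne] /=; rewrite ?orbF.
  case/has_iotaP=> l la /(step _ _ la) h; apply/eqP; rewrite -e vg; apply/has_iotaP.
  by exists l => //; rewrite h e.
move=> /all_iotaP h; have /negPf : ~~ (val g == b).
  rewrite vg; apply/negP => /has_iotaP[l la].
  by rewrite (step _ _ la (h l la)) eq_sym (negbTE ne).
by case: (val g) b v ne {vg tg tb h} => [] [] [].
Qed.

End Fixed.
End Semantics.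
End Checks.

Lemma increasing_upto (z : nat -> nat) n : (forall i, i < n -> z i < z i.+1) ->
  forall i j, i < j -> j <= n -> z i < z j.
Proof.
move=> h i; elim=> // j IH; rewrite ltnS leq_eqVlt => /orP[/eqP -> lt|lt le].
  exact: h.
by apply: ltn_trans (h _ le); apply: IH => //; apply: ltnW.
Qed.

Lemma small_weft1 ar pr j g : small ar pr j g -> weft1 ar pr j g.
Proof.
elim: j g => //= j IH g /andP[-> /all_iotaP h] /=; apply/orP; left.
by apply/all_iotaP => l /h /IH.
Qed.

Lemma weft1_pred ar pr j g l : weft1 ar pr j.+1 g -> l < ar g -> weft1 ar pr j (pr g l).
Proof.
by case/orP=> /andP[_ /all_iotaP h] /h // /small_weft1.
Qed.

(** * Weighted satisfiability as a local constraint problem *)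

Section CircuitCSP.
Variables (tag ar : nat -> nat) (pr : nat -> nat -> nat) (G k D : nat).
Variable vals : (nat -> bool) -> nat -> bool.
Hypothesis G0 : 0 < G.
Hypothesis spec : forall a g, g < G -> gate_spec tag ar pr G a (vals a) g.
Hypothesis deepH : deep ar pr D G.-1.
Hypothesis weftH : weft1 ar pr D G.-1.

(** Room for [2 ^ D] positions of the game and for two list elements around each of up to [2 ^ D]
    inputs. *)
Definition csp_slots : nat := 3 * 2 ^ D.
Definition csp_vars : nat := k.+2 + 2 ^ D.
Definition csp_rel (J U : nat) : bool :=
  view_ok tag ar pr G k csp_slots (dg csp_vars J) (dg G.+2 U) D.

Let s := csp_slots.
Let K := csp_vars.
Let m := 2 ^ D.

Section Sound.
Variable z : nat -> nat.
Hypothesis view : forall js, size js <= s -> all (gtn K) js -> exists J U : nat -> nat,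
  [/\ forall l, l < s -> J l = nth 0 js l, forall l, l < s -> U l = z (J l)
    & view_ok tag ar pr G k s J U D].

Lemma s_gt2 : 2 < s.
Proof. by rewrite /s /csp_slots; have : 0 < 2 ^ D; [rewrite expn_gt0|lia]. Qed.

Lemma step_facts i : i <= k -> [/\ z i < z i.+1, i = 0 -> z i = 0,
  i = k -> z i.+1 = G.+1 & 0 < i -> [&& 0 < z i, z i <= G & tag (z i).-1 == 0]].
Proof.
move=> ik; have s2 := s_gt2.
have [||J [U [hJ hU /and3P[/all_iotaP h1 /all_iotaP h2 _]]]] := view (js := [:: i; i.+1]).
- by apply: ltnW.
- by rewrite /= /K /csp_vars; lia.
have [s0 s1] : 0 < s /\ 1 < s by lia.
have e0 := hJ 0 s0; have e1 := hJ 1 s1; rewrite /= in e0 e1.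
have /all_iotaP/(_ 1 s1) := h2 0 s0; rewrite /order_ok.
have := h1 0 s0; have := h1 1 s1; rewrite /slot_ok !hU // !e0 !e1.
case/and3P=> _ h3 _ /and3P[h4 _ h5] h6; split.
- by case/or3P: h6 => //; [rewrite eqxx|lia].
- by move=> i0; move: h4; rewrite i0 /= => /eqP.
- by move=> ek; move: h3; rewrite ek eqxx /= => /eqP.
- by move=> i0; move: h5; rewrite eqn0Ngt i0 ltnNge ik.
Qed.

Lemma z_mono i j : i < j -> j <= k.+1 -> z i < z j.
Proof. by apply: increasing_upto => i' lt; have [] := step_facts (i := i'). Qed.

Definition csp_assignment (g : nat) : bool := has (fun i => z i.+1 == g.+1) (iota 0 k).
Let a := csp_assignment.

Lemma z_last : z k.+1 = G.+1. Proof. by have [_ _ h _] := step_facts (leqnn k); apply: h. Qed.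
Lemma z_first : z 0 = 0. Proof. by have [_ h _ _] := step_facts (leq0n k); apply: h. Qed.

Lemma located_by g : g < G -> exists2 i, i <= k & forall J U : nat -> nat,
  (forall l, l < s -> U l = z (J l)) ->
  (exists2 l, l < s & J l = i) -> (exists2 l, l < s & J l = i.+1) ->
  located a k s J U g.
Proof.
move=> gG.
have [i [ik z1 z2]] : exists i, [/\ i <= k, z i <= g.+1 & g.+1 < z i.+1].
  have : exists i, (i <= k) && (g.+1 < z i.+1).
    by exists k; rewrite leqnn z_last.
  move/ex_minnP=> [i /andP[ik zi] min]; exists i; split=> //.
  case: i ik zi min => [|i] ik zi min; first by rewrite z_first.
  by rewrite leqNgt; apply/negP => h; have := min i; rewrite h; lia.
exists i => // J U hU [l ls Jl] [l' ls' Jl']; rewrite /located.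
case: (eqVneq (z i) g.+1) => e.
  have i0 : 0 < i by case: i e {ik z1 z2 Jl Jl'} => //; rewrite z_first.
  have -> : a g by apply/has_iotaP; exists i.-1; rewrite ?prednK // e.
  by apply/has_iotaP; exists l => //; rewrite hU // Jl i0 ik e eqxx.
have -> : a g = false.
  apply/has_iotaP => -[j jk /eqP ej].
  case: (ltngtP j.+1 i) => lt.
  - by have := z_mono lt; lia.
  - case: (ltngtP j.+1 i.+1) => lt'; try lia.
      by have := z_mono lt'; lia.
    by move: z2; rewrite -lt' ej; lia.
  - by move: e; rewrite -lt ej eqxx.
apply/has_iotaP; exists l => //; apply/has_iotaP; exists l' => //.
by rewrite !hU // Jl Jl' eqxx /= ltnS ik z2 andbT; lia.
Qed.

(** A view consistent with [z] that shows the whole game and, in addition, the variables in [js]. *)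
Let good (js : seq nat) (J U : nat -> nat) : Prop :=
  [/\ forall l, l < s -> U l = z (J l),
      forall i, i < m -> exists2 l, l < s & J l = k.+2 + i
    & forall i, i \in js -> exists2 l, l < s & J l = i].

Lemma locating (L : seq nat) : all (gtn G) L -> exists js, [/\ size js = 2 * size L,
  all (gtn k.+2) js & forall J U, good js J U -> forall g, g \in L -> located a k s J U g].
Proof.
elim: L => [|g L IH]; first by exists [::]; split.
case/andP=> gG /IH [js [h1 h2 h3]]; have [i ik hi] := located_by gG.
exists [:: i, i.+1 & js]; split; first by rewrite /= h1; lia.
  by rewrite /= h2 !ltnS ik leqW.
move=> J U [g1 g2 g3] g'; rewrite inE => /orP[/eqP ->|]; last first.
  by apply: h3; split=> // x xj; apply: g3; rewrite !inE xj !orbT.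
by apply: hi => //; apply: g3; rewrite !inE eqxx ?orbT.
Qed.

(** The claim is assumed to be accepted by some good view for every short list [js]. Good views show
    all positions, so they agree on the chosen children and the assumption passes down with [js]
    still free. It is spent at an input or a large universal gate, where [js] is taken to locate all
    inputs involved. *)
Lemma chk_sound j : forall g v o, g < G -> deep ar pr j g -> weft1 ar pr j g -> j <= D ->
  o + 2 ^ j <= m ->
  (forall js, size js <= 2 * m -> all (gtn k.+2) js ->
     exists J U, good js J U /\ chk tag ar pr k s J U j g v o) ->
  vals a g = v.
Proof.
elim: j => //= j IH g v o gG /all_iotaP dg w jD om hv.
have e2 : 0 < 2 ^ j by rewrite expn_gt0.
have e2S : 2 ^ j.+1 = 2 ^ j + 2 ^ j by rewrite expnS; lia.
have e2D : 2 ^ j <= m by rewrite leq_exp2l //; lia.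
have js0 : size (Nil nat) <= 2 * m by [].
case: (spec a gG) => [tg _ vg|tg ag lt vg|b tg a1 aG lt vg].
- have [|js [h1 h2 h3]] := locating (L := [:: g]); first by rewrite /= gG.
  have [||J [U [gd]]] := hv js => //; first by rewrite h1 /=; lia.
  rewrite tg /= ?orbF vg /input_poss; move: (h3 _ _ gd g (mem_head _ _)).
  by rewrite /located; case: (a g) => ->; case: v {hv}; rewrite //= orbF.
- have pG : pr g 0 < G by apply: ltn_trans gG.
  rewrite vg (IH (pr g 0) (~~ v) o.+1) ?negbK //.
  + by apply: dg; rewrite ag.
  + by move: w; rewrite ag /= orbF => /andP[].
  + by apply: ltnW.
  + by lia.
  move=> js j1 j2; have [J [U [gd c]]] := hv js j1 j2; exists J, U; split=> //.
  by move: c; rewrite tg /= ?orbF.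
have tb : (tag g == 3) = b by rewrite tg; case: b {tg vg}.
have ltG l : l < ar g -> pr g l < G by move=> la; apply: ltn_trans gG; apply: lt.
case: (eqVneq b v) => bv.
  set c := z (k.+2 + o).
  have yo js J U : good js J U -> chk tag ar pr k s J U j.+1 g v o ->
      c < ar g /\ chk tag ar pr k s J U j (pr g c) v o.+1.
    move=> [g1 g2 _]; rewrite /= tb bv eqxx tg /= ?orbF => /all_iotaP h.
    have [|l ls Jl] := g2 o; first by lia.
    have := h l ls; rewrite Jl eqxx /= g1 // Jl => /andP[]; by [].
  have [J [U [gd /(yo _ _ _ gd) [ca _]]]] := hv [::] js0 isT.
  apply/eqP; rewrite -bv vg; apply/has_iotaP; exists c => //; apply/eqP.
  apply: (IH (pr g c) b o.+1) => //.
  + exact: ltG.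
  + exact: dg.
  + exact: weft1_pred w _.
  + by apply: ltnW.
  + by lia.
  move=> js j1 j2; have [J' [U' [gd' /(yo _ _ _ gd') [_ c']]]] := hv js j1 j2.
  by exists J', U'; rewrite bv.
(* Universal claim: if it failed, some child [l] would have the value [b], but the claim about that
   child gives [v]. *)
have vnb x : x <> b -> x = v by move: bv; case: x b v {vg tg tb hv} => [] [] [].
apply: vnb => /eqP; rewrite vg => /has_iotaP[l la /eqP vl].
suff : vals a (pr g l) = v by move=> e; move: bv; rewrite -vl e eqxx.
case: (leqP (ar g) 2) => a2.
  have l2 : l < 2 by apply: leq_trans la a2.
  apply: (IH _ v (if l == 0 then o.+1 else o + 2 ^ j)) => //.
  + exact: ltG.
  + exact: dg.
  + exact: weft1_pred w _.
  + by apply: ltnW.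
  + by case: eqP; lia.
  move=> js j1 j2; have [J [U [gd]]] := hv js j1 j2.
  rewrite tb (negbTE bv) tg /= a2 ltnNge a2 /= orbF => /andP[c0 c1].
  by exists J, U; split=> //; case: l la vl l2 => [|[|]].
have sm : small ar pr j (pr g l).
  by move: w; rewrite leqNgt a2 /= => /all_iotaP; apply.
(* Below a large gate the circuit has only small ones, so at most [2 ^ j] inputs have to be
   located. *)
have [|js [h1 h2 h3]] := locating (L := inputs_below tag ar pr j (pr g l)).
  apply/allP => i hi; have [] := @inputs_below_input tag ar pr G a (vals a) (spec a) j (pr g l) i => //.
  exact: ltG.
have [||J [U [gd]]] := hv js => //.
  by rewrite h1; have := inputs_below_size tag sm; lia.
rewrite tb (negbTE bv) tg /= leqNgt a2 /= => /all_iotaP h.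
apply: (@poss_sound tag ar pr G a (vals a) k s (spec a) J U j) => //.
+ exact: ltG.
+ exact: dg.
+ by move=> i; apply: h3.
+ exact: h.
Qed.

Lemma csp_assignment_sound :
  count (fun i => (tag i == 0) && a i) (iota 0 G) = k /\ vals a G.-1.
Proof.
split.
- set p := fun i => _; rewrite -size_filter.
  transitivity (size [seq (z i.+1).-1 | i <- iota 0 k]); last by rewrite size_map size_iota.
  have f1 i : i < k -> [&& 0 < z i.+1, z i.+1 <= G & tag (z i.+1).-1 == 0].
    by move=> ik; have [_ _ _ h] := step_facts ik; apply: h.
  apply: perm_size; apply: uniq_perm; first by rewrite filter_uniq ?iota_uniq.
    rewrite map_inj_in_uniq ?iota_uniq // => i j; rewrite !mem_iota /= => ik jk e.
    have := f1 i ik; have := f1 j jk => /and3P[p1 _ _] /and3P[p2 _ _].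
    have {}e : z i.+1 = z j.+1 by lia.
    case: (ltngtP i j) => // lt.
      by have := @z_mono i.+1 j.+1; rewrite e; lia.
    by have := @z_mono j.+1 i.+1; rewrite e; lia.
  move=> g; rewrite mem_filter mem_iota /= /p.
  apply/idP/mapP => [/andP[/andP[tg /has_iotaP[i ik /eqP e]] gG]|[i]].
    by exists i; rewrite ?mem_iota // e.
  rewrite mem_iota /= => ik ->; have /and3P[p1 p2 p3] := f1 i ik.
  rewrite p3 /=; apply/andP; split; last by lia.
  by apply/has_iotaP; exists i => //; rewrite prednK.
- apply: (@chk_sound D G.-1 true 0) => //; first by lia.
  move=> js j1 j2.
  (* All [m] positions of the game, followed by at most [2 * m] list variables, fit into the [s]
     slots. *)
  have [||J [U [hJ hU /and3P[_ _ c]]]] := view (js := iota k.+2 m ++ js).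
  + by rewrite size_cat size_iota /s /csp_slots -/m; lia.
  + rewrite all_cat; apply/andP; split; apply/allP => i.
      by rewrite mem_iota /= /K /csp_vars -/m => /andP[].
    by move/(allP j2) => /=; rewrite /K /csp_vars; lia.
  exists J, U; split=> //; split=> //.
    move=> i im; have ls : i < s by rewrite /s /csp_slots -/m; lia.
    by exists i => //; rewrite hJ // nth_cat size_iota im nth_iota.
  move=> i ij; have lt : index i js < size js by rewrite index_mem.
  exists (m + index i js); first by rewrite /s /csp_slots -/m; lia.
  rewrite hJ; last by rewrite /s /csp_slots -/m; lia.
  by rewrite nth_cat size_iota ltnNge leq_addr /= addKn nth_index.
Qed.

End Sound.

Section Complete.
Variable a : nat -> bool.
Let p i := (tag i == 0) && a i.
Hypothesis wa : count p (iota 0 G) = k.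
Hypothesis va : vals a G.-1.

Let f := [seq i <- iota 0 G | p i].

Lemma csp_complete : local_csp K G.+2 s csp_rel.
Proof.
have szf : size f = k by rewrite size_filter.
have fP i : i < k -> nth 0 f i < G /\ p (nth 0 f i).
  move=> ik; have : nth 0 f i \in f by rewrite mem_nth // szf.
  by rewrite mem_filter mem_iota => /and3P[].
have [|y [y1 y2]] := @chk_complete tag ar pr G a (vals a) k s (spec a) D G.-1 0.
  by lia.
pose z i := if i == 0 then 0 else if i <= k then (nth 0 f i.-1).+1
  else if i == k.+1 then G.+1 else y (i - k.+2).
have zx i : i < k -> z i.+1 = (nth 0 f i).+1 by move=> ik; rewrite /z /= ik.
have zl : z k.+1 = G.+1 by rewrite /z /= ltnn eqxx.
have srt : sorted ltn f by apply: sorted_filter; [exact: ltn_trans|exact: iota_ltn_sorted].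
have zstep i : i < k.+1 -> z i < z i.+1.
  rewrite ltnS leq_eqVlt => /orP[/eqP ->|ik].
    rewrite zl; case: (posnP k) => [->//|k0]; have k1 : k.-1 < k by lia.
    by have [lt _] := fP _ k1; rewrite -(prednK k0) zx.
  rewrite zx //; case: i ik => [|i] ik; first by [].
  rewrite zx; last by lia.
  by rewrite ltnS; apply: (sorted_ltn_nth ltn_trans 0 srt); rewrite ?inE ?szf //; lia.
have mono := increasing_upto zstep.
have zN i : z i < G.+2.
  case: i => [|i]; first by [].
  case: (ltnP i k) => ik; first by rewrite zx //; have [lt _] := fP i ik; lia.
  by rewrite /z /= [i < k]ltnNge ik /=; case: eqP => // _; have := y1 (i.+1 - k.+2); lia.
exists z; split.
  by move=> i _; apply: zN.
move=> J JK.
have [|U hU dU] := @dg_exists G.+2 s (fun l => z (dg K J l)).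
  by move=> i _; apply: zN.
exists U => //; split=> //; rewrite /csp_rel -/s -/K.
(* The list contains every true input, so a gap between consecutive elements contains none. This is
   what makes [known_false] truthful. *)
have between i g : i <= k -> z i < g.+1 -> g.+1 < z i.+1 -> g \notin f.
  move=> ik l1 l2; apply/negP => gf.
  have gi : index g f < k by rewrite -szf index_mem.
  have e : z (index g f).+1 = g.+1 by rewrite zx // nth_index.
  case: (ltngtP (index g f).+1 i) => lt.
  - by have := mono _ _ lt; lia.
  - case: (ltngtP (index g f).+1 i.+1) => lt'; try lia.
      by have := mono _ _ lt'; lia.
    by move: l2; rewrite -lt' e; lia.
  - by move: l1; rewrite -lt e; lia.
have tv : truthful tag G a k s (dg K J) (dg G.+2 U).
  move=> g gG tg; split.
    case/has_iotaP=> l ls /and3P[]; rewrite dU //; case: (dg K J l) => // i _ ik.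
    rewrite zx // eqSS => /eqP <-; by have [_ /andP[]] := fP i ik.
  case/has_iotaP=> l ls /has_iotaP[l' ls'] /and4P[/eqP e]; rewrite !dU // e => ik l1 l2.
  have := between _ _ ik l1 l2; by rewrite mem_filter mem_iota /= add0n gG andbT /p tg.
apply/and3P; split.
- apply/all_iotaP => l ls; rewrite /slot_ok dU //; apply/and3P; split.
  + by rewrite /z; case: eqP.
  + by case: eqP => // ->; rewrite zl eqxx.
  case: (dg K J l) => // i /=; case: leqP => //= ik; rewrite zx //=.
  by have [-> /andP[->]] := fP i ik.
- apply/all_iotaP => l ls; apply/all_iotaP => l' ls'; rewrite /order_ok !dU //.
  by case: eqP => //= ->; case: leqP => //= h; apply: zstep.
- rewrite -va; apply: y2 => // l i ls _ im e.
  by rewrite dU // e /z !ifF ?addKn //; lia.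
Qed.

End Complete.

Theorem circuit_csp :
  (exists a, count (fun i => (tag i == 0) && a i) (iota 0 G) = k /\ vals a G.-1) <->
  local_csp K G.+2 s csp_rel.
Proof.
split=> [[a [h1 h2]]|[z [h1 h2]]]; first exact: csp_complete h1 h2.
exists (csp_assignment z); apply: csp_assignment_sound => js szj alj.
(* Short lists are padded with the variable 0. *)
have [|J JK dJ] := @dg_exists K s (nth 0 js).
  move=> l _; case: (ltnP l (size js)) => h; first by apply: (allP alj); rewrite mem_nth.
  by rewrite nth_default // /K /csp_vars; lia.
have [U hU [dU hA]] := h2 J JK.
by exists (dg K J), (dg G.+2 U); split.
Qed.

End CircuitCSP.

(** * Encoded circuits *)

Definition wlen (x : word) (p : nat) : nat :=
  if nth 0 x p == 0 then 1 else if nth 0 x p == 1 then 2 else 2 + nth 0 x p.+1.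
(* Clipping at [size x] keeps the running time polynomial on words that encode
   no circuit; so do the minima in [war], [wG] and [wk]. *)
Definition wpos (x : word) (i : nat) : nat :=
  iteri (minn i (size x)) (fun _ p => p + wlen x p) 2.

Lemma wposS x i : i < size x -> wpos x i.+1 = wpos x i + wlen x (wpos x i).
Proof. by move=> lt; rewrite /wpos (minn_idPl lt) (minn_idPl (ltnW lt)). Qed.

Definition wtag (x : word) (i : nat) : nat := nth 0 x (wpos x i).
Definition war (x : word) (i : nat) : nat :=
  if wtag x i == 0 then 0 else if wtag x i == 1 then 1
  else minn (nth 0 x (wpos x i).+1) (size x).
Definition wpr (x : word) (i l : nat) : nat :=
  if wtag x i == 1 then nth 0 x (wpos x i).+1 else nth 0 x ((wpos x i).+2 + l).
Definition wG (x : word) : nat := minn (nth 0 x 1) (size x).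
Definition wk (x : word) : nat := minn (nth 0 x 0) (size x).

Definition gate_ok (x : word) (i : nat) : bool :=
  [&& wtag x i < 4, all (fun l => wpr x i l < i) (iota 0 (war x i))
    & (wtag x i <= 1) ||
      [&& 1 < war x i, nth 0 x (wpos x i).+1 <= size x
        & all (fun l => all (fun l' => (l == l') || (wpr x i l != wpr x i l'))
            (iota 0 (war x i))) (iota 0 (war x i))]].

(** No assignment has a weight above the number of gates, so words with a larger [k] are rejected at
    once; on the others the clipping in [wk] changes nothing. The depth argument is [d.+1] because
    [deep j] means depth below [j]. *)
Definition valid (d : nat) (x : word) : bool :=
  [&& 0 < nth 0 x 1, nth 0 x 1 <= size x, nth 0 x 0 <= nth 0 x 1,
      wpos x (wG x) == size x,
      all (gate_ok x) (iota 0 (wG x)),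
      deep (war x) (wpr x) d.+1 (wG x).-1 & weft1 (war x) (wpr x) d.+1 (wG x).-1].

(** * Circuits accessed by the positions of their gates *)

Section GateValues.
Variables (T : Type) (F : seq T -> gate -> T) (x0 : T).

Lemma gate_values_rcons C g :
  gate_values F (rcons C g) = rcons (gate_values F C) (F (gate_values F C) g).
Proof. by rewrite /gate_values foldl_rcons. Qed.

Lemma size_gate_values C : size (gate_values F C) = size C.
Proof. by elim/last_ind: C => // C g IH; rewrite gate_values_rcons !size_rcons IH. Qed.

Lemma nth_gate_values C i : i < size C ->
  nth x0 (gate_values F C) i = F (take i (gate_values F C)) (nth Input C i).
Proof.
elim/last_ind: C => // C g IH; rewrite gate_values_rcons size_rcons ltnS leq_eqVlt.
rewrite !nth_rcons size_gate_values => /orP[/eqP -> |lt].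
  by rewrite ltnn eqxx -cats1 take_size_cat ?size_gate_values.
by rewrite lt IH // -cats1 takel_cat // size_gate_values ltnW.
Qed.

End GateValues.

Definition gate_tag (g : gate) : nat :=
  match g with Input => 0 | Neg _ => 1 | And _ => 2 | Or _ => 3 end.

(** The interface between a circuit and its encoding. [pr] is constrained only below the arity,
    because reading further in the word yields unrelated letters. *)
Definition accesses (tag ar : nat -> nat) (pr : nat -> nat -> nat) (C : circuit) : Prop :=
  forall i, i < size C -> let g := nth Input C i in
    [/\ tag i = gate_tag g, ar i = size (preds g)
      & forall l, l < ar i -> pr i l = nth 0 (preds g) l].

Section Access.
Variables (tag ar : nat -> nat) (pr : nat -> nat -> nat) (C : circuit).
Hypothesis acc : accesses tag ar pr C.
Hypothesis wf : wf_circuit C.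

Lemma wf_preds i j : i < size C -> j \in preds (nth Input C i) -> j < i.
Proof.
move=> iC jp; case/and3P: wf => _ _ /allP/(_ i); rewrite mem_iota => /(_ iC)/allP; exact.
Qed.

Lemma all_preds (P : pred nat) i : i < size C ->
  all (fun l => P (pr i l)) (iota 0 (ar i)) = all P (preds (nth Input C i)).
Proof.
move=> iC; have [_ e1 e2] := acc iC; rewrite e1 -{2}(mkseq_nth 0 (preds _)) all_map.
by apply: eq_in_all => l; rewrite mem_iota /= => lt; rewrite e2 // e1.
Qed.

Lemma has_preds (P : pred nat) i : i < size C ->
  has (fun l => P (pr i l)) (iota 0 (ar i)) = has P (preds (nth Input C i)).
Proof.
move=> iC; have [_ e1 e2] := acc iC; rewrite e1 -{2}(mkseq_nth 0 (preds _)) has_map.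
by apply: eq_in_has => l; rewrite mem_iota /= => lt; rewrite e2 // e1.
Qed.

Lemma circuit_size_gt0 : 0 < size C. Proof. by case/and3P: wf. Qed.

Let boolF (a : nat -> bool) (vs : seq bool) (g : gate) : bool :=
  match g with
  | Input => a (size vs)
  | Neg i => ~~ nth false vs i
  | And s => all (nth false vs) s
  | Or s => has (nth false vs) s
  end.

Definition circuit_vals (a : nat -> bool) (i : nat) : bool :=
  nth false (gate_values (boolF a) C) i.

Lemma circuit_vals_last a : circuit_vals a (size C).-1 = circuit_eval a C.
Proof. by rewrite /circuit_vals -(size_gate_values (boolF a)) nth_last. Qed.

Lemma circuit_gate_spec a g : g < size C ->
  gate_spec tag ar pr (size C) a (circuit_vals a) g.
Proof.
move=> gC; have [e0 e1 e2] := acc gC; have hp P := @has_preds P g gC.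
have E : circuit_vals a g = boolF a (take g (gate_values (boolF a) C)) (nth Input C g).
  exact: nth_gate_values.
have tk j : j \in preds (nth Input C g) ->
    nth false (take g (gate_values (boolF a) C)) j = circuit_vals a j.
  by move=> /(wf_preds gC) jg; rewrite nth_take.
have lt l : l < ar g -> pr g l < g.
  by move=> la; rewrite e2 //; apply: (wf_preds gC); rewrite mem_nth // -e1.
have wg : wf_gate (nth Input C g).
  by case/and3P: wf => _ /(all_nthP Input) h _; apply: h.
(* Distinct predecessors are positions of the circuit, which bounds the arity by its size. *)
have szle : uniq (preds (nth Input C g)) -> size (preds (nth Input C g)) <= size C.
  move=> un; rewrite -[leqRHS](size_iota 0); apply: uniq_leq_size => // j jp.
  by rewrite mem_iota /=; exact: ltn_trans (wf_preds gC jp) gC.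
case: (nth Input C g) e0 e1 e2 hp E tk wg szle => [|i|t|t] /= e0 e1 e2 hp E tk wg szle.
- apply: SpecInput => //; rewrite E size_take size_gate_values gC //.
- apply: SpecNeg => //; first by apply: lt; rewrite e1.
  by rewrite E e2 ?e1 //= tk // mem_head.
- case/andP: wg => s1 un; apply: (@SpecGate _ _ _ _ _ _ _ false) => //; rewrite ?e1 ?szle //.
  rewrite -e1 (hp (fun j => circuit_vals a j == false)) eqbF_neg E -has_predC.
  by apply: eq_in_has => j jt /=; rewrite tk // eqbF_neg.
- case/andP: wg => s1 un; apply: (@SpecGate _ _ _ _ _ _ _ true) => //; rewrite ?e1 ?szle //.
  rewrite -e1 (hp (fun j => circuit_vals a j == true)) eqb_id E.
  by apply: eq_in_has => j jt /=; rewrite tk // eqb_id.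
Qed.

Let depF (vs : seq nat) (g : gate) : nat :=
  if is_input g then 0 else (\max_(i <- preds g) nth 0 vs i).+1.
Let weftF (vs : seq nat) (g : gate) : nat :=
  (2 < size (preds g)) + \max_(i <- preds g) nth 0 vs i.
Let dep i := nth 0 (gate_values depF C) i.
Let wft i := nth 0 (gate_values weftF C) i.

Lemma bigmax_take (vs : seq nat) i : i < size C ->
  \max_(j <- preds (nth Input C i)) nth 0 (take i vs) j =
  \max_(j <- preds (nth Input C i)) nth 0 vs j.
Proof.
by move=> iC; apply: eq_big_seq => j /(wf_preds iC) ji; rewrite nth_take.
Qed.

Lemma preds_nil i : i < size C -> is_input (nth Input C i) = nilp (preds (nth Input C i)).
Proof.
move=> iC; have : wf_gate (nth Input C i).
  by case/and3P: wf => _ /(all_nthP Input) h _; apply: h.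
by case: (nth Input C i) => [|j|t|t] //= /andP[]; case: t.
Qed.

Lemma bigmax_leq_all (P : seq nat) (f : nat -> nat) n :
  (\max_(j <- P) f j <= n) = all (fun j => f j <= n) P.
Proof.
by apply/bigmax_leqP_seq/allP => [h j jp|h j jp _]; [apply: h|apply: h].
Qed.

(** [deep] stops at gates without predecessors, whereas the depth is reset at inputs; in a
    well-formed circuit these are the same gates. *)
Lemma deepE j i : i < size C -> deep ar pr j i = (dep i < j).
Proof.
elim: j i => // j IH i iC; rewrite /= (all_preds (deep ar pr j)) // /dep nth_gate_values //.
rewrite /depF preds_nil // bigmax_take //.
rewrite (eq_in_all (a2 := fun g => dep g < j)); last first.
  by move=> g /(wf_preds iC) gi; apply: IH; apply: ltn_trans iC.
case: (preds _) => [|g t] //; rewrite [LHS]/= ltnS; case: j {IH} => // j.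
by rewrite [RHS]ltnS (bigmax_leq_all (g :: t)).
Qed.

(** As the depth is below [j], the recursion reaches every gate underneath and the check is exact;
    likewise for [weft1E]. *)
Lemma smallE j i : i < size C -> dep i < j -> small ar pr j i = (wft i == 0).
Proof.
elim: j i => // j IH i iC dj; have [_ e1 _] := acc iC.
have dl g : g \in preds (nth Input C i) -> dep g < j.
  by move=> gp; move: dj; rewrite -deepE //= (all_preds (deep ar pr j)) // => /allP/(_ g gp);
     rewrite deepE //; exact: ltn_trans (wf_preds iC gp) iC.
rewrite /= (all_preds (small ar pr j)) // /wft nth_gate_values // /weftF bigmax_take // e1.
rewrite addn_eq0 eqb0 -leqNgt -leqn0 bigmax_leq_all; congr (_ && _).
apply: eq_in_all => g gp; rewrite leqn0; apply: IH; last exact: dl.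
by exact: ltn_trans (wf_preds iC gp) iC.
Qed.

Lemma weft1E j i : i < size C -> dep i < j -> weft1 ar pr j i = (wft i <= 1).
Proof.
elim: j i => // j IH i iC dj; have [_ e1 _] := acc iC.
have dl g : g \in preds (nth Input C i) -> dep g < j.
  by move=> gp; move: dj; rewrite -deepE //= (all_preds (deep ar pr j)) // => /allP/(_ g gp);
     rewrite deepE //; exact: ltn_trans (wf_preds iC gp) iC.
have gC g : g \in preds (nth Input C i) -> g < size C.
  by move=> gp; exact: ltn_trans (wf_preds iC gp) iC.
rewrite /= (all_preds (small ar pr j)) // (all_preds (weft1 ar pr j)) //.
rewrite /wft nth_gate_values // /weftF bigmax_take // e1.
case: leqP => _ /=; rewrite ?orbF ?add0n ?bigmax_leq_all.
  by apply: eq_in_all => g gp; apply: IH; [apply: gC|apply: dl].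
rewrite add1n ltnS bigmax_leq_all.
by apply: eq_in_all => g gp; rewrite leqn0; apply: smallE; [apply: gC|apply: dl].
Qed.

Lemma circuit_checks d : (circuit_weft C <= 1) && (circuit_depth C <= d) =
  deep ar pr d.+1 (size C).-1 && weft1 ar pr d.+1 (size C).-1.
Proof.
have lt : (size C).-1 < size C by have := circuit_size_gt0; lia.
rewrite deepE // /circuit_weft /circuit_depth -!(nth_last 0) !size_gate_values andbC ltnS.
by case: leqP => // le; rewrite !andTb (@weft1E d.+1).
Qed.

Lemma circuit_weight a : weight a C = count (fun i => (tag i == 0) && a i) (iota 0 (size C)).
Proof.
apply: eq_in_count => i; rewrite mem_iota /= => iC; have [-> _ _] := acc iC.
by case: (nth Input C i).
Qed.

End Access.

(** * Encoding and decoding words *)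

Section Encoded.
Variables (k : nat) (C : circuit).
Let x := k :: encode_circuit C.

Lemma size_encode : size C <= size x.
Proof.
suff : size C <= size (flatten (map encode_gate C)) by rewrite /=; lia.
elim: C => //= g s IH; rewrite size_cat.
by have : 0 < size (encode_gate g); [case: g|lia].
Qed.

Lemma wpos_encode i : i <= size C ->
  wpos x i = 2 + size (flatten (map encode_gate (take i C))) /\
  drop (wpos x i) x = flatten (map encode_gate (drop i C)).
Proof.
elim: i => [|i IH] iC.
  by rewrite take0 drop0 /wpos min0n /= drop0.
have {IH} [IH1 IH2] := IH (ltnW iC).
have E : drop (wpos x i) x = encode_gate (nth Input C i) ++
    flatten (map encode_gate (drop i.+1 C)).
  by rewrite IH2 (drop_nth Input).
have L : wlen x (wpos x i) = size (encode_gate (nth Input C i)).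
  have n0 := nth_drop (wpos x i) 0 x 0; have n1 := nth_drop (wpos x i) 0 x 1.
  rewrite addn0 in n0; rewrite addn1 in n1.
  rewrite /wlen -n0 -n1 E; by case: (nth Input C i).
have -> : wpos x i.+1 = wpos x i + size (encode_gate (nth Input C i)).
  by rewrite wposS ?L //; apply: leq_trans iC size_encode.
split; last by rewrite addnC -drop_drop E drop_size_cat.
rewrite (take_nth Input) // map_rcons flatten_rcons size_cat IH1; lia.
Qed.

Lemma wnth_encode i t : i < size C ->
  nth 0 x (wpos x i + t) = nth 0 (encode_gate (nth Input C i) ++
    flatten (map encode_gate (drop i.+1 C))) t.
Proof.
move=> iC; have [_ E] := wpos_encode (ltnW iC).
by rewrite -nth_drop E (drop_nth Input).
Qed.

Lemma encode_gate_size i : i < size C ->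
  wpos x i + size (encode_gate (nth Input C i)) <= size x.
Proof.
move=> iC; have [_ E] := wpos_encode (ltnW iC).
rewrite (drop_nth Input) // in E.
have := congr1 size E; rewrite [flatten _]/= size_cat size_drop.
have : 0 < size (encode_gate (nth Input C i)) by case: (nth Input C i).
by lia.
Qed.

Lemma encode_accesses : accesses (wtag x) (war x) (wpr x) C.
Proof.
move=> i iC g.
have n0 := wnth_encode 0 iC; have n1 := wnth_encode 1 iC.
rewrite addn0 -/g in n0; rewrite addn1 -/g in n1.
have n2 l : nth 0 x ((wpos x i).+2 + l) = nth 0 (encode_gate g ++
    flatten (map encode_gate (drop i.+1 C))) l.+2.
  by rewrite -wnth_encode // !addnS addSn.
have sz := encode_gate_size iC; rewrite -/g in sz.
rewrite /war /wpr /wtag n0.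
case: g n0 n1 n2 sz => [|j|s|s] /= n0 n1 n2 sz; split=> //=.
- by case=> // _; rewrite n1.
- by rewrite n1; lia.
- move=> l; rewrite n1 => ls; rewrite n2 nth_cat ifT //; lia.
- by rewrite n1; lia.
- move=> l; rewrite n1 => ls; rewrite n2 nth_cat ifT //; lia.
Qed.

Lemma wG_encode : wG x = size C.
Proof. by apply/minn_idPl; apply: size_encode. Qed.

Lemma valid_encode d : wf_circuit C -> k <= size C ->
  valid d x = (circuit_weft C <= 1) && (circuit_depth C <= d).
Proof.
move=> wf kC; have acc := encode_accesses.
rewrite (circuit_checks acc wf) /valid wG_encode.
have C0 := circuit_size_gt0 wf; have sz := size_encode.
have [wp _] := wpos_encode (leqnn _).
have -> : nth 0 x 1 = size C by [].
have -> : nth 0 x 0 = k by [].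
rewrite C0 sz kC /= wp take_size /= eqxx /=.
suff -> : all (gate_ok x) (iota 0 (size C)) by [].
apply/all_iotaP => i iC; have [e0 e1 e2] := acc i iC.
have wg : wf_gate (nth Input C i).
  by case/and3P: wf => _ /(all_nthP Input) h _; apply: h.
apply/and3P; split.
- by rewrite e0; case: (nth Input C i).
- apply/all_iotaP => l la; rewrite e2 //; apply: (wf_preds wf iC).
  by rewrite mem_nth // -e1.
have n1 := wnth_encode 1 iC; rewrite addn1 in n1.
have eszz := encode_gate_size iC.
have un : 1 < wtag x i -> [/\ 1 < war x i, nth 0 x (wpos x i).+1 <= size x
    & uniq (preds (nth Input C i))].
  rewrite e0 e1 n1; move: wg eszz.
  by case: (nth Input C i) => [|j|s|s] //= /andP[-> ->] ? _; split=> //; lia.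
case: (leqP (wtag x i) 1) => // /un [-> -> u] /=; apply/all_iotaP => l la; apply/all_iotaP => l' la'.
by rewrite !e2 // nth_uniq -?e1 // orbN.
Qed.

End Encoded.

Definition wgate (x : word) (i : nat) : gate :=
  if wtag x i == 0 then Input else if wtag x i == 1 then Neg (wpr x i 0)
  else if wtag x i == 2 then And (mkseq (wpr x i) (war x i))
  else Or (mkseq (wpr x i) (war x i)).

Lemma valid_decode d x : valid d x ->
  exists C, [/\ x = nth 0 x 0 :: encode_circuit C, wf_circuit C & nth 0 x 0 <= size C].
Proof.
case/and4P=> h1 h2 h3 /and4P[/eqP h4 /all_iotaP h5 _ _].
have eG : wG x = nth 0 x 1 by rewrite /wG; lia.
pose C := mkseq (wgate x) (wG x).
have szC : size C = wG x by rewrite size_mkseq.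
exists C; split; last by rewrite szC eG.
- have posS i : i < wG x -> wpos x i.+1 = wpos x i + wlen x (wpos x i).
    by move=> iG; apply: wposS; lia.
  have pos_le i j : i <= j -> j <= wG x -> wpos x i <= wpos x j.
    elim: j => [|j IH]; first by rewrite leqn0 => /eqP ->.
    rewrite leq_eqVlt => /orP[/eqP -> //|]; rewrite ltnS => /IH le jG.
    by have := le (ltnW jG); rewrite posS //; lia.
  have gateE i : i < wG x -> take (wlen x (wpos x i)) (drop (wpos x i) x) = encode_gate (wgate x i).
    move=> iG; have le : wpos x i.+1 <= size x by rewrite -h4; apply: pos_le.
    rewrite posS // in le.
    have /and3P[t4 _ h] := h5 i iG.
    have szd : size (take (wlen x (wpos x i)) (drop (wpos x i) x)) = wlen x (wpos x i).
      by rewrite size_takel // size_drop; lia.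
    apply: (@eq_from_nth _ 0) => [|t]; rewrite szd.
      rewrite /wlen /wgate /wtag -/(wtag x i).
      move: h; rewrite /war; case: eqP => //= n0; case: eqP => //= n1.
      have -> : (wtag x i <= 1) = false by lia.
      case/and3P=> _ h _; case: eqP => _ /=; rewrite size_mkseq; lia.
    move=> lt; rewrite nth_take // nth_drop.
    move: lt h; rewrite /wlen /wgate -/(wtag x i).
    case: eqP => n0.
      by case: t => // _ _; rewrite addn0 -[LHS]/(wtag x i) n0.
    case: eqP => n1.
      case: t => [|[|]] // _ _; first by rewrite addn0 -[LHS]/(wtag x i) n1.
      by rewrite addn1 /wpr n1 eqxx.
    have -> : (wtag x i <= 1) = false by lia.
    move=> lt /and3P[_ h _].
    have ew : war x i = nth 0 x (wpos x i).+1.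
      by rewrite /war; case: eqP => // _; case: eqP => // _; lia.
    have -> : encode_gate (if wtag x i == 2 then And (mkseq (wpr x i) (war x i))
        else Or (mkseq (wpr x i) (war x i))) =
        [:: wtag x i, war x i & mkseq (wpr x i) (war x i)].
      case: eqP => [-> |n2] /=; first by rewrite size_mkseq.
      by rewrite size_mkseq; congr (_ :: _); lia.
    case: t lt => [|[|t]] lt /=; rewrite ?addn0 ?addn1 //.
    rewrite nth_mkseq; last by lia.
    by rewrite /wpr; case: eqP => // _; rewrite !addnS addSn.
  (* The word is rebuilt gate by gate; at the last gate the prefix is all of [x], since [valid]
     excludes trailing letters. *)
  have pre i : i <= wG x -> take (wpos x i) x =
      [:: nth 0 x 0, nth 0 x 1 & flatten (map encode_gate (take i C))].
    elim: i => [|i IH] iG.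
      by rewrite take0 /wpos min0n /=; case: (x) h1 => [|a' [|b s]] //= _; rewrite take0.
    rewrite posS // takeD IH; last exact: ltnW.
    rewrite gateE // (take_nth Input) ?szC // map_rcons flatten_rcons nth_mkseq //.
  rewrite /encode_circuit szC eG -[LHS]take_size -h4 pre // -szC take_size //.
- apply/and3P; split; first by rewrite szC eG.
  + apply/(all_nthP Input) => i; rewrite szC => iG; rewrite nth_mkseq //.
    have /and3P[t4 _] := h5 i iG; rewrite /wgate.
    case: eqP => // n0; case: eqP => // n1 h.
    have {h} /and3P[w1 _ /all_iotaP un] : [&& 1 < war x i, nth 0 x (wpos x i).+1 <= size x
        & all (fun l => all (fun l' => (l == l') || (wpr x i l != wpr x i l'))
            (iota 0 (war x i))) (iota 0 (war x i))].
      by move: h; have -> : (wtag x i <= 1) = false by lia.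
    have u : uniq (mkseq (wpr x i) (war x i)).
      apply/(uniqP 0) => l l'; rewrite !inE size_mkseq => la la'.
      rewrite !nth_mkseq // => e; have /all_iotaP/(_ l' la') := un l la.
      by rewrite e eqxx orbF => /eqP.
    by case: eqP => _ /=; rewrite size_mkseq w1 u.
  + apply/all_iotaP => i; rewrite szC => iG; rewrite nth_mkseq //.
    have /and3P[_ /all_iotaP pl _] := h5 i iG; rewrite /wgate.
    case: eqP => // n0; case: eqP => // n1 /=.
      by rewrite pl //; rewrite /war; case: eqP => // _; rewrite n1.
    have al : all (fun j => j < i) (mkseq (wpr x i) (war x i)).
      by rewrite all_map; apply/all_iotaP => l la /=; apply: pl.
    by case: eqP.
Qed.

Definition word_csp (d : nat) (x : word) : Prop :=
  local_csp (csp_vars (wk x) d.+1) (wG x).+2 (csp_slots d.+1)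
    (csp_rel (wtag x) (war x) (wpr x) (wG x) (wk x) d.+1).

Theorem wcs_word_csp d x :
  lang (weighted_circuit_sat 1 d) x <-> valid d x /\ word_csp d x.
Proof.
have key k C : wf_circuit C -> k <= size C -> valid d (k :: encode_circuit C) ->
    (exists a, weight a C = k /\ circuit_eval a C) <-> word_csp d (k :: encode_circuit C).
  move=> wf kC vx; have acc := @encode_accesses k C.
  have := vx; case/and4P=> _ _ _ /and4P[_ _ dp wt].
  rewrite wG_encode in dp wt.
  have ek : wk (k :: encode_circuit C) = k.
    by apply/minn_idPl; apply: leq_trans kC (size_encode k C).
  rewrite /word_csp wG_encode ek.
  rewrite -(circuit_csp k (circuit_size_gt0 wf)
    (circuit_gate_spec acc wf) dp wt).
  split=> -[a [h1 h2]]; exists a; split=> //.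
  - by rewrite -(circuit_weight acc).
  - by rewrite circuit_vals_last.
  - by rewrite (circuit_weight acc).
  - by rewrite -circuit_vals_last.
split=> [[k [C [-> wf hw hd [a [wa ea]]]]]|[vx hx]].
- have kC : k <= size C.
    by rewrite -wa /weight -[leqRHS](size_iota 0) count_size.
  have vx : valid d (k :: encode_circuit C) by rewrite valid_encode // hw hd.
  by split=> //; apply/(key _ _ wf kC vx); exists a.
- have [C [e wf kC]] := valid_decode vx; rewrite e in vx hx.
  exists (nth 0 x 0), C; split=> //; last exact/(key _ _ wf kC vx).
    by move: vx; rewrite valid_encode // => /andP[].
  by move: vx; rewrite valid_encode // => /andP[].
Qed.

(** * The reduction *)

Lemma unbump_ltn n (u v : 'I_n) : u != v -> unbump v u < n.-1.
Proof.
rewrite -val_eqE /unbump /=; have := ltn_ord u; have := ltn_ord v.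
by case: (ltngtP v u) => //= lt; lia.
Qed.

(** Row [v] has [n.-1] entries, the column of [v] itself being left out; [(v <= u) + u] skips it and
    inverts [unbump v]. *)
Definition table (wt : nat -> nat -> nat) (n : nat) : seq nat :=
  mkseq (fun e => let v := e %/ n.-1 in let u := e %% n.-1 in wt ((v <= u) + u) v) (n * n.-1).

Lemma nth_table wt n (u v : 'I_n) : u != v ->
  nth 0 (table wt n) (v * n.-1 + unbump v u) = wt u v.
Proof.
move=> uv; have un := unbump_ltn uv; rewrite nth_mkseq; last first.
  have : v.+1 * n.-1 <= n * n.-1 by rewrite leq_mul2r ltn_ord orbT.
  by rewrite mulSn; lia.
rewrite divnMDl ?divn_small ?addn0 ?modnMDl ?modn_small //; last by lia.
by congr wt; have := @unbumpK v u; rewrite /bump => -> //.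
Qed.

Lemma mkseq5 T (f : nat -> T) m : mkseq f (5 + m) =
  [:: f 0; f 1; f 2; f 3; f 4] ++ mkseq (fun e => f (5 + e)) m.
Proof.
rewrite /mkseq iotaD map_cat; congr (_ ++ _).
have -> : iota (0 + 5) m = map (addn 5) (iota 0 m) by rewrite -iotaDl.
by rewrite -map_comp.
Qed.

Definition red_slots (d : nat) : nat := csp_slots d.+1.
Definition red_vars (d : nat) (x : word) : nat := csp_vars (wk x) d.+1.
Definition red_values (x : word) : nat := (wG x).+2.
Definition red_counters (d : nat) (x : word) : nat := csp_counters (red_vars d x) (red_slots d).
Definition red_cap (d : nat) (x : word) : nat := csp_cap (red_vars d x) (red_values x) (red_slots d).
Definition red_classes (d : nat) (x : word) : nat := red_vars d x + red_vars d x ^ red_slots d.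
Definition red_items (d : nat) (x : word) : nat := red_values x ^ red_slots d.
Definition red_base (d : nat) (x : word) : nat := 5 + red_classes d x + red_items d x + red_counters d x + red_cap d x.
Definition red_ok (d : nat) (x : word) (cl it : nat) : bool :=
  csp_item_ok (red_vars d x) (red_values x) (csp_rel (wtag x) (war x) (wpr x) (wG x) (wk x) d.+1) cl it.
Definition red_amount (d : nat) (x : word) (cl it ct : nat) : nat :=
  csp_amount (red_vars d x) (red_values x) (red_slots d) cl it ct.
Definition red_kind (d : nat) (x : word) (v : nat) : nat :=
  vkind (red_classes d x) (red_items d x) (red_counters d x) (red_cap d x) (red_base d x) (red_ok d x) (red_amount d x) v.
Definition red_size (d : nat) (x : word) : nat := vsize (red_base d x).
Definition red_weight (d : nat) (x : word) (u v : nat) : nat :=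
  vwt (red_classes d x) (red_items d x) (red_counters d x) (red_cap d x) (red_base d x) (red_ok d x) (red_amount d x) u v.
Definition red_goal (d : nat) (x : word) : nat :=
  vgoal (red_classes d x) (red_items d x) (red_counters d x) (red_cap d x) (red_base d x) (red_ok d x) (red_amount d x).

Definition red_length (d : nat) (x : word) : nat :=
  if valid d x then 5 + red_size d x * (red_size d x).-1 else 5.

(** A word that encodes no suitable circuit is sent to the instance without vertices and with the
    unattainable score 1. *)
Definition red_letter (d : nat) (x : word) (i : nat) : nat :=
  if valid d x then
    if i == 0 then red_size d x else if i == 2 then red_goal d x else if i == 4 then red_cap d x
    else if i < 5 then 0
    else let v := (i - 5) %/ (red_size d x).-1 in let u := (i - 5) %% (red_size d x).-1 in
      red_weight d x ((v <= u) + u) v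
  else (i == 2).

Definition reduction (d : nat) (x : word) : word := mkseq (red_letter d x) (red_length d x).

Lemma red_base_bounds d x : [/\ 5 <= red_base d x, red_classes d x <= red_base d x, red_items d x <= red_base d x,
  red_counters d x <= red_base d x & red_cap d x <= red_base d x].
Proof. by rewrite /red_base; split; lia. Qed.

Lemma reductionE d x : valid d x -> reduction d x =
  [:: red_size d x, 0, red_goal d x, 0, red_cap d x & table (red_weight d x) (red_size d x)].
Proof.
move=> vx; rewrite /reduction /red_length vx mkseq5.
rewrite -[RHS]/([:: red_size d x; 0; red_goal d x; 0; red_cap d x] ++ _); congr (_ ++ _).
  by rewrite /red_letter vx.
by apply: eq_map => e; rewrite /red_letter vx addKn.
Qed.

Lemma reduction_invalid d x : ~~ valid d x -> reduction d x = [:: 0; 0; 1; 0; 0].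
Proof.
by move=> /negbTE vx; rewrite /reduction /red_length vx (mkseq5 _ 0) /red_letter vx.
Qed.

(** * Correctness and parameter of the reduction *)

Section TableInstance.
Variables (n l q : nat) (wt : nat -> nat -> nat).

Definition table_bnsl : bnsl_instance :=
  BnslInstance (@table_scores_additive n (table wt n)) (decode_int 0 l) (decode_int 0 q).

Lemma lang_table :
  lang bnsl_treewidth [:: n, 0, l, 0, q & table wt n] = bnsl_yes table_bnsl.
Proof. by rewrite /= size_mkseq eqxx. Qed.

Lemma param_table :
  param bnsl_treewidth [:: n, 0, l, 0, q & table wt n] =
  treewidth (superstructure (@bn_f table_bnsl)).
Proof. by rewrite /= size_mkseq eqxx. Qed.

Lemma table_bnsl_yes : bnsl_yes table_bnsl <->
  exists D : rel 'I_n, [/\ acyclic D, forall v, #|parents D v| <= q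
    & l <= \sum_v \sum_(u | D u v) wt u v].
Proof.
have scE (D : rel 'I_n) : acyclic D ->
    score (@table_scores n (table wt n)) D = \sum_v \sum_(u | D u v) wt u v.
  move=> ac; apply: eq_bigr => v _; rewrite /table_scores.
  rewrite (eq_bigl (fun u => D u v)) => [|u]; last by rewrite inE.
  apply: eq_bigr => u Duv; apply: nth_table; apply/eqP => e.
  (* The table has no diagonal, and an acyclic digraph has no loops that would need one. *)
  by have := ac [:: v] isT; rewrite /= -{1}e Duv.
have dE (a b : nat) : (decode_int 0 a <= b%:Z)%R = (a <= b) by rewrite /decode_int lez_nat.
split=> -[D [h1 h2 h3]]; exists D; split=> //.
- by rewrite -scE // -dE.
- by rewrite /= dE scE.
Qed.

Lemma table_superstructure (a b : 'I_n) :
  superstructure (@bn_f table_bnsl) a b -> (wt a b != 0) || (wt b a != 0).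
Proof.
by rewrite /superstructure /= /table_scores !big_set1 => /andP[ab];
  rewrite !nth_table // eq_sym.
Qed.

End TableInstance.

Lemma treewidth_leq (V : finType) (G : rel V) k : treewidth_at_most G k -> treewidth G <= k.
Proof. by move=> h; rewrite /treewidth; case: ex_minnP => m _; apply; apply/asboolP. Qed.

(** Counters plus classes plus one, with [k] as the only variable quantity. *)
Definition tw_bound (d k : nat) : nat :=
  let K := k.+2 + 2 ^ d.+1 in (2 * (red_slots d * K ^ red_slots d) + (K + K ^ red_slots d)).+1.

Lemma tw_bound_mono d k k' : k <= k' -> tw_bound d k <= tw_bound d k'.
Proof.
move=> le; rewrite /tw_bound ltnS; set K := k.+2 + _; set K' := k'.+2 + _.
have leK : K <= K' by rewrite /K /K'; lia.
have leX : K ^ red_slots d <= K' ^ red_slots d.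
  by elim: (red_slots d) => // n IH; rewrite !expnS leq_mul.
by apply: leq_add; [rewrite !leq_mul2l leX !orbT|apply: leq_add].
Qed.

Lemma red_slots_gt0 d : 0 < red_slots d.
Proof. by rewrite /red_slots /csp_slots muln_gt0 expn_gt0. Qed.

Lemma red_amount_le d x cl it ct : red_amount d x cl it ct <= red_cap d x.
Proof. by apply: csp_amount_le; rewrite /red_values. Qed.

Lemma reduction_lang d x :
  lang (weighted_circuit_sat 1 d) x <-> lang bnsl_treewidth (reduction d x).
Proof.
rewrite wcs_word_csp; case: (boolP (valid d x)) => vx; last first.
  split=> [[]//|]; rewrite reduction_invalid //= => -[D [_ _]].
  by rewrite /= /score big_ord0.
rewrite (reductionE vx) lang_table table_bnsl_yes.
have [h1 h2 h3 h4 h5] := red_base_bounds d x.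
rewrite /red_size (packing_bnsl _ h1 h2 h3 h4 h5).
- rewrite (local_csp_packing _ _ _ (red_slots_gt0 d)) //.
  by split=> [[_ h]|h]; [exact: h|split].
- by rewrite /red_counters /red_cap /csp_cap; lia.
- exact: red_amount_le.
Qed.

Lemma reduction_param d x :
  param bnsl_treewidth (reduction d x) <= tw_bound d (param (weighted_circuit_sat 1 d) x).
Proof.
case: (boolP (valid d x)) => vx; last first.
  rewrite reduction_invalid //=; apply: (@leq_trans 0) => //; apply: treewidth_leq.
  exists unit, (fun _ _ => false), (fun=> set0); split; last by move=> z; rewrite cards0.
  split; [|by case|by case|by case].
  split=> //; [by rewrite card_unit|by case=> -[]|].
  by case=> [|y [|z c]] //= _; rewrite /ucycleb.
rewrite (reductionE vx) param_table.
apply: treewidth_leq.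
have [h1 h2 h3 h4 h5] := red_base_bounds d x.
have ek : wk x = head 0 x.
  by case/and4P: vx => _ a1 a2 _; rewrite /wk -nth0; apply/minn_idPl; apply: leq_trans a2 a1.
have -> : tw_bound d (param (weighted_circuit_sat 1 d) x) = (red_counters d x + red_classes d x).+1.
  by rewrite /= -ek.
apply: (packing_treewidth (q := red_cap d x) h1 h2 h3 h4 h5) => [|a b].
- by rewrite /red_counters /red_cap /csp_cap; lia.
- exact: table_superstructure.
Qed.

(** * Computing the reduction *)

Section MoreBounds.
Variable C : ctx.
Implicit Types F : env C -> nat.

Lemma pb_bool (b : env C -> bool) : pb (fun e => (b e : nat)).
Proof. by apply: pb_le (pb_const C 1) => e; apply: leq_b1. Qed.

Lemma pb_succ F : pb F -> pb (fun e => (F e).+1).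
Proof. by move=> h; apply: pb_le (pb_add (pb_const C 1) h). Qed.

Lemma pb_pred F : pb F -> pb (fun e => (F e).-1).
Proof. by apply: pb_le => e; apply: leq_pred. Qed.

Lemma pb_sub F1 F2 : pb F1 -> pb (fun e => F1 e - F2 e).
Proof. by apply: pb_le => e; apply: leq_subr. Qed.

Lemma pb_minr F1 F2 : pb F2 -> pb (fun e => minn (F1 e) (F2 e)).
Proof. by apply: pb_le => e; apply: geq_minr. Qed.

Lemma pb_if (b : env C -> bool) F1 F2 : pb F1 -> pb F2 ->
  pb (fun e => if b e then F1 e else F2 e).
Proof.
by move=> h1 h2; apply: pb_le (pb_add h1 h2) => e; case: ifP => _; rewrite ?leq_addr ?leq_addl.
Qed.

Lemma ev_eqb (b1 b2 : env C -> bool) :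
  ev (fun e => (b1 e : nat)) -> ev (fun e => (b2 e : nat)) ->
  ev (fun e => (b1 e == b2 e : nat)).
Proof.
move=> h1 h2; apply: (@ev_eq _ (fun e => ((b1 e : nat) == (b2 e : nat) : nat))).
  by move=> e; case: (b1 e); case: (b2 e).
exact: ev_eqn.
Qed.

Lemma ev_bif (b b1 b2 : env C -> bool) : ev (fun e => (b e : nat)) ->
  ev (fun e => (b1 e : nat)) -> ev (fun e => (b2 e : nat)) ->
  ev (fun e => ((if b e then b1 e else b2 e) : nat)).
Proof.
move=> h h1 h2; apply: (@ev_eq _ (fun e => if b e then (b1 e : nat) else (b2 e : nat))).
  by move=> e; case: (b e).
exact: ev_if.
Qed.

End MoreBounds.

(** Syntax-directed search, here and in [ev_step]. The hooks [pb_user] and [ev_user] are rebound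
    whenever further functions receive lemmas of their own, so that these need not be unfolded
    again. *)
Ltac pb_user := fail.
Ltac pb_step :=
  lazymatch goal with
  | |- pb (fun _ => ?n) => apply pb_const
  | |- pb (fun e => nat_of_bool (@?b e)) => apply pb_bool
  | |- pb (fun e => size (@?F e)) => apply (pb_size (X := F))
  | |- pb (fun e => S (@?F e)) => apply (pb_succ (F := F))
  | |- pb (fun e => predn (@?F e)) => apply (pb_pred (F := F))
  | |- pb (fun e => subn (@?F e) (@?G e)) => apply pb_sub
  | |- pb (fun e => addn (@?F e) (@?G e)) => apply (pb_add (F1 := F) (F2 := G))
  | |- pb (fun e => muln (@?F e) (@?G e)) => apply (pb_mul (F1 := F) (F2 := G))
  | |- pb (fun e => expn _ _) => apply pb_exp
  | |- pb (fun e => divn (@?F e) (@?G e)) => apply pb_div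
  | |- pb (fun e => modn (@?F e) (@?G e)) => apply pb_mod
  | |- pb (fun e => minn (@?F e) (@?G e)) => apply pb_minr
  | |- pb (fun e => if _ then _ else _) => apply pb_if
  | |- _ => first [pb_user | assumption]
  end.

Ltac ev_user := fail.
Ltac ev_step :=
  lazymatch goal with
  | |- ev (fun _ => ?n) => apply ev_const
  | |- ev (fun e => nat_of_bool (leq (@?F e) (@?G e))) => apply (ev_leq (F1 := F) (F2 := G))
  | |- ev (fun e => nat_of_bool (@eq_op Datatypes_nat__canonical__eqtype_Equality (@?F e) (@?G e))) =>
    apply (ev_eqn (F1 := F) (F2 := G))
  | |- ev (fun e => nat_of_bool (@eq_op Datatypes_bool__canonical__eqtype_Equality (@?F e) (@?G e))) =>
    apply (ev_eqb (b1 := F) (b2 := G))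
  | |- ev (fun e => nat_of_bool (negb (@?F e))) => apply (ev_not (b := F))
  | |- ev (fun e => nat_of_bool (andb (@?F e) (@?G e))) => apply (ev_and (b1 := F) (b2 := G))
  | |- ev (fun e => nat_of_bool (orb (@?F e) (@?G e))) => apply (ev_or (b1 := F) (b2 := G))
  | |- ev (fun e => nat_of_bool (all (@?f e) (iota 0 (@?F e)))) => apply (ev_all (Fb := F) (f := f))
  | |- ev (fun e => nat_of_bool (has (@?f e) (iota 0 (@?F e)))) => apply (ev_has (Fb := F) (f := f))
  | |- ev (fun e => size (@?F e)) => apply (ev_size (X := F))
  | |- ev (fun e => nth 0 (@?X e) (@?F e)) => apply (ev_nth (X := X) (F := F))
  | |- ev (fun e => S (@?F e)) => apply (ev_succ (F := F))
  | |- ev (fun e => predn (@?F e)) => apply (ev_pred (F := F))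
  | |- ev (fun e => addn (@?F e) (@?G e)) => apply (ev_add (F1 := F) (F2 := G))
  | |- ev (fun e => subn (@?F e) (@?G e)) => apply (ev_sub (F1 := F) (F2 := G))
  | |- ev (fun e => minn (@?F e) (@?G e)) => apply (ev_min (F1 := F) (F2 := G))
  | |- ev (fun e => expn (@?F e) (@?G e)) => first [apply ev_exp | apply ev_pow]
  | |- ev (fun e => modn (@?F e) (@?G e)) => apply (ev_mod (F1 := F) (F2 := G))
  | |- ev (fun e => divn (@?F e) (@?G e)) => apply (ev_div (F1 := F) (F2 := G))
  | |- ev (fun e => muln (@?F e) (@?G e)) => apply (ev_mul (F1 := F) (F2 := G))
  | |- ev (fun e => iteri (@?F e) (@?f e) (@?G e)) => apply (ev_iter (Fb := F) (step := f) (F0 := G))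
  | |- ev (fun e => nat_of_bool (if _ then _ else _)) => apply ev_bif
  | |- ev (fun e => if _ then _ else _) => apply ev_if
  | |- _ => first [ev_user | assumption]
  end.

Ltac evt := repeat (cbv beta zeta;
  lazymatch goal with
  | |- @ev _ _ => ev_step
  | |- @pb _ _ => pb_step
  | |- @evw _ _ => assumption
  | |- forall (_ : ctx), _ => ev_bind
  end).

Lemma pb_dg C (b c l : env C -> nat) : pb c -> pb (fun e => dg (b e) (c e) (l e)).
Proof. by move=> h; rewrite /dg; evt. Qed.

Lemma ev_dg C (b c l : env C -> nat) : ev b -> pb b -> ev c -> pb c -> ev l -> pb l ->
  ev (fun e => dg (b e) (c e) (l e)).
Proof. by move=> h1 h2 h3 h4 h5 h6; rewrite /dg; evt. Qed.

Section WordLemmas.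
Variables (C : ctx) (X : env C -> word).
Hypothesis hX : evw X.

Lemma ev_wlen F : ev F -> ev (fun e => wlen (X e) (F e)).
Proof. by move=> h; rewrite /wlen; evt. Qed.
End WordLemmas.

Ltac ev_user ::=
  lazymatch goal with
  | |- ev (fun e => dg (@?b e) (@?c e) (@?l e)) => apply ev_dg
  | |- ev (fun e => wlen (@?X e) (@?F e)) => apply ev_wlen
  end.
Ltac pb_user ::=
  lazymatch goal with
  | |- pb (fun e => dg (@?b e) (@?c e) (@?l e)) => apply pb_dg
  end.

Lemma ev_wpos C (X : env C -> word) F : evw X -> ev F -> ev (fun e => wpos (X e) (F e)).
Proof. by move=> hX h; rewrite /wpos; evt. Qed.

Ltac ev_user ::=
  lazymatch goal with
  | |- ev (fun e => dg (@?b e) (@?c e) (@?l e)) => apply ev_dg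
  | |- ev (fun e => wlen (@?X e) (@?F e)) => apply ev_wlen
  | |- ev (fun e => wpos (@?X e) (@?F e)) => apply ev_wpos
  end.

Lemma ev_wtag C (X : env C -> word) F : evw X -> ev F -> ev (fun e => wtag (X e) (F e)).
Proof. by move=> hX h; rewrite /wtag; evt. Qed.

Lemma ev_war C (X : env C -> word) F : evw X -> ev F -> ev (fun e => war (X e) (F e)).
Proof. by move=> hX h; rewrite /war /wtag; evt. Qed.

Lemma pb_war C (X : env C -> word) F : evw X -> pb (fun e => war (X e) (F e)).
Proof. by move=> hX; rewrite /war; evt. Qed.

Lemma ev_wpr C (X : env C -> word) F1 F2 : evw X -> ev F1 -> ev F2 ->
  ev (fun e => wpr (X e) (F1 e) (F2 e)).
Proof. by move=> hX h1 h2; rewrite /wpr /wtag; evt. Qed.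

Lemma ev_wG C (X : env C -> word) : evw X -> ev (fun e => wG (X e)).
Proof. by move=> hX; rewrite /wG; evt. Qed.
Lemma pb_wG C (X : env C -> word) : evw X -> pb (fun e => wG (X e)).
Proof. by move=> hX; rewrite /wG; evt. Qed.
Lemma ev_wk C (X : env C -> word) : evw X -> ev (fun e => wk (X e)).
Proof. by move=> hX; rewrite /wk; evt. Qed.
Lemma pb_wk C (X : env C -> word) : evw X -> pb (fun e => wk (X e)).
Proof. by move=> hX; rewrite /wk; evt. Qed.

Ltac ev_user ::=
  lazymatch goal with
  | |- ev (fun e => dg (@?b e) (@?c e) (@?l e)) => apply ev_dg
  | |- ev (fun e => wlen (@?X e) (@?F e)) => apply ev_wlen
  | |- ev (fun e => wpos (@?X e) (@?F e)) => apply ev_wpos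
  | |- ev (fun e => wtag (@?X e) (@?F e)) => apply ev_wtag
  | |- ev (fun e => war (@?X e) (@?F e)) => apply ev_war
  | |- ev (fun e => wpr (@?X e) (@?F e) (@?G e)) => apply ev_wpr
  | |- ev (fun e => wG (@?X e)) => apply ev_wG
  | |- ev (fun e => wk (@?X e)) => apply ev_wk
  end.
Ltac pb_user ::=
  lazymatch goal with
  | |- pb (fun e => dg (@?b e) (@?c e) (@?l e)) => apply pb_dg
  | |- pb (fun e => war (@?X e) (@?F e)) => apply pb_war
  | |- pb (fun e => wG (@?X e)) => apply pb_wG
  | |- pb (fun e => wk (@?X e)) => apply pb_wk
  end.

Lemma ev_gate_ok C (X : env C -> word) F : evw X -> ev F ->
  ev (fun e => (gate_ok (X e) (F e) : nat)).
Proof. by move=> hX h; rewrite /gate_ok; evt. Qed.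

(** The context is generalized in the induction because the recursive call sits in a loop body,
    where the index is a further variable. *)
Lemma ev_deep j : forall C (X : env C -> word) F, evw X -> ev F ->
  ev (fun e => (deep (war (X e)) (wpr (X e)) j (F e) : nat)).
Proof.
elim: j => [|j IH] C X F hX h; cbn [deep]; evt.
by apply: (IH _ (fun e => X (pr e)) (fun e => wpr (X (pr e)) (F (pr e)) (vi e))); evt.
Qed.

Lemma ev_small j : forall C (X : env C -> word) F, evw X -> ev F ->
  ev (fun e => (small (war (X e)) (wpr (X e)) j (F e) : nat)).
Proof.
elim: j => [|j IH] C X F hX h; cbn [small]; evt.
by apply: (IH _ (fun e => X (pr e)) (fun e => wpr (X (pr e)) (F (pr e)) (vi e))); evt.
Qed.

Lemma ev_weft1 j : forall C (X : env C -> word) F, evw X -> ev F ->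
  ev (fun e => (weft1 (war (X e)) (wpr (X e)) j (F e) : nat)).
Proof.
elim: j => [|j IH] C X F hX h; cbn [weft1]; evt.
- by apply: (IH _ (fun e => X (pr e)) (fun e => wpr (X (pr e)) (F (pr e)) (vi e))); evt.
- by apply: (@ev_small j _ (fun e => X (pr e)) (fun e => wpr (X (pr e)) (F (pr e)) (vi e))); evt.
Qed.

Ltac ev_user ::=
  lazymatch goal with
  | |- ev (fun e => dg _ _ _) => apply ev_dg
  | |- ev (fun e => wpos _ _) => apply ev_wpos
  | |- ev (fun e => wG _) => apply ev_wG
  | |- ev (fun e => nat_of_bool (gate_ok (@?X e) (@?F e))) => apply ev_gate_ok
  | |- ev (fun e => nat_of_bool (deep _ _ _ _)) => apply ev_deep
  | |- ev (fun e => nat_of_bool (weft1 _ _ _ _)) => apply ev_weft1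
  end.

Lemma ev_valid d C (X : env C -> word) : evw X -> ev (fun e => (valid d (X e) : nat)).
Proof. by move=> hX; rewrite /valid; evt. Qed.

Lemma ev_input_poss s C (k K N J U g : env C -> nat) (v : env C -> bool) :
  ev k -> pb k -> ev K -> pb K -> ev N -> pb N -> ev J -> pb J -> ev U -> pb U -> ev g ->
  ev (fun e => (v e : nat)) ->
  ev (fun e => (input_poss (k e) s (dg (K e) (J e)) (dg (N e) (U e)) (g e) (v e) : nat)).
Proof.
move=> h1 h2 h3 h4 h5 h6 h7 h8 h9 h10 h11 h12.
by rewrite /input_poss /known_false /known_true; evt.
Qed.

Ltac ev_user ::=
  lazymatch goal with
  | |- ev (fun e => dg (@?b e) (@?c e) (@?l e)) => apply ev_dg
  | |- ev (fun e => wlen (@?X e) (@?F e)) => apply ev_wlen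
  | |- ev (fun e => wpos (@?X e) (@?F e)) => apply ev_wpos
  | |- ev (fun e => wtag (@?X e) (@?F e)) => apply ev_wtag
  | |- ev (fun e => war (@?X e) (@?F e)) => apply ev_war
  | |- ev (fun e => wpr (@?X e) (@?F e) (@?G e)) => apply ev_wpr
  | |- ev (fun e => wG (@?X e)) => apply ev_wG
  | |- ev (fun e => wk (@?X e)) => apply ev_wk
  | |- ev (fun e => nat_of_bool (input_poss (@?k e) ?s (dg (@?K e) (@?J e)) (dg (@?N e) (@?U e)) (@?g e) (@?v e))) => apply ev_input_poss
  end.

Lemma ev_poss s j : forall C (X : env C -> word) (k K N J U g : env C -> nat) (v : env C -> bool),
  evw X ->
  ev k -> pb k -> ev K -> pb K -> ev N -> pb N -> ev J -> pb J -> ev U -> pb U -> ev g ->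
  ev (fun e => (v e : nat)) ->
  ev (fun e => (poss (wtag (X e)) (war (X e)) (wpr (X e)) (k e) s
    (dg (K e) (J e)) (dg (N e) (U e)) j (g e) (v e) : nat)).
Proof.
elim: j => [|j IH] C X k K N J U g v hX h1 h2 h3 h4 h5 h6 h7 h8 h9 h10 h11 h12.
  exact: ev_const.
cbn [poss]; evt.
- by apply: (IH C X k K N J U (fun e => wpr (X e) (g e) 0) (fun e => ~~ v e)); evt.
- by apply: (IH _ (fun e => X (pr e)) (fun e => k (pr e)) (fun e => K (pr e)) (fun e => N (pr e))
    (fun e => J (pr e)) (fun e => U (pr e)) (fun e => wpr (X (pr e)) (g (pr e)) (vi e))
    (fun e => v (pr e))); evt.
- by apply: (IH _ (fun e => X (pr e)) (fun e => k (pr e)) (fun e => K (pr e)) (fun e => N (pr e))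
    (fun e => J (pr e)) (fun e => U (pr e)) (fun e => wpr (X (pr e)) (g (pr e)) (vi e))
    (fun e => v (pr e))); evt.
Qed.

(** Like [j], the position [o] is a constant of the program: the game tree is unrolled into code,
    and only the gates are run-time values. *)
Lemma ev_chk s j : forall o C (X : env C -> word) (k K N J U g : env C -> nat) (v : env C -> bool),
  evw X ->
  ev k -> pb k -> ev K -> pb K -> ev N -> pb N -> ev J -> pb J -> ev U -> pb U -> ev g ->
  ev (fun e => (v e : nat)) ->
  ev (fun e => (chk (wtag (X e)) (war (X e)) (wpr (X e)) (k e) s
    (dg (K e) (J e)) (dg (N e) (U e)) j (g e) (v e) o : nat)).
Proof.
elim: j => [|j IH] o C X k K N J U g v hX h1 h2 h3 h4 h5 h6 h7 h8 h9 h10 h11 h12.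
  exact: ev_const.
cbn [chk]; evt.
- by apply: (IH _ C X k K N J U (fun e => wpr (X e) (g e) 0) (fun e => ~~ v e)); evt.
- by apply: (IH _ _ (fun e => X (pr e)) (fun e => k (pr e)) (fun e => K (pr e)) (fun e => N (pr e))
    (fun e => J (pr e)) (fun e => U (pr e))
    (fun e => wpr (X (pr e)) (g (pr e)) (dg (N (pr e)) (U (pr e)) (vi e)))
    (fun e => v (pr e))); evt.
- by apply: (IH _ C X k K N J U (fun e => wpr (X e) (g e) 0) v); evt.
- by apply: (IH _ C X k K N J U (fun e => wpr (X e) (g e) 1) v); evt.
- by apply: (@ev_poss s j _ (fun e => X (pr e)) (fun e => k (pr e)) (fun e => K (pr e))
    (fun e => N (pr e)) (fun e => J (pr e)) (fun e => U (pr e))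
    (fun e => wpr (X (pr e)) (g (pr e)) (vi e)) (fun e => v (pr e))); evt.
Qed.

Lemma ev_csp_rel D C (X : env C -> word) (J U : env C -> nat) :
  evw X -> ev J -> pb J -> ev U -> pb U ->
  ev (fun e => (csp_rel (wtag (X e)) (war (X e)) (wpr (X e)) (wG (X e)) (wk (X e)) D
    (J e) (U e) : nat)).
Proof.
move=> hX h1 h2 h3 h4; rewrite /csp_rel /view_ok /slot_ok /order_ok /csp_vars; evt.
by apply: (@ev_chk (csp_slots D) D 0 C X (fun e => wk (X e))
  (fun e => (wk (X e)).+2 + 2 ^ D) (fun e => (wG (X e)).+2) J U (fun e => (wG (X e)).-1)
  (fun=> true)); evt.
Qed.

Section ReductionParameters.
Variables (d : nat) (C : ctx) (X : env C -> word).
Hypothesis hX : evw X.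

Lemma ev_red_vars : ev (fun e => red_vars d (X e)). Proof. by rewrite /red_vars /csp_vars; evt; apply: ev_wk. Qed.
Lemma pb_red_vars : pb (fun e => red_vars d (X e)). Proof. by rewrite /red_vars /csp_vars; evt. Qed.
Lemma ev_red_values : ev (fun e => red_values (X e)). Proof. by rewrite /red_values; evt; apply: ev_wG. Qed.
Lemma pb_red_values : pb (fun e => red_values (X e)). Proof. by rewrite /red_values; evt. Qed.
End ReductionParameters.

Ltac ev_user ::=
  lazymatch goal with
  | |- ev (fun e => dg _ _ _) => apply ev_dg
  | |- ev (fun e => red_vars _ _) => apply ev_red_vars
  | |- ev (fun e => red_values _) => apply ev_red_values
  end.
Ltac pb_user ::=
  lazymatch goal with
  | |- pb (fun e => dg _ _ _) => apply pb_dg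
  | |- pb (fun e => red_vars _ _) => apply pb_red_vars
  | |- pb (fun e => red_values _) => apply pb_red_values
  end.

Section ReductionParameters2.
Variables (d : nat) (C : ctx) (X : env C -> word).
Hypothesis hX : evw X.

Lemma ev_red_counters : ev (fun e => red_counters d (X e)). Proof. by rewrite /red_counters /csp_counters; evt. Qed.
Lemma pb_red_counters : pb (fun e => red_counters d (X e)). Proof. by rewrite /red_counters /csp_counters; evt. Qed.
Lemma ev_red_cap : ev (fun e => red_cap d (X e)). Proof. by rewrite /red_cap /csp_cap /csp_counters; evt. Qed.
Lemma pb_red_cap : pb (fun e => red_cap d (X e)). Proof. by rewrite /red_cap /csp_cap /csp_counters; evt. Qed.
Lemma ev_red_classes : ev (fun e => red_classes d (X e)). Proof. by rewrite /red_classes; evt. Qed.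
Lemma pb_red_classes : pb (fun e => red_classes d (X e)). Proof. by rewrite /red_classes; evt. Qed.
Lemma ev_red_items : ev (fun e => red_items d (X e)). Proof. by rewrite /red_items; evt. Qed.
Lemma pb_red_items : pb (fun e => red_items d (X e)). Proof. by rewrite /red_items; evt. Qed.
End ReductionParameters2.

Ltac ev_user ::=
  lazymatch goal with
  | |- ev (fun e => dg _ _ _) => apply ev_dg
  | |- ev (fun e => red_vars _ _) => apply ev_red_vars
  | |- ev (fun e => red_values _) => apply ev_red_values
  | |- ev (fun e => red_counters _ _) => apply ev_red_counters
  | |- ev (fun e => red_cap _ _) => apply ev_red_cap
  | |- ev (fun e => red_classes _ _) => apply ev_red_classes
  | |- ev (fun e => red_items _ _) => apply ev_red_items
  | |- ev (fun e => nat_of_bool (csp_rel _ _ _ _ _ _ _ _)) => apply ev_csp_rel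
  end.
Ltac pb_user ::=
  lazymatch goal with
  | |- pb (fun e => dg _ _ _) => apply pb_dg
  | |- pb (fun e => red_vars _ _) => apply pb_red_vars
  | |- pb (fun e => red_values _) => apply pb_red_values
  | |- pb (fun e => red_counters _ _) => apply pb_red_counters
  | |- pb (fun e => red_cap _ _) => apply pb_red_cap
  | |- pb (fun e => red_classes _ _) => apply pb_red_classes
  | |- pb (fun e => red_items _ _) => apply pb_red_items
  end.

Section ReductionParameters3.
Variables (d : nat) (C : ctx) (X : env C -> word).
Hypothesis hX : evw X.

Lemma ev_red_base : ev (fun e => red_base d (X e)). Proof. by rewrite /red_base; evt. Qed.
Lemma pb_red_base : pb (fun e => red_base d (X e)). Proof. by rewrite /red_base; evt. Qed.

Lemma ev_red_ok (cl it : env C -> nat) : ev cl -> pb cl -> ev it -> pb it ->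
  ev (fun e => (red_ok d (X e) (cl e) (it e) : nat)).
Proof. by move=> h1 h2 h3 h4; rewrite /red_ok /csp_item_ok; evt. Qed.

Lemma ev_red_amount (cl it ct : env C -> nat) : ev cl -> pb cl -> ev it -> pb it -> ev ct -> pb ct ->
  ev (fun e => red_amount d (X e) (cl e) (it e) (ct e)).
Proof.
by move=> h1 h2 h3 h4 h5 h6; rewrite /red_amount /csp_amount /csp_cap /csp_counters; evt.
Qed.
End ReductionParameters3.

Ltac ev_user ::=
  lazymatch goal with
  | |- ev (fun e => dg _ _ _) => apply ev_dg
  | |- ev (fun e => red_base _ _) => apply ev_red_base
  | |- ev (fun e => red_counters _ _) => apply ev_red_counters
  | |- ev (fun e => red_cap _ _) => apply ev_red_cap
  | |- ev (fun e => red_classes _ _) => apply ev_red_classes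
  | |- ev (fun e => red_items _ _) => apply ev_red_items
  | |- ev (fun e => nat_of_bool (red_ok _ _ _ _)) => apply ev_red_ok
  | |- ev (fun e => red_amount _ _ _ _ _) => apply ev_red_amount
  end.
Ltac pb_user ::=
  lazymatch goal with
  | |- pb (fun e => dg _ _ _) => apply pb_dg
  | |- pb (fun e => red_base _ _) => apply pb_red_base
  | |- pb (fun e => red_counters _ _) => apply pb_red_counters
  | |- pb (fun e => red_cap _ _) => apply pb_red_cap
  | |- pb (fun e => red_classes _ _) => apply pb_red_classes
  | |- pb (fun e => red_items _ _) => apply pb_red_items
  end.

Section ReductionParameters4.
Variables (d : nat) (C : ctx) (X : env C -> word).
Hypothesis hX : evw X.

Lemma ev_red_size : ev (fun e => red_size d (X e)). Proof. by rewrite /red_size /vsize; evt. Qed.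
Lemma pb_red_size : pb (fun e => red_size d (X e)). Proof. by rewrite /red_size /vsize; evt. Qed.

Lemma ev_red_kind (v : env C -> nat) : ev v -> pb v -> ev (fun e => red_kind d (X e) (v e)).
Proof. by move=> h1 h2; rewrite /red_kind /vkind; evt. Qed.

Lemma ev_vsel (v : env C -> nat) : ev v -> pb v -> ev (fun e => vsel (red_base d (X e)) (v e)).
Proof. by move=> h1 h2; rewrite /vsel /vcode /hcode; cbn [foldr]; evt. Qed.

Lemma ev_vctr (v : env C -> nat) : ev v -> pb v -> ev (fun e => vctr (red_base d (X e)) (v e)).
Proof. by move=> h1 h2; rewrite /vctr /vcode /hcode; cbn [foldr]; evt. Qed.

Lemma ev_vnext (v : env C -> nat) : ev v -> pb v -> ev (fun e => vnext (red_base d (X e)) (v e)).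
Proof. by move=> h1 h2; rewrite /vnext /vhub /vcode /hcode; cbn [foldr]; evt. Qed.

End ReductionParameters4.

Ltac ev_user ::=
  lazymatch goal with
  | |- ev (fun e => red_size _ _) => apply ev_red_size
  | |- ev (fun e => red_cap _ _) => apply ev_red_cap
  | |- ev (fun e => red_kind _ _ _) => apply ev_red_kind
  | |- ev (fun e => vsel _ _) => apply ev_vsel
  | |- ev (fun e => vctr _ _) => apply ev_vctr
  | |- ev (fun e => vnext _ _) => apply ev_vnext
  | |- ev (fun e => nat_of_bool (valid _ _)) => apply ev_valid
  end.
Ltac pb_user ::=
  lazymatch goal with
  | |- pb (fun e => red_size _ _) => apply pb_red_size
  | |- pb (fun e => red_cap _ _) => apply pb_red_cap
  end.

(** Stated with the [red_] functions folded, so that [evt] can apply their lemmas. *)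
Lemma red_weightE d x u v : red_weight d x u v =
  (4 * red_size d x + 1) *
    ((red_kind d x v == 1) && ((red_kind d x u == 0) || (red_kind d x u == 4) && (vsel (red_base d x) u == v)))
  + ((red_kind d x u == 3) && (vnext (red_base d x) u == v)) + ((red_kind d x u == 3) && (vctr (red_base d x) u == v))
  + ((red_kind d x v == 3) && (vsel (red_base d x) v == u)) + ((red_kind d x u == 2) && (vsel (red_base d x) u == v)).
Proof. by []. Qed.

Section ReductionParameters5.
Variables (d : nat) (C : ctx) (X : env C -> word).
Hypothesis hX : evw X.

Lemma ev_red_weight (u v : env C -> nat) : ev u -> pb u -> ev v -> pb v ->
  ev (fun e => red_weight d (X e) (u e) (v e)).
Proof. by move=> h1 h2 h3 h4; apply: (ev_eq (fun e => esym (red_weightE _ _ _ _))); evt. Qed.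

Lemma ev_red_goal : ev (fun e => red_goal d (X e)).
Proof.
rewrite /red_goal /vgoal; apply: (ev_sum (Fb := fun e => red_size d (X e)) (f := fun e v =>
  (red_kind d (X e) v == 1) * ((4 * red_size d (X e) + 1) * (red_cap d (X e)).-1 + 1)
  + (red_kind d (X e) v == 3) * 2)); evt.
Qed.

Lemma ev_red_length : ev (fun e => red_length d (X e)).
Proof. by rewrite /red_length; evt. Qed.

Lemma pb_red_length : pb (fun e => red_length d (X e)).
Proof. by rewrite /red_length; evt. Qed.

End ReductionParameters5.

Lemma ev_red_letter d C (X : env C -> word) (i : env C -> nat) : evw X -> ev i -> pb i ->
  ev (fun e => red_letter d (X e) (i e)).
Proof.
move=> hX h1 h2; rewrite /red_letter; evt.
- exact: ev_red_goal.
- by apply: (ev_red_weight d hX (u := fun e => _) (v := fun e => _)); evt.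
Qed.

(** * Assembling the fpt-reduction *)

Lemma output_holds s y : output s = y -> holds y s.
Proof.
move=> <-; rewrite /output; split=> [|i]; first by rewrite size_mkseq.
by rewrite size_mkseq => lt; rewrite nth_mkseq.
Qed.

Lemma reduction_program d : exists (c : cmd) (e : nat), forall y s, output s = y ->
  exists t s', [/\ exec c s t s', t + size (reduction d y) <= (size y).+2 ^ e
    & output s' = reduction d y].
Proof.
have m1 (x : word) : 1 < (size x).+2 by [].
have msz (x : word) : size x <= (size x).+2 by lia.
have hid : @evw (top m1 msz) id by [].
have [c [e1 hc]] := ev_program (ev_red_length d hid) (pb_red_length d hid)
  (fun C pr vi (W : @extends (top m1 msz) C pr) hi pi =>
     let: And3 _ _ W3 := W in ev_red_letter d (W3 id hid) hi pi).
have [e2 hl] := pb_red_length d hid.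
exists c, (e1 + e2).+1 => y s /output_holds hy.
have [t [s' [h1 h2 h3]]] := hc y s hy; exists t, s'; split=> //.
apply: leq_trans (poly_add e1 e2 (m1 y)); apply: leq_add => //.
by rewrite size_mkseq; apply: (hl y s).
Qed.

(** Computability carries no time bound, so the measure may include the value of the letter, which
    thereby counts as polynomially bounded. *)
Lemma computable_comp (P f : nat -> nat) :
  (forall C (F : env C -> nat), ev F -> pb F -> ev (fun e => P (F e))) ->
  computable f -> computable (fun n => P (f n)).
Proof.
move=> hP [cf hf].
pose m (x : word) := nth 0 x 0 + (size x).+2.
have m1 x : 1 < m x by rewrite /m; lia.
have msz x : size x <= m x by rewrite /m; lia.
have hid : @evw (top m1 msz) id by [].
have pn : @pb (top m1 msz) (fun x => nth 0 x 0).
  by exists 1 => x s _; rewrite expn1 /= /m leq_addr.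
have [c [e hc]] := @ev_program m m1 msz (fun=> 1) (fun x _ => P (nth 0 x 0))
  (@ev_const _ 1) (@pb_const _ 1)
  (fun C pr vi (W : @extends (top m1 msz) C pr) hi pi =>
     let: And3 _ W2 W3 := W in
     hP _ _ (ev_nth (W3 id hid) (@ev_const _ 0)) (W2 _ pn)).
exists (Seq cf c) => n; have [t [t1 [s1 [x1 o1 _]]]] := hf n.
have [t2 [s2 [x2 _ o2]]] := hc _ _ (output_holds o1).
exists (t1 + t2 + 1), (t1 + t2), s2; split=> //.
exact: ExecSeq x1 x2.
Qed.

Theorem theorem8 : W_hard 1 bnsl_treewidth.
Proof.
move=> A [d [cA [RA [f [g [eA [cf cg hA hl hp]]]]]]].
have [c2 [e hc2]] := reduction_program d.
exists (Seq cA c2), (fun x => reduction d (RA x)), (fun k => (f k + 2) ^ e.+2),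
  (fun k => tw_bound d (g k)), (eA * e.+2).
split.
- apply: (@computable_comp (fun v => (v + 2) ^ e.+2)) => // C F h1 h2; evt.
- apply: (@computable_comp (tw_bound d)) => // C F h1 h2; rewrite /tw_bound; evt.
- move=> x; have [t [s [x1 o1 le1]]] := hA x.
  have [t2 [s2 [x2 le2 o2]]] := hc2 _ _ o1.
  exists (t + t2), s2; split=> //; first exact: ExecSeq x1 x2.
  set b := (bitsize x).+1 in le1 *; set k := param A x in le1 *.
  (* [T] bounds the time of the first program and the length of its output, so the second one takes
     at most [(T + 2) ^ e] steps. The sum is at most [(T + 2) ^ e.+2], where
     [T + 2 <= (f k + 2) * b ^ eA] separates the parameter from the input size. *)
  set T := f k * b ^ eA in le1.
  have b0 : 0 < b ^ eA by rewrite expn_gt0.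
  have T2 : T + 2 <= (f k + 2) * b ^ eA by rewrite /T; nia.
  rewrite expnM -expnMn.
  apply: (@leq_trans ((T + 2) ^ e.+2)); last by rewrite leq_exp2r.
  apply: (@leq_trans ((T + 2) ^ 1 + (T + 2) ^ e)); last first.
    by apply: leq_trans (poly_add 1 e _) _ => //; lia.
  have : (size (RA x)).+2 ^ e <= (T + 2) ^ e.
    by case: (e) => // e'; rewrite leq_exp2r //; lia.
  by rewrite expn1; lia.
- by move=> x; rewrite hl reduction_lang.
- move=> x; apply: leq_trans (reduction_param d (RA x)) _.
  exact: tw_bound_mono.
Qed.
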